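(* Let $X$ be a L\'evy process with $X_0=0$ and let $0\le b<1$. (a) Assume $X_t/B(t)\to 1$ in probability as $t\to 0$, where $B(t)>0$ is a non-stochastic function. Then $B(t)/t^b$ may be chosen to be continuous and strictly increasing, in which case $\overline{T}_b(r)/C(r)\to 1$ in probability as $r\to 0$, where $C(r)$ is the inverse function to $t\mapsto B(t)/t^b$. Conversely, assume $\overline{T}_b(r)/C(r)\to 1$ in probability as $r\to 0$, where $C(r)>0$ is a finite non-stochastic function. Then $C(r)$ may be taken to be continuous and strictly increasing with inverse $C^{-1}$, in which case $X_t/B(t)\to 1$ in probability as $t\to 0$, where $B(t)=t^bC^{-1}(t)$. (b) Assume $|X_t|/B(t)\to 1$ in probability as $t\to 0$, where $B(t)>0$ is a non-stochastic function. Then $B(t)/t^b$ may be chosen to be continuous and strictly increasing, in which case $T^*_b(r)/C(r)\to 1$ in probability as $r\to 0$, where $C(r)$ is the inverse function to $t\mapsto B(t)/t^b$. Conversely, assume $T^*_b(r)/C(r)\to 1$ in probability as $r\to 0$, where $C(r)>0$ is a finite non-stochastic function. Then $C(r)$ may be taken to be continuous and strictly increasing with inverse $C^{-1}$, in which case $|X_t|/B(t)\to 1$ in probability as $t\to 0$, where $B(t)=t^bC^{-1}(t)$. In either case, (a) or (b), the function $C(r)$ is regularly varying with index $1/(1-b)$ as $r\to 0$.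
   Context: $X$ is a real-valued L\'evy process. For $r\ge 0$, $$\overline{T}_b(r)=\inf\{t\ge 0: X_t>rt^b\},\qquad T^*_b(r)=\inf\{t\ge 0:|X_t|>rt^b\},$$ with $\inf\emptyset=+\infty$ (and $t^0=1$ for all $t\ge0$); convergence in probability to $1$ of these $[0,\infty]$-valued ratios includes that the times are finite with probability approaching 1. All limits as $t\to0$ or $r\to 0$ are one-sided, from above, and functions such as $B$, $C$ and their inverses matter only on a right neighbourhood of $0$. Saying that a norming function ''may be chosen/taken'' to have a property means that it can be replaced by another positive function having that property for which the assumed convergence still holds. *)

(* Defs.v *)
From HB Require Import structures.
From mathcomp Require Import all_boot all_order all_algebra.
From mathcomp Require Import all_classical all_reals all_analysis.

Set Implicit Arguments.
Unset Strict Implicit.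
Unset Printing Implicit Defensive.

Import Order.TTheory GRing.Theory Num.Theory.
Import numFieldNormedType.Exports.

Local Open Scope classical_set_scope.
Local Open Scope ring_scope.

(* Processes are indexed by R, but only times t >= 0 are ever constrained or
   used.  Every path is cadlag, so first passage times over r * t `^ b are
   measurable.  Continuity in probability is not listed because it follows
   from cadlag paths and stationary increments.  Taking some A i = setT in
   levy_indep gives the product rule for subfamilies of increments. *)
Record levy_process (R : realType) (d : measure_display)
    (Omega : measurableType d) (P : probability Omega R)
    (X : R -> Omega -> R) : Prop := LevyProcess {
  levy_meas : forall t, 0 <= t -> measurable_fun setT (X t) ;
  levy_start : {ae P, forall w, X 0 w = 0} ;
  levy_indep : forall (n : nat) (t : nat -> R) (A : nat -> set R),
    0 <= t 0%N ->
    (forall i, (i < n)%N -> t i <= t i.+1) ->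
    (forall i, measurable (A i)) ->
    P (\bigcap_(i < n) [set w | A i (X (t i.+1) w - X (t i) w)]) =
    (\prod_(i < n) P [set w | A i (X (t i.+1) w - X (t i) w)%R])%E ;
  levy_stationary : forall (s t : R) (A : set R),
    0 <= s -> 0 <= t -> measurable A ->
    P [set w | A (X (s + t) w - X s w)] = P [set w | A (X t w - X 0 w)] ;
  levy_right_continuous : forall w (t : R), 0 <= t ->
    X s w @[s --> t^'+] --> X t w ;
  levy_left_limit : forall w (t : R), 0 < t ->
    cvg (X s w @[s --> t^'-])
}.

(* inf {t >= 0 : X_t > r t^b}, with value +oo on the empty set; powR satisfies
   0 `^ 0 = 1 and 0 `^ b = 0 for b != 0. *)
Definition upper_passage_time (R : realType) (Omega : Type)
    (X : R -> Omega -> R) (b r : R) (w : Omega) : \bar R :=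
  ereal_inf [set t%:E | t in [set t : R | 0 <= t /\ r * t `^ b < X t w]].

Definition two_sided_passage_time (R : realType) (Omega : Type)
    (X : R -> Omega -> R) (b r : R) (w : Omega) : \bar R :=
  ereal_inf [set t%:E | t in [set t : R | 0 <= t /\ r * t `^ b < `|X t w|]].

(* Y s / N s --> 1 in probability as s decreases to 0.  A value Y s w = +oo
   makes the deviation +oo when N s > 0, so the convergence forces Y s to be
   finite with probability tending to 1. *)
Definition ratio_cvg1_in_prob (R : realType) (d : measure_display)
    (Omega : measurableType d) (P : probability Omega R)
    (Y : R -> Omega -> \bar R) (N : R -> R) : Prop :=
  forall eps : R, 0 < eps ->
    P [set w | (eps%:E < `| Y s w * ((N s)^-1)%:E - 1|)%E] @[s --> 0^'+]
      --> 0%E.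

Definition positive_near0 (R : realType) (f : R -> R) : Prop :=
  \forall s \near 0^'+, 0 < f s.

Definition cont_incr_near0 (R : realType) (f : R -> R) : Prop :=
  exists2 delta : R, 0 < delta &
    {in `]0, delta[, continuous f} /\
    {in `]0, delta[ &, {homo f : s t / s < t}}.

(* f and g restrict to mutually inverse bijections between some ]0, delta[
   and some ]0, eta[. *)
Definition inverse_near0 (R : realType) (f g : R -> R) : Prop :=
  exists delta eta : R,
    [/\ 0 < delta, 0 < eta,
        (forall s, s \in `]0, delta[ -> g (f s) = s /\ f s \in `]0, eta[) &
        (forall r, r \in `]0, eta[ -> f (g r) = r /\ g r \in `]0, delta[)].

Definition power_scaling_at0 (R : realType) (rho : R) (f : R -> R) : Prop :=
  forall lambda : R, 0 < lambda ->
    f (lambda * r) / f r @[r --> 0^'+] --> lambda `^ rho.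

Definition regularly_varying_at0 (R : realType) (rho : R) (f : R -> R)
    : Prop :=
  [/\ positive_near0 f,
      exists2 delta : R, 0 < delta & measurable_fun `]0, delta[%classic f &
      power_scaling_at0 rho f].

(* Main.v *)
(** If [X t] concentrates near [c], conditioning on the increment [X t - X s]
    shows that every [X s] with [s <= t] concentrates near some [m s].
    Stationary independent increments make [m] almost additive, hence almost
    linear, and Ottaviani's inequality upgrades this to uniform closeness of the
    path to the line [s * (c / t)].  In case (b), halving [t] shows that [|X t|]
    can concentrate only if [X t] itself picks a sign.  So [B] is almost linear
    at every small scale, [B t / t `^ b] varies regularly with index [1 - b],
    and near time [C r] the boundary, concave since [b < 1], is crossed by a
    path that is nearly a line; crossings at much earlier times are excluded by
    a chaining bound over geometric scales.

    Conversely, a deterministic passage time keeps the path below the boundary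
    up to time about [C r] and forces it above just after.  Cutting time into
    short blocks shows that upward increments over a short window are small
    compared with the boundary, so [X u] (or [|X u|]) is already concentrated near the
    boundary at some [u] slightly below [C r].  Letting [r] run through a
    geometric sequence, with [C (r / 2)] and [C r] comparable, gives
    concentration at every small time; the direct part then identifies [C] up to
    asymptotic equivalence. *)
Require Import Defs.
From HB Require Import structures.
From mathcomp Require Import all_boot all_order all_algebra.
From mathcomp Require Import all_classical all_reals all_analysis.
From mathcomp Require Import measurable_realfun.
From mathcomp Require Import ring lra zify.

Set Implicit Arguments.
Unset Strict Implicit.
Unset Printing Implicit Defensive.

Import Order.TTheory GRing.Theory Num.Theory.
Import numFieldNormedType.Exports.

Local Open Scope classical_set_scope.
Local Open Scope ring_scope.

(** * High-probability events *)

(** All estimates are kept at a fixed tolerance: for each [e], near 0, an event of probability at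
    least [1 - e]. Deterministic relations between norming constants are then read off a single
    path, because events whose errors add up to less than 1 share an outcome. The obstacle is that
    no regularity of [B] or [C] is given, and that closeness to the line on [0, t] has error
    [e * B t]: it is measured at the end of the line and says nothing about times much smaller than
    [t]. At times comparable with [t], the strict gap between the line and the concave boundary
    absorbs this error. Across scales, one passes from a time to a fixed fraction of it with strict
    slack, so that constants do not deteriorate with the number of steps; for paths, independence of
    N blocks improves an error [e] to order [e / N], which makes the errors summable over all scales
    down to 0. *)

Section WithHighProbability.
Context {R : realType} {d : measure_display} {Omega : measurableType d}.
Variable P : probability Omega R.
Implicit Types (e : R) (E F : set Omega).

(** An inner form of probability at least [1 - e]. Most events below quantify over all times of an
    interval, an uncountable intersection whose measurability would otherwise have to be proved each
    time. *)
Definition whp e E := exists F, [/\ measurable F, F `<=` E & ((1 - e)%:E <= P F)%E].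

Lemma le_prob E F : measurable E -> measurable F -> E `<=` F -> (P E <= P F)%E.
Proof. by move=> mE mF EF; apply: le_measure => //; rewrite inE. Qed.

Lemma whpP e E : measurable E -> whp e E <-> ((1 - e)%:E <= P E)%E.
Proof.
move=> mE; split=> [[F [mF FE h]]|h]; last by exists E; split.
by apply: le_trans h _; exact: le_prob.
Qed.

Lemma whpCP e E : measurable E -> whp e E <-> (P (~` E) <= e%:E)%E.
Proof.
move=> mE; rewrite whpP // probability_setC //.
rewrite -(fineK (fin_num_measure P _ mE)) -EFinB !lee_fin; split; lra.
Qed.

Lemma whpS e E e' E' : whp e E -> E `<=` E' -> e <= e' -> whp e' E'.
Proof.
move=> [F [mF FE h]] EE' ee'; exists F; split => //.
  exact: subset_trans EE'.
by apply: le_trans h; rewrite lee_fin; lra.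
Qed.

Lemma whpI e1 E1 e2 E2 : whp e1 E1 -> whp e2 E2 -> whp (e1 + e2) (E1 `&` E2).
Proof.
move=> [F [mF FE h]] [G [mG GE k]]; exists (F `&` G); split.
- exact: measurableI.
- exact: setISS.
- apply/(whpP _ (measurableI _ _ mF mG))/whpCP; first exact: measurableI.
  rewrite setCI; apply: le_trans (measureU2 P (measurableC mF) (measurableC mG)) _.
  rewrite EFinD; apply: leeD; apply/whpCP => //; first by exists F; split.
  by exists G; split.
Qed.

(** The source of every deterministic comparison: applied to an intersection of events with total
    error below 1, it yields one path on which all the estimates hold. *)
Lemma whp_nonempty e E : e < 1 -> whp e E -> E !=set0.
Proof.
move=> e1 [F [mF FE h]].
have [F0|/set0P[x Fx]] := eqVneq F set0; last by exists x; apply: FE.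
by move: h; rewrite F0 measure0 lee_fin; lra.
Qed.

Lemma whp_ae E : {ae P, forall w, E w} -> whp 0 E.
Proof.
move=> [N [mN N0 EN]]; exists (~` N); split.
- exact: measurableC.
- by move=> w Nw; apply: contrapT => /EN.
- by rewrite probability_setC // N0 sube0 subr0.
Qed.

(** Countable subadditivity on the complements of the inner events; it serves to control all
    geometric scales down to time 0 at once. *)
Lemma whp_bigcap (e : nat -> R) (s : R) (E : nat -> set Omega) :
  (forall k, whp (e k) (E k)) ->
  (forall n, \sum_(k < n) e k <= s) -> whp s (\bigcap_k E k).
Proof.
move=> /choice[F hF] es; exists (\bigcap_k F k); split.
- by apply: bigcapT_measurable => k; case: (hF k).
- by move=> w Fw k _; case: (hF k) => _ + _; apply; exact: Fw.
- have mF k : measurable (F k) by case: (hF k).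
  apply/(whpP _ (bigcapT_measurable mF))/whpCP; first exact: bigcapT_measurable.
  rewrite setC_bigcap; apply: le_trans (generalized_Boole_inequality P (fun k => measurableC (mF k)) _) _.
    by apply: bigcupT_measurable => k; exact: measurableC.
  have PFe k : (P (~` F k) <= (e k)%:E)%E.
    by apply/whpCP => //; exists (F k); split => //; case: (hF k).
  have e0 k : 0 <= e k.
    by have := le_trans (measure_ge0 P (~` F k)) (PFe k); rewrite lee_fin.
  apply: lime_le; first exact: is_cvg_nneseries.
  near=> n; rewrite big_mkord; apply: (le_trans (y := (\sum_(k < n) (e k)%:E)%E)).
    by apply: lee_sum => k _; exact: PFe.
  by rewrite sumEFin lee_fin; exact: es.
Unshelve. all: by end_near. Qed.

End WithHighProbability.

Section MeasurableEvents.
Context {R : realType} {d : measure_display} {Omega : measurableType d}.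
Implicit Types (f : Omega -> R) (A : set R) (a : R).

Lemma measurable_event f A : measurable_fun setT f -> measurable A ->
  measurable [set w | A (f w)].
Proof. by move=> mf mA; have := mf measurableT A mA; rewrite setTI. Qed.

Lemma measurable_event_le f a : measurable_fun setT f ->
  measurable [set w | f w <= a].
Proof.
move=> mf; have := measurable_event mf (measurable_itv `]-oo, a]).
by congr measurable; apply/seteqP; split => w /=; rewrite in_itv.
Qed.

Lemma measurable_event_gt f a : measurable_fun setT f ->
  measurable [set w | a < f w].
Proof.
move=> mf; have := measurable_event mf (measurable_itv `]a, +oo[).
by congr measurable; apply/seteqP; split => w /=; rewrite in_itv /= andbT.
Qed.

Lemma measurable_fun_dist f a : measurable_fun setT f ->
  measurable_fun setT (fun w => `|f w - a|).
Proof.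
move=> mf; apply: measurableT_comp => //.
by apply: measurable_funB => //; exact: measurable_cst.
Qed.

Lemma measurable_near (c a : R) : measurable [set x : R | `|x - c| <= a].
Proof.
have -> : [set x : R | `|x - c| <= a] = `[c - a, c + a]%classic.
  by apply/seteqP; split => x /=; rewrite in_itv /= ler_distl.
exact: measurable_itv.
Qed.

End MeasurableEvents.

(** * Levy processes *)

Section LevyBasics.
Context {R : realType} {d : measure_display} {Omega : measurableType d}.
Variable P : probability Omega R.
Implicit Types (X : R -> Omega -> R) (A B : set R) (s t h : R).

Lemma eq_prob_ae (E F : set Omega) : measurable E -> measurable F ->
  {ae P, forall w, E w <-> F w} -> P E = P F.
Proof.
move=> mE mF [N [mN N0 EN]].
have sub (G H : set Omega) : measurable G -> measurable H ->
    (forall w, ~ N w -> G w -> H w) -> (P G <= P H)%E.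
  move=> mG mH GH; have : (P (H `|` N) <= P H + P N)%E by exact: measureU2.
  rewrite N0 adde0; apply: le_trans; apply: le_prob => //; first exact: measurableU.
  move=> w Gw; have [Nw|Nw] := pselect (N w); [by right|left; exact: GH].
have NEF w : ~ N w -> (E w <-> F w) by move=> Nw; apply: contrapT => /EN.
by apply/eqP; rewrite eq_le; apply/andP; split; apply: sub => // w /NEF [].
Qed.

Lemma levy_measurable X t : levy_process P X -> 0 <= t -> measurable_fun setT (X t).
Proof. by move=> hX; exact: levy_meas hX t. Qed.

Lemma levy_measurable_incr X s t : levy_process P X -> 0 <= s -> 0 <= t ->
  measurable_fun setT (fun w => X t w - X s w).
Proof.
by move=> hX s0 t0; apply: measurable_funB; exact: levy_measurable.
Qed.

Lemma levy_start0 X t A : levy_process P X -> 0 <= t -> measurable A ->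
  P [set w | A (X t w - X 0 w)] = P [set w | A (X t w)].
Proof.
move=> hX t0 mA; apply: eq_prob_ae.
- by apply: measurable_event => //; exact: levy_measurable_incr.
- by apply: measurable_event => //; exact: levy_measurable.
- apply: filterS (levy_start hX) => w /= ->; by rewrite subr0.
Qed.

Lemma levy_incr X s t A : levy_process P X -> 0 <= s -> 0 <= t -> measurable A ->
  P [set w | A (X (s + t) w - X s w)] = P [set w | A (X t w)].
Proof.
move=> hX s0 t0 mA; exact: etrans (levy_stationary hX s0 t0 mA) (levy_start0 hX t0 mA).
Qed.

Lemma levy_whp_incr X s t A e : levy_process P X -> 0 <= s -> 0 <= t -> measurable A ->
  whp P e [set w | A (X t w)] -> whp P e [set w | A (X (s + t) w - X s w)].
Proof.
move=> hX s0 t0 mA.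
rewrite !whpP; first by rewrite (levy_incr hX s0 t0 mA).
- apply: measurable_event => //; apply: levy_measurable_incr => //; exact: addr_ge0.
- by apply: measurable_event => //; exact: levy_measurable.
Qed.

Lemma levy_opp X : levy_process P X -> levy_process P (fun t w => - X t w).
Proof.
move=> hX; have mopp A : measurable A -> measurable [set x : R | A (- x)].
  move=> mA; have mo : measurable_fun setT (fun x : R => - x) by apply: oppr_measurable.
  by have := mo measurableT A mA; rewrite setTI.
have oppD (x y : R) : - x - - y = - (x - y) by rewrite opprB opprK addrC.
split.
- move=> t t0; apply: measurableT_comp; [exact: oppr_measurable|exact: levy_measurable].
- by apply: filterS (levy_start hX) => w /= ->; rewrite oppr0.
- move=> n t A t0 tle mA.
  have := levy_indep hX (A := fun i => [set x | A i (- x)]) t0 tle (fun i => mopp _ (mA i)).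
  move=> h; apply: etrans (etrans _ h) _.
    by congr (P _); apply: eq_bigcapr => i _; apply/seteqP; split => w /=; rewrite oppD.
  by apply: eq_bigr => i _; congr (P _); apply/seteqP; split => w /=; rewrite oppD.
- move=> s t A s0 t0 mA; apply: etrans (etrans _ (levy_stationary hX s0 t0 (mopp _ mA))) _.
    by congr (P _); apply/seteqP; split => w /=; rewrite oppD.
  by congr (P _); apply/seteqP; split => w /=; rewrite oppD.
- by move=> w t t0; apply: cvgN; exact: (levy_right_continuous hX).
- by move=> w t t0; apply: is_cvgN; exact: (levy_left_limit hX).
Qed.

Lemma levy_indep2 X s t A B : levy_process P X -> 0 <= s -> 0 <= t ->
  measurable A -> measurable B ->
  P [set w | A (X s w) /\ B (X (s + t) w - X s w)] =
  (P [set w | A (X s w)] * P [set w | B (X t w)])%E.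
Proof.
move=> hX s0 t0 mA mB.
pose u i : R := match i with 0%N => 0 | 1%N => s | _ => s + t end.
pose C i := match i with 0%N => A | _ => B end.
have h := @levy_indep _ _ _ _ _ hX 2 u C (lexx 0).
have : P (\bigcap_(i < 2) [set w | C i (X (u i.+1) w - X (u i) w)]) =
    (\prod_(i < 2) P [set w | C i (X (u i.+1) w - X (u i) w)%R])%E.
  apply: h; last by case.
  by case=> [|[|//]] _ //=; rewrite lerDl.
rewrite big_ord_recr /= big_ord1 /=.
rewrite (levy_start0 hX s0 mA) (levy_incr hX s0 t0 mB) => <-.
apply: eq_prob_ae.
- apply: measurableI; apply: measurable_event => //; first exact: levy_measurable.
  by apply: levy_measurable_incr => //; exact: addr_ge0.
- apply: bigcap_measurable => [|i]; first by exists 0%N.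
  case: i => [|[|//]] _ /=; apply: measurable_event => //; apply: levy_measurable_incr => //.
  exact: addr_ge0.
- apply: filterS (levy_start hX) => w /= X0; split.
    by case=> hA hB [|[|//]] _ //=; rewrite X0 subr0.
  move=> h'; split; last exact: (h' 1%N).
  by have := h' 0%N isT; rewrite /= X0 subr0.
Qed.

Lemma levy_indep_grid X h n (A : nat -> set R) : levy_process P X -> 0 <= h ->
  (forall i, measurable (A i)) ->
  P (\bigcap_(i < n) [set w | A i (X (h * i.+1%:R) w - X (h * i%:R) w)]) =
  (\prod_(i < n) P [set w | A i (X h w)])%E.
Proof.
move=> hX h0 mA.
rewrite (levy_indep hX (t := fun i => h * i%:R)) ?mulr0 //; last first.
  by move=> i _; rewrite ler_wpM2l // ler_nat.
apply: eq_bigr => i _; rewrite -natr1 mulrDr mulr1.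
by apply: (levy_incr hX) => //; rewrite mulr_ge0.
Qed.

(** Right continuity at 0 gives continuity in probability there. If it failed at times [s n] below
    [1 / (n + 1)], the increasing events that all [X (s k)] with [k >= n] are within [a] of 0 would
    still exhaust a set of probability 1, so one of them would exceed [1 - e]. *)
Lemma levy_cvg0 X : levy_process P X ->
  forall e a : R, 0 < e -> 0 < a -> exists2 t0, 0 < t0 &
    forall s, 0 <= s -> s < t0 -> whp P e [set w | `|X s w| <= a].
Proof.
move=> hX e a e0 a0; apply: contrapT => /forall2NP H.
have {}H n : exists s, [/\ 0 <= s, s < n.+1%:R^-1 & ~ whp P e [set w | `|X s w| <= a]].
  have [|] := H (n.+1%:R^-1); first by rewrite invr_gt0.
  move=> /existsNP[s] /not_implyP[s0] /not_implyP[sn hs].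
  by exists s.
have [s hs] := choice H.
have mE k : measurable [set w | `|X (s k) w| <= a].
  apply: measurable_event_le; apply: measurableT_comp => //.
  by apply: levy_measurable => //; case: (hs k).
pose G n := \bigcap_(k in [set k | (n <= k)%N]) [set w | `|X (s k) w| <= a].
have mG n : measurable (G n) by apply: bigcap_measurable => //; exists n => /=.
have GE n : G n `<=` [set w | `|X (s n) w| <= a] by move=> w; apply => /=.
have mUG : measurable (\bigcup_n G n) by exact: bigcupT_measurable.
have cvgG : (P \o G) x @[x --> \oo] --> P (\bigcup_n G n).
  apply: nondecreasing_cvg_mu => // n m nm; apply/subsetPset => w Gw k /= mk.
  by apply: Gw => /=; exact: leq_trans mk.
have PU : P (\bigcup_n G n) = 1%E.
  apply/eqP; rewrite eq_le probability_le1 //=.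
  suff : whp P 0 (\bigcup_n G n) by rewrite whpP // subr0.
  apply: whpS (whp_ae (levy_start hX)) _ (lexx _) => w /= X0.
  have := @levy_right_continuous _ _ _ _ _ hX w 0 (lexx 0); rewrite X0 => /cvgrPdist_le /(_ a a0).
  move=> [r /= r0 hr].
  have [N hN] : exists N : nat, N.+1%:R^-1 < r.
    exists (Num.truncn r^-1).
    rewrite -[ltRHS]invrK ltf_pV2 ?posrE ?invr_gt0 //.
    exact: truncnS_gt.
  exists N => // k /= Nk; have [sk0 sk _] := hs k.
  move: sk0; rewrite le_eqVlt => /orP[/eqP<-|sk0]; first by rewrite X0 normr0 ltW.
  rewrite -normrN -sub0r; apply: hr => //=.
  rewrite sub0r normrN gtr0_norm //; apply: lt_trans sk _; apply: le_lt_trans hN.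
  by rewrite lef_pV2 ?posrE // ler_nat.
have : \forall n \near \oo, ((1 - e)%:E < P (G n))%E.
  rewrite PU in cvgG; apply: (cvgG [set y | ((1 - e)%:E < y)%E]).
  apply: open_nbhs_nbhs; split; first exact: open_ereal_gt_ereal.
  by rewrite /= lte_fin; lra.
move=> [N _ /(_ N (leqnn N)) hN]; have [_ _] := hs N; apply.
by rewrite whpP //; apply: (le_trans (ltW hN)); exact: le_prob.
Qed.

End LevyBasics.

(** * Sequences of independent identically distributed random variables *)

Section Sequences.
Context {R : realType}.
Implicit Types (x : nat -> R) (k n : nat).

(** Finite-dimensional rectangles form a pi-system generating the product sigma-algebra, so a
    product rule on sequence space need only be checked on them. *)
Definition cylinder : set (set (nat -> R)) :=
  [set C | exists n (A : nat -> set R), (forall i, measurable (A i)) /\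
    C = [set x | forall i, (i < n)%N -> A i (x i)]].

Definition rseq := g_sigma_algebraType cylinder.

(** Padding by 0 keeps the past in the same space as the whole sequence, so one family of sets
    describes events about past, future and whole walk. *)
Definition seqtrunc k x : rseq := fun i => if (i < k)%N then x i else 0.
Definition seqshift k x : rseq := fun i => x (k + i)%N.
Definition psum n (x : rseq) : R := \sum_(i < n) x i.

Lemma cylinder_setI_closed : setI_closed cylinder.
Proof.
move=> _ _ [n [A [mA ->]]] [m [B [mB ->]]].
exists (maxn n m), (fun i => (if (i < n)%N then A i else setT) `&`
  (if (i < m)%N then B i else setT)); split.
  by move=> i; apply: measurableI; case: ifP.
apply/seteqP; split => x /=.
  by move=> [hA hB] i _; split; case: ifP => //; [exact: hA|exact: hB].
move=> h; split=> i im; have := h i; rewrite leq_max im ?orbT => /(_ isT) [h1 h2]; by [].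
Qed.

Lemma measurable_cylinder n (A : nat -> set R) : (forall i, measurable (A i)) ->
  measurable [set x : rseq | forall i, (i < n)%N -> A i (x i)].
Proof. by move=> mA; apply: sub_sigma_algebra; exists n, A. Qed.

Lemma measurable_coord i : measurable_fun setT (fun x : rseq => x i).
Proof.
move=> _ B mB; rewrite setTI.
have := @measurable_cylinder i.+1 (fun j => if j == i then B else setT).
have h : forall j, measurable (if j == i then B else setT) by move=> j; case: ifP.
move=> /(_ h); congr measurable; apply/seteqP; split => x /=.
  by move=> /(_ i (ltnSn i)); rewrite eqxx.
by move=> Bx j _; case: eqP => // ->.
Qed.

Lemma measurable_psum n : measurable_fun setT (psum n).
Proof. by apply: measurable_sum => i; exact: measurable_coord. Qed.

Lemma measurable_to_rseq d (T : measurableType d) (f : T -> rseq) :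
  (forall i, measurable_fun setT (fun t => f t i)) -> measurable_fun setT f.
Proof.
move=> mf; apply: (@measurability _ _ T rseq setT f cylinder erefl).
move=> _ [_ [n [A [mA ->]]] <-].
rewrite [X in measurable X](_ : _ = \bigcap_(i in `I_n) (f ^~ i) @^-1` A i); last first.
  by apply/seteqP; split => t /=; [move=> [_ h] i|move=> h; split => // i]; exact: h.
have [->|n0] := posnP n; first by rewrite (_ : `I_0 = set0) ?bigcap_set0 // -subset0 => i.
apply: bigcap_measurable; first by exists 0%N.
by move=> i _; have := mf i measurableT _ (mA i); rewrite setTI.
Qed.

Lemma psum_seqtrunc k n x : (k <= n)%N -> psum k (seqtrunc n x) = psum k x.
Proof.
move=> kn; apply: eq_bigr => i _; rewrite /seqtrunc ifT //; exact: leq_trans kn.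
Qed.

Lemma psumD k n x : psum (k + n) x = psum k x + psum n (seqshift k x).
Proof. by rewrite /psum big_split_ord. Qed.

Lemma seqshift_shift k n x : seqshift k (seqshift n x) = seqshift (n + k) x.
Proof. by apply/funext => i; rewrite /seqshift addnA. Qed.

End Sequences.
Arguments rseq : clear implicits.

Section IID.
Context {R : realType} {d : measure_display} {Omega : measurableType d}.
Variable P : probability Omega R.

(** Dynkin's argument: for fixed [E], the sets obeying the product rule are stable under complements
    and disjoint countable unions. The second map [g] lets the factor be computed from another
    variable than the one in the intersection, such as the unshifted sequence. *)
Lemma prod_rule_extension d' (T : measurableType d') (G : set (set T))
    (E : set Omega) (f g : Omega -> T) :
  @measurable _ T = <<s G >> -> setI_closed G -> measurable E ->
  measurable_fun setT f -> measurable_fun setT g ->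
  (forall B, G B -> P (E `&` f @^-1` B) = (P E * P (g @^-1` B))%E) ->
  forall B, measurable B -> P (E `&` f @^-1` B) = (P E * P (g @^-1` B))%E.
Proof.
move=> mG GI mE mf mg GE B mB.
have mpre (h : Omega -> T) C : measurable_fun setT h -> measurable C -> measurable (h @^-1` C).
  by move=> mh mC; have := mh measurableT C mC; rewrite setTI.
apply: (@dynkin_induction _ T G (fun B => P (E `&` f @^-1` B) = (P E * P (g @^-1` B))%E)) => //.
- by rewrite !preimage_setT setIT probability_setT mule1.
- move=> S mS IH; have mfS := mpre f S mf mS; have mgS := mpre g S mg mS.
  have -> : E `&` f @^-1` (~` S) = E `\` f @^-1` S by [].
  have -> : (P (g @^-1` (~` S)) = 1 - P (g @^-1` S))%E by exact: (probability_setC P mgS).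
  have Elty : (P E < +oo)%E by apply: le_lt_trans (probability_le1 P mE) (ltry _).
  have -> : (P (E `\` f @^-1` S) = P E - P (E `&` f @^-1` S))%E.
    exact: measureD.
  by rewrite IH muleBr ?mule1 ?fin_num_measure // fin_num_adde_defr.
- move=> F mF tF IH; rewrite !preimage_bigcup setI_bigcupr.
  have mfF i : measurable (f @^-1` F i) by exact: (mpre f (F i) mf (mF i)).
  have mgF i : measurable (g @^-1` F i) by exact: (mpre g (F i) mg (mF i)).
  have tpre (h : Omega -> T) : trivIset setT (fun i => h @^-1` F i).
    apply/trivIsetP => i j _ _ ij; rewrite -preimage_setI.
    by move/trivIsetP: tF => ->; rewrite ?preimage_set0.
  rewrite (measure_bigcup P) //; last 2 first.
    by move=> i _; exact: measurableI.
    by apply: trivIset_setIl.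
  rewrite [in RHS](measure_bigcup P) //.
  rewrite -(fineK (fin_num_measure P _ mE)) -nneseriesZl //.
  by apply: eq_eseriesr => i _; rewrite fineK ?fin_num_measure //; exact: IH.
- by rewrite -mG.
Qed.

Variable D : Omega -> nat -> R.

(** Independence and equality of laws in one formula: all factors refer to coordinate 0, and taking
    every set but one equal to [setT] gives the law of a single coordinate. *)
Definition iid_seq :=
  (forall i, measurable_fun setT (fun w => D w i)) /\
  forall n (A : nat -> set R), (forall i, measurable (A i)) ->
    P [set w | forall i, (i < n)%N -> A i (D w i)] =
    (\prod_(i < n) P [set w | A i (D w 0%N)])%E.

Hypothesis iidD : iid_seq.

Lemma measurable_iid_trunc k : measurable_fun setT (fun w => seqtrunc k (D w)).
Proof.
apply: measurable_to_rseq => i; rewrite /seqtrunc.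
by case: (i < k)%N; [exact: iidD.1|exact: measurable_cst].
Qed.

Lemma measurable_iid_shift k : measurable_fun setT (fun w => seqshift k (D w)).
Proof. by apply: measurable_to_rseq => i; exact: iidD.1. Qed.

Lemma measurable_iid_event (f : Omega -> rseq R) (B : set (rseq R)) :
  measurable_fun setT f -> measurable B -> measurable [set w | B (f w)].
Proof. by move=> mf mB; have := mf measurableT B mB; rewrite setTI. Qed.

Lemma iid_indep_cylinder k (A B : set (rseq R)) : cylinder A -> cylinder B ->
  P [set w | A (seqtrunc k (D w)) /\ B (seqshift k (D w))] =
  (P [set w | A (seqtrunc k (D w))] * P [set w | B (D w)])%E.
Proof.
move=> [n [A' [mA ->]]] [m [B' [mB ->]]].
(* Coordinates from [k] on are 0 after truncation, so the constraints on them are either always met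
   or never; in the second case both sides vanish. *)
have [c|c] := pselect (forall i, (k <= i < n)%N -> A' i 0); last first.
  rewrite [X in P X](_ : _ = set0) ?measure0; last first.
    apply/seteqP; split => w //= [h _]; apply: c => i /andP[ki ik].
    by have := h i ik; rewrite /seqtrunc ltnNge ki.
  rewrite [X in (P X * _)%E](_ : _ = set0) ?measure0 ?mul0e //.
  apply/seteqP; split => w //= h; apply: c => i /andP[ki ik].
  by have := h i ik; rewrite /seqtrunc ltnNge ki.
pose A1 i := if (i < n)%N then A' i else setT.
have mA1 i : measurable (A1 i) by rewrite /A1; case: ifP.
have EA w : (forall i, (i < n)%N -> A' i (seqtrunc k (D w) i)) <->
    (forall i, (i < k)%N -> A1 i (D w i)).
  split=> h i ik.
    by rewrite /A1; case: ifP => // i_n; have := h i i_n; rewrite /seqtrunc ik.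
  rewrite /seqtrunc; case: ifP => ik'; first by have := h i ik'; rewrite /A1 ik.
  by apply: c; rewrite ik leqNgt ik'.
pose C i := if (i < k)%N then A1 i else B' (i - k)%N.
have mC i : measurable (C i) by rewrite /C; case: ifP.
rewrite [X in P X](_ : _ = [set w | forall i, (i < k + m)%N -> C i (D w i)]); last first.
  apply/seteqP; split => w /=.
    move=> [/EA hA hB] i im; rewrite /C; case: ifP => ik; first exact: hA.
    have ki : (k <= i)%N by rewrite leqNgt ik.
    by have := hB (i - k)%N; rewrite /seqshift subnKC //; apply; rewrite ltn_subLR.
  move=> h; split.
    by apply/EA => i ik; have := h i (ltn_addr _ ik); rewrite /C ik.
  move=> i im; have := h (k + i)%N; rewrite ltn_add2l => /(_ im).
  by rewrite /C ltnNge leq_addr /= addKn.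
rewrite [X in (P X * _)%E](_ : _ = [set w | forall i, (i < k)%N -> A1 i (D w i)]); last first.
  by apply/seteqP; split => w /= /EA.
rewrite !iidD.2 // big_split_ord /=; congr (_ * _)%E.
  by apply: eq_bigr => i _; rewrite /C ltn_ord.
by apply: eq_bigr => i _; rewrite /C ltnNge leq_addr /= addKn.
Qed.

(** The extension is applied twice: first to the future with a cylinder as past, then to the past
    with a fixed measurable future. *)
Lemma iid_indep k (A B : set (rseq R)) : measurable A -> measurable B ->
  P [set w | A (seqtrunc k (D w)) /\ B (seqshift k (D w))] =
  (P [set w | A (seqtrunc k (D w))] * P [set w | B (D w)])%E.
Proof.
have mD : measurable_fun setT (D : Omega -> rseq R).
  by apply: measurable_to_rseq; exact: iidD.1.
have step1 (A1 B1 : set (rseq R)) : cylinder A1 -> measurable B1 ->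
  P [set w | A1 (seqtrunc k (D w)) /\ B1 (seqshift k (D w))] =
  (P [set w | A1 (seqtrunc k (D w))] * P [set w | B1 (D w)])%E.
  move=> cA mB.
  have mA1 : measurable A1 by exact: sub_sigma_algebra.
  apply: (@prod_rule_extension _ (rseq R) cylinder [set w | A1 (seqtrunc k (D w))]
     (fun w => seqshift k (D w)) D) => //.
  - exact: cylinder_setI_closed.
  - by apply: measurable_iid_event => //; exact: measurable_iid_trunc.
  - exact: measurable_iid_shift.
  - by move=> B2 cB2; exact: iid_indep_cylinder.
have cT : @cylinder R setT.
  by exists 0%N, (fun=> setT); split => //; apply/seteqP; split.
have shiftE (B1 : set (rseq R)) : measurable B1 ->
    P [set w | B1 (seqshift k (D w))] = P [set w | B1 (D w)].
  move=> mB1; have := step1 _ _ cT mB1.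
  rewrite [X in P X](_ : _ = [set w | B1 (seqshift k (D w))]); last first.
    by apply/seteqP; split => w /=; [case|].
  move=> ->; rewrite [X in (P X * _)%E](_ : _ = setT) ?probability_setT ?mul1e //.
move=> mA mB.
have := @prod_rule_extension _ (rseq R) cylinder [set w | B (seqshift k (D w))]
     (fun w => seqtrunc k (D w)) (fun w => seqtrunc k (D w)) erefl cylinder_setI_closed.
have mEB : measurable [set w | B (seqshift k (D w))].
  by apply: measurable_iid_event => //; exact: measurable_iid_shift.
move=> /(_ mEB (measurable_iid_trunc k) (measurable_iid_trunc k)).
rewrite shiftE // => H; rewrite muleC -H //; last first.
  move=> B1 cB1; rewrite muleC -[RHS]step1 //; congr (P _).
  by apply/seteqP; split => w /= [].
by congr (P _); apply/seteqP; split => w /= [].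
Qed.

Lemma iid_shift k (B : set (rseq R)) : measurable B ->
  P [set w | B (seqshift k (D w))] = P [set w | B (D w)].
Proof.
move=> mB; have := iid_indep k measurableT mB.
rewrite [X in P X](_ : _ = [set w | B (seqshift k (D w))]); last first.
  by apply/seteqP; split => w /=; [case|].
move=> ->; rewrite [X in (P X * _)%E](_ : _ = setT) ?probability_setT ?mul1e //.
Qed.

End IID.

Lemma measurable_forall_lt d (T : measurableType d) n (E : nat -> set T) :
  (forall k, measurable (E k)) -> measurable [set w | forall k, (k < n)%N -> E k w].
Proof.
move=> mE; elim: n => [|n IH].
  rewrite (_ : [set _ | _] = setT); first exact: measurableT.
  by apply/seteqP; split.
rewrite (_ : [set _ | _] = [set w | forall k, (k < n)%N -> E k w] `&` E n).
  exact: measurableI.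
apply/seteqP; split => w /= h.
  by split; [move=> k /ltnW kn|]; apply: h.
by move=> k; rewrite ltnS leq_eqVlt => /orP[/eqP->|kn]; [exact: h.2|exact: h.1].
Qed.

Lemma measurable_exists_lt d (T : measurableType d) n (E : nat -> set T) :
  (forall k, measurable (E k)) -> measurable [set w | exists2 k, (k < n)%N & E k w].
Proof.
move=> mE; have := measurable_forall_lt n (fun k => measurableC (mE k)).
move=> /measurableC; congr measurable; apply/seteqP; split => w /=.
  move=> /existsNP[k] /not_implyP[kn] /contrapT Ek; by exists k.
by move=> [k kn Ek] h; apply: (h k kn).
Qed.

(** * Maximal inequalities for random walks *)

Section RandomWalk.
Context {R : realType} {d : measure_display} {Omega : measurableType d}.
Variables (P : probability Omega R) (D : Omega -> nat -> R).
Hypothesis iidD : iid_seq P D.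
Implicit Types (A y e q : R) (n N k : nat).

Let mshift k (B : set (rseq R)) : measurable B -> measurable [set w | B (seqshift k (D w))].
Proof. by move=> mB; apply: measurable_iid_event => //; exact: measurable_iid_shift iidD k. Qed.

Let mwalk (B : set (rseq R)) : measurable B -> measurable [set w | B (D w)].
Proof. exact: (@mshift 0). Qed.

(* Decomposing according to the first k with U k: this event depends only on
   the first k increments, while V k only involves the later ones. *)
Lemma first_passage_lower (U V : nat -> set (rseq R)) n q :
  (forall k, measurable (U k)) -> (forall k, measurable (V k)) ->
  (forall k m x, (k <= m)%N -> U k (seqtrunc m x) <-> U k x) ->
  (forall k, (k < n)%N -> (q%:E <= P [set w | V k (D w)])%E) -> 0 <= q ->
  (q%:E * P [set w | exists2 k, (k < n)%N & U k (D w)] <=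
   P [set w | exists2 k, (k < n)%N & U k (D w) /\ V k (seqshift k (D w))])%E.
Proof.
move=> mU mV tU hV q0; elim: n hV => [_|n IH hV].
  rewrite [X in (_ * P X)%E](_ : _ = set0) ?measure0 ?mule0 ?measure_ge0 //.
  by apply/seteqP; split => w // [].
pose F m : set (rseq R) := [set x | exists2 k, (k < m)%N & U k x].
have mF m : measurable (F m) by exact: measurable_exists_lt.
pose W : set (rseq R) := U n `\` F n.
have mW : measurable W by exact: measurableD.
have WE w : W (seqtrunc n (D w)) <-> W (D w).
  split=> -[Un nF]; split; try exact/(tU _ _ _ (leqnn n)).
    by move=> [k kn Uk]; apply: nF; exists k => //; apply/tU => //; exact: ltnW.
  by move=> [k kn Uk]; apply: nF; exists k => //; apply/tU/Uk; exact: ltnW.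
pose G := [set w | exists2 k, (k < n)%N & U k (D w) /\ V k (seqshift k (D w))].
have mG : measurable G.
  by apply: measurable_exists_lt => k; apply: measurableI; [exact: mwalk|exact: mshift].
pose E1 := [set w | F n (D w)].
pose E2 := [set w | W (D w)].
pose E3 := [set w | W (seqtrunc n (D w)) /\ V n (seqshift n (D w))].
have mE1 : measurable E1 by exact: mwalk.
have mE2 : measurable E2 by exact: mwalk.
have mE3 : measurable E3.
  apply: measurableI; last exact: mshift.
  by apply: measurable_iid_event => //; exact: (measurable_iid_trunc iidD).
have -> : [set w | exists2 k, (k < n.+1)%N & U k (D w)] = E1 `|` E2.
  apply/seteqP; split => w /=.
    move=> [k]; rewrite ltnS leq_eqVlt => /orP[/eqP->|kn] Uk; last by left; exists k.
    by have [Fn|Fn] := pselect (F n (D w)); [left|right; split].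
  by move=> [[k kn Uk]|[Un _]]; [exists k => //; exact: leqW|exists n].
have disj (A B C : set Omega) : A `<=` C -> [disjoint B & C] -> A `&` B = set0.
  by move=> AC /disj_set2P BC; rewrite -subset0 => w [/AC Cw Bw]; rewrite -BC.
have E12 : [disjoint E2 & E1].
  by apply/disj_set2P; rewrite -subset0 => w [[_ +]] /=.
rewrite measureU //; last exact: (disj _ _ _ (@subset_refl _ _) E12).
have E32 : E3 `<=` E2 by move=> w [/WE].
have G1 : G `<=` E1 by move=> w [k kn [Uk _]]; exists k.
have GE3 : G `&` E3 = set0.
  rewrite -subset0 => w [/G1 Gw /E32 Ew].
  by move/disj_set2P: E12 => <-; split.
apply: (@le_trans _ _ (P (G `|` E3))); last first.
  apply: le_prob.
  - exact: measurableU.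
  - by apply: measurable_exists_lt => k; apply: measurableI; [exact: mwalk|exact: mshift].
  - move=> w [[k kn h]|[/WE[Un _] Vn]]; first by exists k => //; exact: leqW.
    by exists n.
rewrite measureU // muleDr ?fin_num_adde_defr ?fin_num_measure //.
apply: leeD; first by apply: IH => k kn; apply: hV; exact: leqW.
suff : (q%:E * P E2 <= P E3)%E by [].
have -> : P E3 = (P [set w | W (seqtrunc n (D w))] * P [set w | V n (D w)])%E.
  exact: iid_indep.
rewrite [X in (_ <= X)%E]muleC.
have -> : [set w | W (seqtrunc n (D w))] = E2 by apply/seteqP; split => w /WE.
by apply: lee_wpmul2r => //; exact: hV.
Qed.

Lemma measurable_psum_gt n A : measurable [set x : rseq R | A < psum n x].
Proof. by apply: measurable_event_gt; exact: measurable_psum. Qed.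

Lemma measurable_abs_psum_le n A : measurable [set x : rseq R | `|psum n x| <= A].
Proof.
by apply: measurable_event_le; apply: measurableT_comp => //; exact: measurable_psum.
Qed.

Lemma measurable_abs_psum_gt n A : measurable [set x : rseq R | A < `|psum n x|].
Proof.
by apply: measurable_event_gt; apply: measurableT_comp => //; exact: measurable_psum.
Qed.

Lemma not_exists_lt_abs (n : nat) (A : R) (f : nat -> R) :
  ~ (exists2 k, (k < n)%N & A < `|f k|) <-> (forall k, (k < n)%N -> `|f k| <= A).
Proof.
split=> [h k kn|h [k kn]]; last by rewrite ltNge h.
by rewrite leNgt; apply/negP => hk; apply: h; exists k.
Qed.

(** When the walk first exceeds [2 * A] in absolute value, its remaining increment is at most [A]
    with probability at least [1 - e], which leaves the endpoint beyond [A]. Hence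
    [(1 - e) * p <= e] for the crossing probability [p], and [e <= 1 / 2] gives [p <= 2 * e]. *)
Lemma walk_ottaviani n e A : e <= 2^-1 ->
  (forall k, (k <= n)%N -> whp P e [set w | `|psum k (D w)| <= A]) ->
  whp P (2 * e) [set w | forall k, (k <= n)%N -> `|psum k (D w)| <= 2 * A].
Proof.
move=> e2 he.
pose U k : set (rseq R) := [set x | 2 * A < `|psum k x|].
pose V k : set (rseq R) := [set x | `|psum (n - k) x| <= A].
have mU k : measurable (U k) by exact: measurable_abs_psum_gt.
have mV k : measurable (V k) by exact: measurable_abs_psum_le.
have tU k m x : (k <= m)%N -> U k (seqtrunc m x) <-> U k x.
  by move=> km; rewrite /U /= psum_seqtrunc.
have hV k : (k < n.+1)%N -> ((1 - e)%:E <= P [set w | V k (D w)])%E.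
  by move=> _; apply/whpP; [exact: mwalk|exact: he (leq_subr _ _)].
have e1 : 0 <= 1 - e by lra.
have := first_passage_lower mU mV tU hV e1.
set E1 := [set w | _]; set E2 := [set w | _] => h.
have mE1 : measurable E1 by apply: measurable_exists_lt => k; exact: mwalk.
have mE2 : measurable E2.
  by apply: measurable_exists_lt => k; apply: measurableI; [exact: mwalk|exact: mshift].
have hE2 : (P E2 <= e%:E)%E.
  have mn : measurable [set w | `|psum n (D w)| <= A].
    exact: (mwalk (measurable_abs_psum_le n A)).
  apply: (@le_trans _ _ (P (~` [set w | `|psum n (D w)| <= A]))); last first.
    by apply/whpCP => //; exact: he.
  apply: le_prob => //; first exact: measurableC.
  move=> w [k kn [Uk Vk]] /=; apply/negP; rewrite -ltNge.
  have := psumD k (n - k) (D w); rewrite subnKC // => ->.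
  have := lerB_normD (psum k (D w)) (psum (n - k) (seqshift k (D w))).
  move: Uk Vk; rewrite /U /V /=; lra.
have -> : [set w | forall k, (k <= n)%N -> `|psum k (D w)| <= 2 * A] = ~` E1.
  have H w := not_exists_lt_abs n.+1 (2 * A) (fun k => psum k (D w)).
  by apply/seteqP; split => w h'; [exact: (H w).2 h'|exact: (H w).1 h'].
apply/whpCP; first exact: measurableC.
rewrite setCK; have := le_trans h hE2.
rewrite -(fineK (fin_num_measure P _ mE1)) -EFinM !lee_fin.
have := fine_ge0 (measure_ge0 P E1); nra.
Qed.

(** Let [p] be the probability of rising above [y] within [n] steps. Restarting at the first passage
    above each multiple of [y] shows that level [(N + 1) * y] is passed within [(N + 1) * n] steps
    with probability at least [p ^ (N + 1)]. This is at most [e <= q ^ (N + 1)], so [p <= q]; by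
    stationarity the starting index [j] is arbitrary. *)
Lemma walk_multiple_passage n N y e q : 0 <= q -> e <= q ^+ N.+1 ->
  whp P e [set w | forall k, (k <= N.+1 * n)%N -> psum k (D w) <= N.+1%:R * y] ->
  forall j, whp P q [set w | forall k, (k <= n)%N -> psum k (seqshift j (D w)) <= y].
Proof.
move=> q0 eq he j.
pose T m z : set (rseq R) := [set x | exists2 k, (k < m.+1)%N & z < psum k x].
have mT m z : measurable (T m z).
  by apply: measurable_exists_lt => k; exact: measurable_psum_gt.
have TE m z x : (forall k, (k <= m)%N -> psum k x <= z) <-> ~ T m z x.
  split=> [h [k km]|h k km]; first by rewrite ltNge h.
  by rewrite leNgt; apply/negP => hk; apply: h; exists k.
pose p := fine (P [set w | T n y (D w)]).
have p0 : 0 <= p by apply: fine_ge0; exact: measure_ge0.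
have step M : ((p ^+ M.+1)%:E <= P [set w | T (M.+1 * n)%N (M.+1%:R * y)%R (D w)])%E.
  elim: M => [|M IH].
    by rewrite expr1 mul1n mul1r /p fineK ?fin_num_measure //; exact: mwalk.
  pose U k : set (rseq R) := [set x | M.+1%:R * y < psum k x].
  pose V (k : nat) : set (rseq R) := T n y.
  have mU k : measurable (U k) by exact: measurable_psum_gt.
  have mV k : measurable (V k) by exact: mT.
  have tU k m x : (k <= m)%N -> U k (seqtrunc m x) <-> U k x.
    by move=> km; rewrite /U /= psum_seqtrunc.
  have hV k : (k < (M.+1 * n).+1)%N -> (p%:E <= P [set w | V k (D w)])%E.
    by move=> _; rewrite /p fineK // fin_num_measure //; exact: mwalk.
  have h := first_passage_lower mU mV tU hV p0.
  rewrite exprS EFinM; apply: le_trans (lee_wpmul2l _ IH) _; first by rewrite lee_fin.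
  apply: le_trans h _; apply: le_prob.
  - by apply: measurable_exists_lt => k; apply: measurableI; [exact: mwalk|exact: mshift].
  - exact: mwalk.
  - move=> w [k kn [Uk [i i_n Vi]]]; exists (k + i)%N; first by rewrite mulSn; lia.
    by rewrite psumD -natr1 mulrDl mul1r ltrD.
have pq : p <= q.
  rewrite leNgt; apply/negP => qp.
  have mC : measurable [set w | forall k, (k <= N.+1 * n)%N -> psum k (D w) <= N.+1%:R * y].
    rewrite (_ : [set _ | _] = ~` [set w | T (N.+1 * n)%N (N.+1%:R * y) (D w)]).
      by apply: measurableC; exact: mwalk.
    by apply/seteqP; split => w /TE.
  move/(whpCP _ _ mC): he; rewrite (_ : ~` _ = [set w | T (N.+1 * n)%N (N.+1%:R * y) (D w)]); last first.
    apply/seteqP; split => w /= h; first by apply: contrapT => /TE.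
    by move=> /TE.
  move=> /(le_trans (step N)); rewrite lee_fin => h.
  have := le_trans h eq; apply/negP; rewrite -ltNge.
  exact: ltrXn2r.
have -> : [set w | forall k, (k <= n)%N -> psum k (seqshift j (D w)) <= y] =
    ~` [set w | T n y (seqshift j (D w))].
  by apply/seteqP; split => w /TE.
apply/whpCP; first by apply: measurableC; exact: mshift.
rewrite setCK (iid_shift iidD) // -(fineK (fin_num_measure P _ _)) ?lee_fin //.
exact: mwalk.
Qed.

(** Induction on [(1 - p) * (1 + (N + 1) * p) <= 1 + N * p]. This form of Bernoulli's inequality
    bounds [p] from above when [(1 - p) ^ N] is close to 1. *)
Lemma bernoulli_bound (p : R) N : 0 <= p -> p <= 1 -> (1 - p) ^+ N * (1 + N%:R * p) <= 1.
Proof.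
move=> p0 p1; elim: N => [|N IH]; first by rewrite expr0 mul0r; lra.
apply: le_trans IH; rewrite exprS mulrAC mulrC ler_wpM2l //.
  by rewrite exprn_ge0 //; lra.
by rewrite -natr1; have := ler0n R N; nra.
Qed.

(* The N blocks are independent, so a large oscillation has probability of
   order e / N on each of them. *)
Lemma walk_block n N e A : e <= 2^-1 -> 0 <= e ->
  whp P e [set w | forall k, (k <= N.+1 * n)%N -> `|psum k (D w)| <= A] ->
  whp P (2 * e / N.+1%:R) [set w | forall k, (k <= n)%N -> `|psum k (D w)| <= 2 * A].
Proof.
move=> e2 e0 he.
pose G : set (rseq R) := [set x | forall k, (k < n.+1)%N -> `|psum k x| <= 2 * A].
have mG : measurable G by apply: measurable_forall_lt => k; exact: measurable_abs_psum_le.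
pose GN M : set (rseq R) := [set x | forall i, (i < M)%N -> G (seqshift (i * n) x)].
have mGN M : measurable (GN M).
  apply: measurable_forall_lt => i.
  have ms : measurable_fun setT (seqshift (i * n) : rseq R -> rseq R).
    by apply: measurable_to_rseq => k; exact: measurable_coord.
  by have := ms measurableT G mG; rewrite setTI.
have tG x : G (seqtrunc n x) <-> G x.
  by split=> h k kn; have := h k kn; rewrite psum_seqtrunc.
pose g := fine (P [set w | G (D w)]).
have gE : P [set w | G (D w)] = g%:E by rewrite /g fineK // fin_num_measure //; exact: mwalk.
have g0 : 0 <= g by apply: fine_ge0; exact: measure_ge0.
have g1 : g <= 1 by rewrite -lee_fin -gE; apply: probability_le1; exact: mwalk.
have pg M : P [set w | GN M (D w)] = (g ^+ M)%:E.
  elim: M => [|M IH].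
    rewrite expr0 (_ : [set _ | _] = setT) ?probability_setT //.
    by apply/seteqP; split => w.
  rewrite exprS EFinM -IH -gE.
  have -> : [set w | G (D w)] = [set w | G (seqtrunc n (D w))] by apply/seteqP; split => w /tG.
  rewrite -(iid_indep iidD) //; congr (P _); apply/seteqP; split => w /= h.
    split; first by apply/tG; have := h 0%N isT; rewrite mul0n.
    by move=> i iM; rewrite seqshift_shift -mulSn; exact: h.
  move=> [|i] iM; first by rewrite mul0n; exact/tG/h.1.
  by have := h.2 i iM; rewrite seqshift_shift -mulSn.
(* An increment inside a block is a difference of two partial sums, whence the factor 2 on [A]. *)
have hg : 1 - e <= g ^+ N.+1.
  have : whp P e [set w | GN N.+1 (D w)].
    apply: whpS he _ (lexx _) => w h i iN k kn.
    have h1 : (i * n + k <= N.+1 * n)%N.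
      by apply: leq_trans (leq_mul iN (leqnn n)); rewrite mulSn addnC leq_add2r.
    have h2 : (i * n <= N.+1 * n)%N by rewrite leq_mul // ltnW.
    have := h _ h1; have := h _ h2; rewrite psumD.
    have := ler_normB (psum (i * n) (D w) + psum k (seqshift (i * n) (D w))) (psum (i * n) (D w)).
    by rewrite addrAC subrr add0r; lra.
  by rewrite whpP ?pg ?lee_fin //; exact: mwalk.
have mC : measurable [set w | forall k, (k <= n)%N -> `|psum k (D w)| <= 2 * A].
  by have := mwalk mG.
apply/whpP => //; rewrite (_ : [set _ | _] = [set w | G (D w)]) // gE lee_fin.
(* With [x = (N + 1) * (1 - g)], this gives [(1 - e) * (1 + x) <= 1], hence
   [x <= e / (1 - e) <= 2 * e]. *)
have := @bernoulli_bound (1 - g) N.+1; rewrite subKr.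
have {}g0 : 1 - g <= 1 by lra.
have {}g1 : 0 <= 1 - g by lra.
move=> /(_ g1 g0) hb.
have N0 : 0 < N.+1%:R :> R by rewrite ltr0n.
rewrite lerBlDr -lerBlDl ler_pdivlMr //.
have : 0 <= N.+1%:R * (1 - g) by rewrite mulr_ge0 // ltW.
nra.
Qed.

End RandomWalk.

(** * Maximal inequalities for Levy processes *)

Section LevyMaximal.
Context {R : realType} {d : measure_display} {Omega : measurableType d}.
Variable P : probability Omega R.
Implicit Types (X Y : R -> Omega -> R) (A e t v y : R).

Lemma dyadic_le (t : R) m N k : 0 <= t -> (k <= N * 2 ^ m)%N ->
  t / 2 ^+ m * k%:R <= N%:R * t.
Proof.
move=> t0 km; rewrite mulrAC ler_pdivrMr ?exprn_gt0 // mulrC mulrAC ler_wpM2r //.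
by rewrite -natrX -natrM ler_nat.
Qed.

Lemma dyadic_between (t s eta : R) : 0 <= s -> s < t -> 0 < eta ->
  exists m k, [/\ (k <= 2 ^ m)%N, s < t / 2 ^+ m * k%:R & t / 2 ^+ m * k%:R < s + eta].
Proof.
move=> s0 st eta0; have t0 : 0 < t by exact: le_lt_trans st.
pose m := Num.truncn (t / eta).
have tm : t / 2 ^+ m < eta.
  have h : t / eta < 2 ^+ m.
    apply: lt_le_trans (truncnS_gt _) _; rewrite -/m -natrX ler_nat.
    exact: ltn_expl.
  by rewrite ltr_pdivrMr ?exprn_gt0 // mulrC -ltr_pdivrMr.
have h0 : 0 < t / 2 ^+ m by rewrite divr_gt0 // exprn_gt0.
pose k := Num.truncn (s / (t / 2 ^+ m)).
have /andP[k1 k2] := @truncn_itv R (s / (t / 2 ^+ m)) (divr_ge0 s0 (ltW h0)).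
rewrite -/k in k1 k2.
have {}k1 : t / 2 ^+ m * k%:R <= s by rewrite mulrC -ler_pdivlMr.
have {}k2 : s < t / 2 ^+ m * k.+1%:R by rewrite mulrC -ltr_pdivrMr.
exists m, k.+1; split => //.
- have : t / 2 ^+ m * k%:R < t by exact: le_lt_trans st.
  rewrite mulrAC ltr_pdivrMr ?exprn_gt0 // ltr_pM2l //.
  by rewrite -natrX ltr_nat.
- rewrite -[k.+1%:R]natr1 mulrDr mulr1; lra.
Qed.

(** The dyadic grids of [0, t] are nested, so the grid events decrease and continuity from above
    keeps the bound [1 - e] on their intersection. Right continuity carries the bound from grid
    points to the right of [s] over to [s]; the endpoint [t] is itself a grid point. *)
Lemma right_continuous_sup_whp Y t A e : 0 < t ->
  (forall s, 0 <= s -> measurable_fun setT (Y s)) ->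
  (forall w s, 0 <= s -> Y u w @[u --> s^'+] --> Y s w) ->
  (forall m, whp P e [set w | forall k, (k <= 2 ^ m)%N -> Y (t / 2 ^+ m * k%:R) w <= A]) ->
  whp P e [set w | forall s, 0 <= s -> s <= t -> Y s w <= A].
Proof.
move=> t0 mY cY hY.
pose G m := [set w | forall k, (k < (2 ^ m).+1)%N -> Y (t / 2 ^+ m * k%:R) w <= A].
have mG m : measurable (G m).
  apply: measurable_forall_lt => k; apply: measurable_event_le; apply: mY.
  by rewrite mulr_ge0 // divr_ge0 // ?ltW // exprn_ge0.
have mIG : measurable (\bigcap_m G m) by exact: bigcapT_measurable.
exists (\bigcap_m G m); split => //.
- move=> w Gw s s0; rewrite le_eqVlt => /orP[/eqP ->|st].
    by have := Gw 0%N I 1%N isT; rewrite /= divr1 mulr1.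
  rewrite leNgt; apply/negP => As.
  have /cvgrPdist_lt/(_ (Y s w - A)) := cY w s s0.
  rewrite subr_gt0 => /(_ As) [r /= r0 hr].
  have [m [k [km sk ks]]] := dyadic_between s0 st r0.
  have := Gw m I k; rewrite ltnS => /(_ km).
  have := hr (t / 2 ^+ m * k%:R); rewrite /= => /(_ _ sk).
  rewrite distrC gtr0_norm ?subr_gt0 // => h1.
  have /h1 : t / 2 ^+ m * k%:R - s < r by rewrite ltrBlDl.
  have := ler_norm (Y s w - Y (t / 2 ^+ m * k%:R) w); lra.
- have nG : {homo G : n m / (n <= m)%N >-> (m <= n)%O}.
    apply/nonincreasing_seqP => m; apply/subsetPset => w h k /=; rewrite ltnS => km.
    have := h (2 * k)%N; rewrite ltnS expnS leq_mul2l km orbT => /(_ isT).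
    rewrite exprS natrM; congr (Y _ w <= _).
    have : (2:R) ^+ m != 0 by rewrite expf_neq0.
    by move=> ?; field.
  have := nonincreasing_cvg_mu (mu := P) _ mG mIG nG.
  rewrite (le_lt_trans (probability_le1 P (mG 0%N))) ?ltry // => /(_ isT) cG.
  apply: (@cvge_to_ge _ _ _ _ (P \o G)) cG _.
  by near=> m; apply/whpP => //; exact: hY.
Unshelve. all: by end_near. Qed.

(** The drift [v] is built in so that Ottaviani's inequality for this walk controls the distance of
    the path to a line of slope [v]; the other uses take [v = 0]. *)
Definition grid_incr X (h v : R) (w : Omega) : nat -> R :=
  fun i => X (h * i.+1%:R) w - X (h * i%:R) w - h * v.

Lemma psum_grid X h v k w : psum k (grid_incr X h v w) = X (h * k%:R) w - X 0 w - h * k%:R * v.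
Proof.
rewrite /psum; elim: k => [|k IH].
  by rewrite big_ord0 mulr0 mul0r subrr subr0.
by rewrite big_ord_recr /= IH /grid_incr -[k.+1%:R]natr1; ring.
Qed.

Lemma psum_grid_shift X h j k w :
  psum k (seqshift j (grid_incr X h 0 w)) = X (h * (j + k)%:R) w - X (h * j%:R) w.
Proof.
have := psumD j k (grid_incr X h 0 w); rewrite !psum_grid !mulr0 !subr0 => h'.
by apply: (addrI (X (h * j%:R) w - X 0 w)); rewrite -h'; ring.
Qed.

Lemma levy_grid_iid X h v : levy_process P X -> 0 <= h -> iid_seq P (grid_incr X h v).
Proof.
move=> hX h0; have ge0 i : 0 <= h * i%:R by rewrite mulr_ge0.
have mg i : measurable_fun setT (fun w => X (h * i.+1%:R) w - X (h * i%:R) w).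
  exact: levy_measurable_incr hX _ _.
split=> [i|n A mA].
  by apply: measurable_funB => //; exact: measurable_cst.
pose B i := [set x : R | A i (x - h * v)].
have mB i : measurable (B i).
  have mf : measurable_fun setT (fun x : R => x - h * v).
    by apply: measurable_funB => //; exact: measurable_cst.
  by have := mf measurableT _ (mA i); rewrite setTI.
rewrite (_ : [set _ | _] = \bigcap_(i < n)
    [set w | B i (X (h * i.+1%:R) w - X (h * i%:R) w)]); last first.
  by apply/seteqP; split => w h' i /h'.
rewrite (levy_indep_grid _ hX) //; apply: eq_bigr => i _.
by rewrite /grid_incr mulr1 mulr0 -(levy_start0 hX h0 (mB i)).
Qed.

Lemma levy_ottaviani X t v A e : levy_process P X -> 0 < t -> e <= 2^-1 ->
  (forall s, 0 <= s -> s <= t -> whp P e [set w | `|X s w - s * v| <= A]) ->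
  whp P (2 * e) [set w | forall s, 0 <= s -> s <= t -> `|X s w - s * v| <= 2 * A].
Proof.
move=> hX t0 e2 he.
have X0 : whp P 0 [set w | X 0 w = 0] by exact: whp_ae (levy_start hX).
(* The walk records increments from [X 0], which is 0 only almost surely. *)
suff h : whp P (2 * e) [set w | forall s, 0 <= s -> s <= t ->
    `|X s w - X 0 w - s * v| <= 2 * A].
  apply: whpS (whpI h X0) _ _; last by rewrite addr0.
  by move=> w [/= h1 h0] s s0 st; have := h1 s s0 st; rewrite h0 subr0.
apply: (@right_continuous_sup_whp (fun s w => `|X s w - X 0 w - s * v|)) => //.
- move=> s s0; apply: measurableT_comp => //; apply: measurable_funB.
    exact: levy_measurable_incr hX _ _.
  exact: measurable_cst.
- move=> w s s0; apply: cvg_norm; apply: cvgB; first apply: cvgB.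
  + exact: (levy_right_continuous hX).
  + exact: cvg_cst.
  + apply: cvgMl; apply: cvg_at_right_filter; exact: cvg_id.
- move=> m; have h0 : 0 <= t / 2 ^+ m by rewrite divr_ge0 // ?ltW // exprn_ge0.
  have := @walk_ottaviani _ _ _ P _ (levy_grid_iid v hX h0) (2 ^ m)%N e A e2.
  move=> /(_ _) h; apply: whpS (h _) _ (lexx _).
    move=> k km; have kt : t / 2 ^+ m * k%:R <= t.
      by have := @dyadic_le t m 1 k (ltW t0); rewrite mul1n mul1r; apply.
    apply: whpS (whpI (he _ _ kt) X0) _ _; last by rewrite addr0.
      by rewrite mulr_ge0.
    by move=> w [/= h1 h2]; rewrite psum_grid h2 subr0.
  by move=> w h' k km; rewrite -psum_grid; exact: h'.
Qed.

Lemma levy_multiple_passage X v y e q N : levy_process P X -> 0 < v -> 0 <= q ->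
  e <= q ^+ N.+1 ->
  whp P e [set w | forall s, 0 <= s -> s <= N.+1%:R * v -> X s w <= N.+1%:R * y] ->
  forall j, whp P q [set w | forall s, 0 <= s -> s <= v ->
    X (j%:R * v + s) w - X (j%:R * v) w <= y].
Proof.
move=> hX v0 q0 eq he j; have jv0 : 0 <= j%:R * v by rewrite mulr_ge0 // ltW.
have X0 : whp P 0 [set w | X 0 w = 0] by exact: whp_ae (levy_start hX).
apply: (@right_continuous_sup_whp (fun s w => X (j%:R * v + s) w - X (j%:R * v) w)) => //.
- by move=> s s0; apply: levy_measurable_incr hX _ _ => //; rewrite addr_ge0.
- move=> w s s0; apply: cvgB; last exact: cvg_cst.
  have := @levy_right_continuous _ _ _ _ _ hX w (j%:R * v + s) (addr_ge0 jv0 s0).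
  move=> /cvgrPdist_lt h; apply/cvgrPdist_lt => eps eps0; have [r /= r0 hr] := h eps eps0.
  exists r => //= u; rewrite /= distrC => us su; apply: hr => /=; last by rewrite ltrD2l.
  by rewrite distrC opprD addrACA subrr add0r.
- move=> m; have h0 : 0 <= v / 2 ^+ m by rewrite divr_ge0 // ?ltW // exprn_ge0.
  have m0 : (2 : R) ^+ m != 0 by rewrite expf_neq0.
  have hv : v / 2 ^+ m * (j * 2 ^ m)%:R = j%:R * v.
    by rewrite natrM natrX; field.
  have := @walk_multiple_passage _ _ _ P _ (levy_grid_iid 0 hX h0) (2 ^ m)%N N y e q q0 eq.
  move=> /(_ _ (j * 2 ^ m)%N) h; apply: whpS (h _) _ (lexx _).
    apply: whpS (whpI he X0) _ _; last by rewrite addr0.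
    move=> w [/= h1 h2] k km; rewrite psum_grid mulr0 h2 !subr0; apply: h1.
      by rewrite mulr_ge0.
    by apply: dyadic_le => //; exact: ltW.
  move=> w h' k km; have := h' k km; rewrite psum_grid_shift hv.
  by rewrite natrD mulrDr hv.
Qed.

Lemma levy_block X v A e N : levy_process P X -> 0 < v -> 0 <= e -> e <= 2^-1 ->
  whp P e [set w | forall s, 0 <= s -> s <= N.+1%:R * v -> `|X s w| <= A] ->
  whp P (2 * e / N.+1%:R) [set w | forall s, 0 <= s -> s <= v -> `|X s w| <= 2 * A].
Proof.
move=> hX v0 e0 e2 he.
have X0 : whp P 0 [set w | X 0 w = 0] by exact: whp_ae (levy_start hX).
suff h : whp P (2 * e / N.+1%:R) [set w | forall s, 0 <= s -> s <= v ->
    `|X s w - X 0 w| <= 2 * A].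
  apply: whpS (whpI h X0) _ _; last by rewrite addr0.
  by move=> w [/= h1 h0] s s0 st; have := h1 s s0 st; rewrite h0 subr0.
apply: (@right_continuous_sup_whp (fun s w => `|X s w - X 0 w|)) => //.
- move=> s s0; apply: measurableT_comp => //; exact: levy_measurable_incr hX _ _.
- move=> w s s0; apply: cvg_norm; apply: cvgB; last exact: cvg_cst.
  exact: (levy_right_continuous hX).
- move=> m; have h0 : 0 <= v / 2 ^+ m by rewrite divr_ge0 // ?ltW // exprn_ge0.
  have := @walk_block _ _ _ P _ (levy_grid_iid 0 hX h0) (2 ^ m)%N N e A e2 e0.
  move=> /(_ _) h; apply: whpS (h _) _ (lexx _).
    apply: whpS (whpI he X0) _ _; last by rewrite addr0.
    move=> w [/= h1 h2] k km; rewrite psum_grid mulr0 h2 !subr0; apply: h1.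
      by rewrite mulr_ge0.
    by apply: dyadic_le => //; exact: ltW.
  by move=> w h' k km; have := h' k km; rewrite psum_grid mulr0 subr0.
Qed.

End LevyMaximal.

(** * Concentration of a Levy process at a fixed time *)

Section Concentration.
Context {R : realType} {d : measure_display} {Omega : measurableType d}.
Variables (P : probability Omega R) (X : R -> Omega -> R).
Hypothesis hX : levy_process P X.
Implicit Types (A : set R) (a c e f h p s t u y : R).

Lemma measurable_floor_level h (n : nat) : 0 < h ->
  measurable [set x : R | choice.pickle (Num.floor (x / h)) = n].
Proof.
move=> h0; have [[k <-]|nk] := pselect (exists k : int, choice.pickle k = n).
  rewrite (_ : [set _ | _] = `[k%:~R * h, (k + 1)%:~R * h[%classic).
    exact: measurable_itv.
  apply/seteqP; split => x /=; rewrite in_itv /= -ler_pdivlMr // -ltr_pdivrMr // -floor_eq.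
    by move=> /(pcan_inj choice.pickleK) ->.
  by move=> /eqP ->.
rewrite (_ : [set _ | _] = set0); first exact: measurable0.
by apply/seteqP; split => x //= xn; apply: nk; exists (Num.floor (x / h)).
Qed.

(* Condition on X (s + u) - X s, discretized with mesh h. *)
Lemma levy_concentration s u h p A A' : 0 <= s -> 0 <= u -> 0 < h ->
  measurable A -> (forall y, measurable [set x | A' (x + y)]) ->
  (forall x z, A x -> `|z - x| <= h -> A' z) ->
  (p%:E < P [set w | A (X (s + u) w)])%E ->
  exists y, (p%:E < P [set w | A' (X s w + y)%R])%E.
Proof.
move=> s0 u0 h0 mA mA' AA' hp; apply: contrapT => H.
have {}H y : (P [set w | A' (X s w + y)%R] <= p%:E)%E.
  by rewrite leNgt; apply/negP => hy; apply: H; exists y.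
have mX := levy_measurable hX.
have mI : measurable_fun setT (fun w => X (s + u) w - X s w).
  by apply: levy_measurable_incr hX _ _; rewrite ?addr_ge0.
have p0 : 0 <= p.
  by rewrite -lee_fin; apply: le_trans (H 0); exact: measure_ge0.
pose L n := [set x : R | choice.pickle (Num.floor (x / h)) = n].
have mL n : measurable (L n) by exact: measurable_floor_level.
pose F n := [set w | L n (X (s + u) w - X s w)].
have mF n : measurable (F n) by exact: measurable_event.
have tF (G : set Omega) : trivIset setT (fun n => G `&` F n).
  apply/trivIsetP => i j _ _ ij; rewrite -subset0 => w [[_ hi] [_ hj]].
  by move: ij; rewrite -hi -hj eqxx.
have UF : \bigcup_n F n = setT.
  apply/seteqP; split => w // _.
  by exists (choice.pickle (Num.floor ((X (s + u) w - X s w) / h))).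
pose E := [set w | A (X (s + u) w)].
have mE : measurable E by apply: measurable_event => //; apply: mX; rewrite addr_ge0.
have EF n : (P (E `&` F n) <= p%:E * P (F n))%E.
  have [->|/set0P[w0 [Ew0 Fw0]]] := eqVneq (E `&` F n) set0.
    by rewrite measure0 mule_ge0.
  pose k := Num.floor ((X (s + u) w0 - X s w0) / h).
  apply: (@le_trans _ _ (P [set w | [set x | A' (x + k%:~R * h)%R] (X s w) /\
      L n (X (s + u) w - X s w)%R])).
    apply: le_prob; first exact: measurableI.
      apply: measurableI; last exact: mF.
      exact: (measurable_event (mX s s0) (mA' (k%:~R * h))).
    move=> w [Ew Fw]; split => //=; apply: (AA' _ _ Ew).
    have wk : Num.floor ((X (s + u) w - X s w) / h) = k.
      by apply: (pcan_inj choice.pickleK); move: Fw Fw0; rewrite /F /L /= => -> ->.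
    have /eqP := wk; rewrite floor_eq ler_pdivlMr // ltr_pdivrMr // intrD mulrDl mul1r.
    by move=> /andP[h1 h2]; rewrite ler_norml; apply/andP; split; lra.
  rewrite (levy_indep2 hX) // (levy_incr hX) //.
  by apply: lee_wpmul2r => //; exact: H.
move: hp; rewrite ltNge => /negP; apply.
rewrite -/E -(setIT E) -UF setI_bigcupr measure_bigcup //; last first.
  by move=> i _; exact: measurableI.
apply: (@le_trans _ _ (\big[+%E/0%E]_(0 <= i <oo | i \in setT) (p%:E * P (F i))%E)).
  by apply: lee_nneseries => // i *; exact: EF.
rewrite nneseriesZl // -measure_bigcup //.
  rewrite UF; suff : (p%:E * P setT <= p%:E)%E by [].
  by rewrite probability_setT mule1.
by have := tF setT; under eq_fun do rewrite setTI.
Qed.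

(** A stability argument of Hyers-Ulam type. Let S be the supremum of [|g|], finite thanks to [M].
    For [s <= t / 2], comparing [2 * g s] with [g (2 * s)] gives [|g s| <= (S + a) / 2]; for larger
    [s], [g t = 0] makes [g s] close to [- g (t - s)]. So [S <= S / 2 + 3 * a / 2]. *)
Lemma sup_dist_half (g : R -> R) t a M :
  0 <= a -> 0 < t ->
  (forall s, 0 <= s -> s <= t -> `|g s| <= M) ->
  (forall s u, 0 <= s -> 0 <= u -> s + u <= t -> `|g (s + u) - g s - g u| <= a) ->
  g t = 0 ->
  forall s, 0 <= s -> s <= t -> `|g s| <= 3 * a.
Proof.
move=> a0 t0 gM gD gt0.
pose S := [set `|g s| | s in [set s | 0 <= s /\ s <= t]].
have S0 : S !=set0 by exists `|g 0|, 0 => //; split => //; exact: ltW.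
have Sub : has_sup S.
  by split=> //; exists M => _ [s [s0 st] <-]; exact: gM.
have gS s : 0 <= s -> s <= t -> `|g s| <= sup S.
  by move=> s0 st; apply: sup_upper_bound Sub _ _; exists s.
have half s : 0 <= s -> s <= t / 2 -> `|g s| <= (sup S + a) / 2.
  move=> s0 st; have ss : s + s <= t by lra.
  have := gD s s s0 s0 ss; have := gS (s + s) (addr_ge0 s0 s0) ss.
  rewrite !ler_norml => /andP[h1 h2] /andP[h3 h4]; apply/andP; split; lra.
have h s : 0 <= s -> s <= t -> `|g s| <= sup S / 2 + 3 * a / 2.
  move=> s0 st; have [st2|st2] := leP s (t / 2); first by have := half s s0 st2; lra.
  have h1 : 0 <= t - s by lra.
  have h2 : s + (t - s) <= t by lra.
  have := gD s (t - s) s0 h1 h2; have -> : s + (t - s) = t by ring.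
  have : `|g (t - s)| <= (sup S + a) / 2 by apply: half; lra.
  rewrite gt0 !ler_norml => /andP[h3 h4] /andP[h5 h6]; apply/andP; split; lra.
have : sup S <= sup S / 2 + 3 * a / 2.
  by apply: ge_sup => // _ [s [s0 st] <-]; exact: h.
by move=> h1 s s0 st; have := gS s s0 st; lra.
Qed.

Lemma abs_fraction_le s t y : 0 <= s -> s <= t -> 0 < t -> `|s * (y / t)| <= `|y|.
Proof.
move=> s0 st t0; rewrite normrM normf_div (ger0_norm s0) (gtr0_norm t0) mulrA.
by rewrite ler_pdivrMr // mulrC ler_wpM2l.
Qed.

(** Each [X s] concentrates within [2 * a] of a centre [m s]; three such events have total error
    [6 * e < 1], so [m] is additive up to [6 * a]. Then [m s] is within [18 * a] of [s * (m t / t)],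
    and [m t] within [3 * a] of [c]: in all 23 times [a]. *)
Lemma levy_linear t c a e : 0 < t -> 0 < e -> 6 * e < 1 -> 0 < a ->
  whp P e [set w | `|X t w - c| <= a] ->
  forall s, 0 <= s -> s <= t -> whp P (2 * e) [set w | `|X s w - s * (c / t)| <= 24 * a].
Proof.
move=> t0 e0 e6 a0 hc.
have mX := levy_measurable hX.
have [m hm] : exists m : R -> R, forall s, 0 <= s -> s <= t ->
    whp P (2 * e) [set w | `|X s w - m s| <= 2 * a].
  suff : forall s, exists y, 0 <= s -> s <= t -> whp P (2 * e) [set w | `|X s w - y| <= 2 * a].
    by move=> /choice[m hm]; exists m.
  move=> s; have [/andP[s0 st]|/negP st] := boolP ((0 <= s) && (s <= t)); last first.
    by exists 0 => s0 st'; exfalso; apply: st; rewrite s0.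
  have ts0 : 0 <= t - s by rewrite subr_ge0.
  have [||||y hy] := @levy_concentration s (t - s) a (1 - 2 * e)
      [set x | `|x - c| <= a] [set x | `|x - c| <= 2 * a] s0 ts0 a0.
  - exact: measurable_near.
  - move=> y; have := measurable_near (c - y) (2 * a).
    by congr measurable; apply/seteqP; split => x /=; rewrite opprB addrA.
  - move=> x z /=; rewrite !ler_norml => /andP[h1 h2] /andP[h3 h4]; apply/andP; split; lra.
  - have -> : s + (t - s) = t by ring.
    apply: (@lt_le_trans _ _ (1 - e)%:E).
      by rewrite lte_fin; lra.
    apply/whpP => //; apply: measurable_event_le; apply: measurable_fun_dist.
    by apply: mX; exact: ltW.
  - exists (c - y) => _ _.
    apply/whpP; first by apply: measurable_event_le; apply: measurable_fun_dist; exact: mX.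
    apply: ltW; rewrite (_ : [set _ | _] = [set w | [set x | `|x - c| <= 2 * a] (X s w + y)]) //.
    by apply/seteqP; split => w /=; rewrite opprB addrA.
have mt : `|m t - c| <= 3 * a.
  have [|w [/=]] := whp_nonempty _ (whpI (hm t (ltW t0) (lexx _)) hc); first lra.
  rewrite !ler_norml => /andP[h1 h2] /andP[h3 h4]; apply/andP; split; lra.
have mD s u : 0 <= s -> 0 <= u -> s + u <= t -> `|m (s + u) - m s - m u| <= 6 * a.
  move=> s0 u0 sut.
  have us : u <= t by lra.
  have su : s <= t by lra.
  have hu := levy_whp_incr hX s0 u0 (measurable_near (m u) (2 * a)) (hm u u0 us).
  have [|w [[/= h1 h2] h3]] := whp_nonempty _
     (whpI (whpI (hm _ (addr_ge0 s0 u0) sut) (hm s s0 su)) hu); first lra.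
  move: h1 h2 h3; rewrite /= !ler_norml => /andP[h1 h2] /andP[h3 h4] /andP[h5 h6].
  apply/andP; split; lra.
have half0 : 0 < 2^-1 :> R by rewrite invr_gt0.
have [del del0 hdel] := levy_cvg0 hX half0 a0.
have mdel s : 0 <= s -> s <= t -> s < del -> `|m s| <= 3 * a.
  move=> s0 st sd.
  have [|w [/=]] := whp_nonempty _ (whpI (hm s s0 st) (hdel s s0 sd)); first lra.
  rewrite !ler_norml => /andP[h1 h2] /andP[h3 h4]; apply/andP; split; lra.
(* Approximate additivity alone does not bound [m]. Continuity in probability bounds it by [3 * a]
   near 0, and doubling the time turns a bound [M] into [2 * M + 6 * a], a recursion solved by
   [2 ^ n * (9 * a) - 6 * a]. *)
have mpow n : forall s, 0 <= s -> s <= t -> s < 2 ^+ n * del -> `|m s| <= 2 ^+ n * (9 * a) - 6 * a.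
  elim: n => [|n IH] s s0 st sn.
    by have := mdel s s0 st; move: sn; rewrite expr0 !mul1r => sn /(_ sn); lra.
  have s20 : 0 <= s / 2 by lra.
  have ss : s / 2 + s / 2 <= t by lra.
  have := mD _ _ s20 s20 ss; have -> : s / 2 + s / 2 = s by field.
  have := IH (s / 2) s20; rewrite exprS in sn; rewrite exprS.
  have -> : s / 2 <= t by lra.
  have -> : s / 2 < 2 ^+ n * del by lra.
  move=> /(_ isT isT); clear; rewrite !ler_norml => /andP[h1 h2] /andP[h3 h4]; apply/andP; split; lra.
have [n hn] : exists n : nat, t < 2 ^+ n * del.
  exists (Num.truncn (t / del)).
  rewrite -ltr_pdivrMr //; apply: lt_le_trans (truncnS_gt _) _.
  by rewrite -natrX ler_nat; exact: ltn_expl.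
have := @sup_dist_half (fun s => m s - s * (m t / t)) t (6 * a) (2 ^+ n * (9 * a) - 6 * a + `|m t|).
have tn0 : t != 0 by rewrite gt_eqF.
have a60 : 0 <= 6 * a by lra.
move=> /(_ a60 t0) H s s0 st.
have {}H : `|m s - s * (m t / t)| <= 3 * (6 * a).
  apply: H => //.
  - move=> u u0 ut; apply: le_trans (ler_normB _ _) _; apply: lerD.
      by apply: mpow => //; exact: le_lt_trans hn.
    exact: abs_fraction_le.
  - move=> u v u0 v0 uv; have := mD u v u0 v0 uv.
    by congr (`| _ | <= _); ring.
  - by rewrite mulrC divfK // subrr.
apply: whpS (hm s s0 st) _ (lexx _) => w /=.
have : `|s * (m t / t) - s * (c / t)| <= 3 * a.
  by rewrite -mulrBr -mulrBl; apply: le_trans mt; exact: abs_fraction_le.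
move: H; clear; rewrite !ler_norml => /andP[h1 h2] /andP[h3 h4] /andP[h5 h6]; apply/andP; split; lra.
Qed.

Lemma levy_functional t c a e : 0 < t -> 0 < e -> 6 * e < 1 -> 0 < a ->
  whp P e [set w | `|X t w - c| <= a] ->
  whp P (4 * e) [set w | forall s, 0 <= s -> s <= t -> `|X s w - s * (c / t)| <= 48 * a].
Proof.
move=> t0 e0 e6 a0 hc.
have e2 : 2 * e <= 2^-1 by lra.
have := levy_ottaviani hX t0 e2 (levy_linear t0 e0 e6 a0 hc).
by move=> /whpS; apply; [move=> w /= h s s0 st; have := h s s0 st; lra|lra].
Qed.

Lemma measurable_near_pm (c a : R) y : measurable [set x : R | `| `|x + y| - c| <= a].
Proof.
have mf : measurable_fun setT (fun x : R => `| `|x + y| - c|).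
  apply: measurable_fun_dist; apply: measurableT_comp => //.
  by apply: measurable_funD => //; exact: measurable_cst.
exact: measurable_event_le mf.
Qed.

(* X (t / 2) concentrates near at most two points c1 and c2 at distance 2 a;
   if both had a sizeable weight, X t would be near 2 c1 and near 2 c2, which
   cannot both be at distance a from 0. *)
Lemma levy_sign t a eta f : 0 < t -> 0 < a -> 0 < eta -> 5 * eta < 1 ->
  0 < f -> f <= 4^-1 ->
  whp P (f ^+ 2) [set w | `| `|X t w| - a| <= eta * a] ->
  exists2 c, `|c| = a & whp P (3 * f) [set w | `|X t w - c| <= 9 * eta * a].
Proof.
move=> t0 a0 eta0 eta5 f0 f4 ht.
have mX := levy_measurable hX.
have s0 : 0 <= t / 2 by lra.
have ea0 : 0 < eta * a by rewrite mulr_gt0.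
have ea5 : 5 * (eta * a) < a by nra.
have ff : f ^+ 2 <= f / 4 by rewrite expr2; nra.
have ff0 : 0 < f ^+ 2 by rewrite exprn_gt0.
have tt : t / 2 + t / 2 = t by field.
have mt : measurable [set w | `| `|X t w| - a| <= eta * a].
  by apply: measurable_event_le; apply: measurable_fun_dist; apply: measurableT_comp => //;
    apply: mX; exact: ltW.
have [||||y hy] := @levy_concentration (t / 2) (t / 2) (eta * a) (1 - 2 * f ^+ 2)
    [set x | `| `|x| - a| <= eta * a] [set x | `| `|x| - a| <= 2 * (eta * a)] s0 s0 ea0.
- by have := measurable_near_pm a (eta * a) 0; congr measurable; apply/seteqP; split => x /=; rewrite addr0.
- by move=> y; exact: measurable_near_pm.
- move=> x z /= h1 h2; have := le_trans (ler_dist_dist z x) h2; move: h1.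
  rewrite !ler_norml => /andP[h3 h4] /andP[h5 h6]; apply/andP; split; lra.
- rewrite tt; apply: (@lt_le_trans _ _ (1 - f ^+ 2)%:E); first by rewrite lte_fin; lra.
  exact/whpP.
pose E c := [set w | `|X (t / 2) w - c| <= 2 * (eta * a)].
have mE c : measurable (E c).
  by apply: measurable_event_le; apply: measurable_fun_dist; exact: mX.
pose c1 := a - y; pose c2 := - a - y.
have hE : whp P (2 * f ^+ 2) (E c1 `|` E c2).
  exists [set w | `| `|X (t / 2) w + y| - a| <= 2 * (eta * a)]; split; last exact: ltW.
  - by apply: measurable_event (measurable_near_pm a (2 * (eta * a)) y); exact: mX.
  - move=> w /=; rewrite /E /c1 /c2 /=; have [h|h] := leP 0 (X (t / 2) w + y).
      by rewrite (ger0_norm h) => h1; left; apply: le_trans h1; rewrite opprB addrA.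
    rewrite (ltr0_norm h) => h1; right; apply: le_trans h1.
    by rewrite -[leRHS]normrN le_eqVlt; apply/orP; left; apply/eqP; congr `| _ |; ring.
(* If both independent half-increments are near [c] with weight above [f], then [X t] is near
   [2 * c] with probability above [f ^ 2], which exceeds the error of the hypothesis: some outcome
   has [|X t|] near [a] as well. *)
have key c : (P (E c) <= f%:E)%E \/ `| `|2 * c| - a| <= 5 * (eta * a).
  have [|hc] := leP (P (E c)) f%:E; [by left|right].
  pose I := [set x : R | `|x - c| <= 2 * (eta * a)].
  have hp : ((f ^+ 2)%:E < P [set w | I (X (t / 2)%R w) /\
     I (X (t / 2 + t / 2) w - X (t / 2) w)%R])%E.
    rewrite (levy_indep2 hX s0 s0 (measurable_near _ _) (measurable_near _ _)) expr2 EFinM.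
    move: hc; rewrite -/(E c) -(fineK (fin_num_measure P _ (mE c))) -EFinM !lte_fin => hc.
    by rewrite ltr_pM // ltW.
  set G := [set w | _] in hp.
  have mG : measurable G.
    apply: measurableI; first exact: mE.
    apply: measurable_event_le; apply: measurable_fun_dist.
    by apply: levy_measurable_incr hX _ _; rewrite ?tt // ltW.
  have : G `&` [set w | `| `|X t w| - a| <= eta * a] !=set0.
    apply: contrapT => GE; move: hp; rewrite ltNge => /negP; apply.
    apply: (@le_trans _ _ (P (~` [set w | `| `|X t w| - a| <= eta * a]))).
      apply: le_prob => //; first exact: measurableC.
      by move=> w Gw Xw; apply: GE; exists w.
    exact/whpCP.
  move=> [w [[/= h1 h2] h3]]; rewrite tt in h2.
  have : `|X t w - 2 * c| <= 4 * (eta * a).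
    move: h1 h2; clear; rewrite /I /= !ler_norml => /andP[h4 h5] /andP[h6 h7]; apply/andP; split; lra.
  have := ler_dist_dist (X t w) (2 * c).
  move: h3; rewrite !ler_norml => /andP[h4 h5] /andP[h6 h7] /andP[h8 h9].
  have h10 : `|X t w - 2 * c| <= 4 * (eta * a) by rewrite ler_norml h8 h9.
  by clear - h4 h5 h6 h7 h10; apply/andP; split; lra.
(* A point of weight at most [f] can be discarded; all the mass is then near the other one, and
   doubling gives [X t] near [2 * c]. The tolerance 9 is 4 from the two halves plus 5 from replacing
   [2 * c] by [a] or [- a]. *)
have conc c c' : whp P (2 * f ^+ 2) (E c `|` E c') -> (P (E c') <= f%:E)%E ->
    exists2 z, `|z| = a & whp P (3 * f) [set w | `|X t w - z| <= 9 * eta * a].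
  move=> hcc hc'.
  have hEc : whp P (2 * f ^+ 2 + f) (E c).
    have h : whp P f (~` E c').
      by apply/whpCP; [exact: measurableC|rewrite setCK].
    by apply: whpS (whpI hcc h) _ (lexx _) => w [[]].
  have hI := levy_whp_incr hX s0 s0 (measurable_near c (2 * (eta * a))) hEc.
  rewrite tt in hI.
  have h2c : whp P (4 * f ^+ 2 + 2 * f) [set w | `|X t w - 2 * c| <= 4 * (eta * a)].
    apply: whpS (whpI hEc hI) _ _; last lra.
    move=> w []; clear; rewrite /E /= !ler_norml => /andP[h4 h5] /andP[h6 h7].
    by apply/andP; split; lra.
  have [|w [/= h1 h2]] := whp_nonempty _ (whpI h2c ht); first lra.
  have hz : `| `|2 * c| - a| <= 5 * (eta * a).
    have := le_trans (ler_dist_dist (X t w) (2 * c)) h1; move: h2; clear.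
    by rewrite !ler_norml => /andP[h6 h7] /andP[h8 h9]; apply/andP; split; lra.
  have [c0|c0] := leP 0 c.
    exists a; first exact: gtr0_norm.
    apply: whpS h2c _ _; last lra.
    move=> w' /=; move: hz; rewrite (ger0_norm (_ : 0 <= 2 * c)) ?mulr_ge0 //; clear.
    by rewrite !ler_norml => /andP[h6 h7] /andP[h8 h9]; apply/andP; split; lra.
  exists (- a); first by rewrite normrN gtr0_norm.
  apply: whpS h2c _ _; last lra.
  move=> w' /=; move: hz; rewrite (ltr0_norm (_ : 2 * c < 0)) ?pmulr_rlt0 //; clear.
  by rewrite !ler_norml => /andP[h6 h7] /andP[h8 h9]; apply/andP; split; lra.
have [h1|h1] := key c1.
  by apply: (conc c2 c1) => //; rewrite setUC.
have [h2|h2] := key c2; first exact: (conc c1 c2).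
(* The distance between [2 * c1] and [2 * c2] is [4 * a], whereas each has absolute value at most
   [(1 + 5 * eta) * a < 2 * a]. *)
exfalso; have : `|2 * c1 - 2 * c2| <= `|2 * c1| + `|2 * c2| by exact: ler_normB.
have -> : 2 * c1 - 2 * c2 = 4 * a by rewrite /c1 /c2; ring.
rewrite ger0_norm; last by lra.
move: h1 h2; rewrite !ler_norml => /andP[h6 h7] /andP[h8 h9]; lra.
Qed.

End Concentration.

(** * Neighbourhoods of 0 and norming functions up to equivalence *)

Section NearZero.
Context {R : realType}.
Implicit Types (Q : R -> Prop) (t : R).

Lemma near0P Q : (\forall t \near 0^'+, Q t) <->
  exists2 d : R, 0 < d & forall t, 0 < t -> t < d -> Q t.
Proof.
split=> [[r /= r0 hr]|[r r0 hr]]; exists r => // t; last first.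
  by rewrite /= sub0r normrN => tr t0; apply: hr => //; rewrite -(gtr0_norm t0).
by move=> t0 tr; apply: hr => //=; rewrite sub0r normrN gtr0_norm.
Qed.

Lemma near0_scale Q (k : R) : 0 < k ->
  (\forall t \near 0^'+, Q t) -> \forall t \near 0^'+, Q (k * t).
Proof.
move=> k0 /near0P[r r0 h]; apply/near0P; exists (r / k); first exact: divr_gt0.
by move=> t t0; rewrite ltr_pdivlMr // mulrC => tr; apply: h => //; exact: mulr_gt0.
Qed.

Lemma near0_le Q : (\forall t \near 0^'+, Q t) ->
  \forall t \near 0^'+, forall s, 0 < s -> s <= t -> Q s.
Proof.
move=> /near0P[r r0 h]; apply/near0P; exists r => // t t0 tr s s0 st.
by apply: h => //; exact: le_lt_trans tr.
Qed.

End NearZero.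

Section Equivalents.
Context {R : realType} {d : measure_display} {Omega : measurableType d}.
Variable P : probability Omega R.
Implicit Types (Y : R -> Omega -> \bar R) (N : R -> R).

(** Convergence of the ratio in a division-free form that covers real and extended values alike; a
    single [e] serves as both the relative tolerance and the error in probability. *)
Definition squeezed Y N := forall e : R, 0 < e -> \forall s \near 0^'+,
  whp P e [set w | ((((1 - e) * N s)%:E <= Y s w) /\ (Y s w <= ((1 + e) * N s)%:E))%E].

Lemma squeezeP (y : \bar R) (n e : R) : 0 < n ->
  (`|y * (n^-1)%:E - 1| <= e%:E)%E <->
  ((((1 - e) * n)%:E <= y) /\ (y <= ((1 + e) * n)%:E))%E.
Proof.
move=> n0; have ni0 : (0 < (n^-1)%:E)%E by rewrite lte_fin invr_gt0.
case: y => [y||].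
- rewrite -EFinM -EFinB /= !lee_fin ler_distl ler_pdivlMr // ler_pdivrMr //.
  by split=> [/andP//|[-> ->]].
- by rewrite gt0_mulye //= leye_eq; split => // -[_].
- by rewrite gt0_mulNye //= leeNy_eq; split => // -[].
Qed.

Lemma ratio_cvg1P Y N :
  (\forall r \near 0^'+, measurable_fun setT (Y r)) -> positive_near0 N ->
  ratio_cvg1_in_prob P Y N <-> squeezed Y N.
Proof.
move=> mY N0.
have mE r (e : R) : measurable_fun setT (Y r) ->
    measurable [set w | (e%:E < `| Y r w * ((N r)^-1)%:E - 1|)%E].
  move=> mYr.
  have mf : measurable_fun setT (fun w => `| Y r w * ((N r)^-1)%:E - 1|%E).
    apply: measurableT_comp => //; apply: emeasurable_funB => //.
      under eq_fun do rewrite muleC; exact: measurable_funeM.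
  by have := emeasurable_fun_o_infty measurableT mf e%:E; rewrite setTI.
have Ec r (e : R) : [set w | (e%:E < `| Y r w * ((N r)^-1)%:E - 1|)%E] =
    ~` [set w | (`| Y r w * ((N r)^-1)%:E - 1| <= e%:E)%E].
  by apply/seteqP; split => w /=; rewrite ltNge => /negP.
split=> [h e e0|h e e0].
- have /fine_cvgP[hf /cvgrPdist_le /(_ e e0) hc] := h e e0.
  near=> r; have mYr : measurable_fun setT (Y r) by near: r.
  have N0r : 0 < N r by near: r.
  have hw : whp P e [set w | (`| Y r w * ((N r)^-1)%:E - 1| <= e%:E)%E].
    apply/whpCP; first by have := measurableC (mE r e mYr); rewrite Ec setCK.
    rewrite -Ec -[X in (X <= _)%E]fineK; last by near: r.
    rewrite lee_fin; apply: le_trans (ler_norm _) _.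
    by rewrite -normrN -[X in `|X|]add0r; near: r.
  by apply: whpS hw _ (lexx _) => w /= /(squeezeP _ _ N0r).
- apply/fine_cvgP; split.
    near=> r; have mYr : measurable_fun setT (Y r) by near: r.
    by apply: fin_num_measure; exact: mE.
  apply/cvgrPdist_le => e' e'0.
  (* Here tolerance [e] and probability [e'] are independent, while [squeezed] has one parameter for
     both. *)
  have m0 : 0 < Num.min e e' by rewrite lt_min e0.
  have hm := h _ m0.
  near=> r; have mYr : measurable_fun setT (Y r) by near: r.
  have N0r : 0 < N r by near: r.
  have hw : whp P (Num.min e e') [set w | (`| Y r w * ((N r)^-1)%:E - 1| <= e%:E)%E].
    have := near hm r; move=> /(_ _) /whpS; apply => //.
    move=> w /= /(squeezeP _ _ N0r) /le_trans; apply.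
    by rewrite lee_fin ge_min lexx.
  move/whpCP : hw; rewrite -Ec => /(_ _) hw.
  rewrite /= sub0r normrN ger0_norm; last by apply: fine_ge0; exact: measure_ge0.
  rewrite -lee_fin fineK; last by apply: fin_num_measure; exact: mE.
  apply: le_trans (hw _) _; last by rewrite lee_fin ge_min lexx orbT.
  by have := measurableC (mE r e mYr); rewrite Ec setCK.
Unshelve. all: by end_near. Qed.

Lemma squeezed_equiv Y (N N' : R -> R) :
  positive_near0 N -> squeezed Y N ->
  (forall e, 0 < e -> \forall s \near 0^'+, `|N' s - N s| <= e * N s) ->
  squeezed Y N'.
Proof.
move=> N0 hN hNN' e e0.
pose e' := Num.min (e / 4) 2^-1.
have e'0 : 0 < e' by rewrite lt_min; apply/andP; split; lra.
have e'4 : e' <= e / 4 by rewrite ge_min lexx.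
have e'2 : e' <= 2^-1 by rewrite ge_min lexx orbT.
have h1 := hN _ e'0; have h2 := hNN' _ e'0.
near=> s.
have Ns : 0 < N s by near: s.
have /whpS : whp P e' [set w | ((((1 - e') * N s)%:E <= Y s w) /\ (Y s w <= ((1 + e') * N s)%:E))%E].
  by near: s.
have : `|N' s - N s| <= e' * N s by near: s.
rewrite ler_norml => /andP[h3 h4]; apply; last lra.
move=> w /= [h5 h6]; split.
  apply: le_trans h5; rewrite lee_fin.
  have N's : 0 < N' s by nra.
  have [e1|e1] := leP e 1; last by nra.
  have e1' : 0 <= 1 - e by lra.
  apply: le_trans (_ : (1 - e) * ((1 + e') * N s) <= _).
    by rewrite ler_wpM2l //; lra.
  by rewrite mulrA; apply: (ler_wpM2r (ltW Ns)); nra.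
apply: le_trans h6 _; rewrite lee_fin.
apply: (le_trans (y := (1 + e) * ((1 - e') * N s))); last by rewrite ler_wpM2l //; lra.
have ee : 0 <= e * (2^-1 - e') by rewrite mulr_ge0 ?subr_ge0 // ltW.
by rewrite mulrA; apply: (ler_wpM2r (ltW Ns)); lra.
Unshelve. all: by end_near. Qed.

(** One outcome lying in both intervals forces the two norming values together. This is how an
    arbitrary norming function is compared with a constructed one. *)
Lemma squeezed_unique Y (N N' : R -> R) :
  positive_near0 N -> positive_near0 N' -> squeezed Y N -> squeezed Y N' ->
  forall e, 0 < e -> \forall s \near 0^'+, `|N' s - N s| <= e * N s.
Proof.
move=> N0 N'0 hN hN' e e0.
pose e' := Num.min (e / 4) (4^-1).
have e'0 : 0 < e' by rewrite lt_min; apply/andP; split; lra.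
have e'4 : e' <= e / 4 by rewrite ge_min lexx.
have e'2 : e' <= 4^-1 by rewrite ge_min lexx orbT.
have h1 := hN _ e'0; have h2 := hN' _ e'0.
near=> s.
have Ns : 0 < N s by near: s.
have N's : 0 < N' s by near: s.
have hw1 : whp P e' [set w | ((((1 - e') * N s)%:E <= Y s w) /\ (Y s w <= ((1 + e') * N s)%:E))%E].
  by near: s.
have hw2 : whp P e' [set w | ((((1 - e') * N' s)%:E <= Y s w) /\ (Y s w <= ((1 + e') * N' s)%:E))%E].
  by near: s.
have [|w [[/= a1 a2] [/= a3 a4]]] := whp_nonempty _ (whpI hw1 hw2); first lra.
have := le_trans a1 a4; have := le_trans a3 a2; rewrite !lee_fin => a5 a6.
have a7 : N' s <= 2 * N s by nra.
by rewrite ler_norml; apply/andP; split; nra.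
Unshelve. all: by end_near. Qed.

End Equivalents.

(** * Passage times *)

Section PassageTime.
Context {R : realType} {d : measure_display} {Omega : measurableType d}.
Implicit Types (Y : R -> Omega -> R) (b r t u : R).

Lemma powR_right_continuous b t : 0 <= b -> 0 <= t ->
  s `^ b @[s --> t^'+] --> t `^ b.
Proof.
move=> b0; rewrite le_eqVlt => /orP[/eqP <-|t0].
  have [->|bn0] := eqVneq b 0.
    under eq_fun do rewrite powRr0; rewrite powRr0; exact: cvg_cst.
  by rewrite powR0 //; apply: powR_cvg0; rewrite lt_neqAle eq_sym bn0.
apply: cvg_at_right_filter.
have : derivable (fun s : R => s `^ b) t 1 by apply: derivable_powR; rewrite in_itv /= t0.
by move/derivable1_diffP/differentiable_continuous.
Qed.

Lemma passage_time_ltP Y b r u w :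
  (upper_passage_time Y b r w < u%:E)%E <->
  exists t, [/\ 0 <= t, t < u & r * t `^ b < Y t w].
Proof.
split=> [|[t [t0 tu rt]]].
  by move=> /ereal_inf_lt[_ [t [t0 rt] <-]]; rewrite lte_fin => tu; exists t.
apply: le_lt_trans (_ : (t%:E < _)%E); last by rewrite lte_fin.
by apply: ereal_inf_lbound; exists t.
Qed.

Lemma passage_time_ge Y b r u w :
  (forall t, 0 <= t -> t < u -> Y t w <= r * t `^ b) ->
  (u%:E <= upper_passage_time Y b r w)%E.
Proof.
move=> h; rewrite leNgt; apply/negP => /passage_time_ltP[t [t0 tu]].
by rewrite ltNge h.
Qed.

Lemma passage_time_le Y b r u w : 0 <= u -> r * u `^ b < Y u w ->
  (upper_passage_time Y b r w <= u%:E)%E.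
Proof. by move=> u0 ru; apply: ereal_inf_lbound; exists u. Qed.

(** The path minus the boundary is right continuous, so a crossing before [u] persists at some
    dyadic point of ]0, u[; the event [T < u] is thus a countable union over such points. *)
Lemma measurable_passage_time Y b r : 0 <= b ->
  (forall t, 0 <= t -> measurable_fun setT (Y t)) ->
  (forall w t, 0 <= t -> Y s w @[s --> t^'+] --> Y t w) ->
  measurable_fun setT (upper_passage_time Y b r).
Proof.
move=> b0 mY cY; apply: (measurability _ (ErealGenInftyO.measurableE R)) => _ /= -[_ [u ->] <-].
rewrite setTI.
have [u0|u0] := leP u 0.
  rewrite (_ : _ @^-1` _ = set0) // -subset0 => w /=; rewrite in_itv /=.
  by move=> /passage_time_ltP[t [t0 tu _]]; lra.
pose F m k := if u / 2 ^+ m * k%:R < u then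
  [set w | r * (u / 2 ^+ m * k%:R) `^ b < Y (u / 2 ^+ m * k%:R) w] else set0.
rewrite (_ : _ @^-1` _ = \bigcup_m \bigcup_k F m k).
  apply: bigcupT_measurable => m; apply: bigcupT_measurable => k.
  rewrite /F; case: ifP => _ //; apply: measurable_event_gt; apply: mY.
  by rewrite mulr_ge0 // divr_ge0 // ?ltW // exprn_ge0.
apply/seteqP; split => w /=; rewrite in_itv /=; last first.
  move=> [m _ [k _]]; rewrite /F; case: ifP => // ku h.
  apply/passage_time_ltP; exists (u / 2 ^+ m * k%:R); split => //.
  by rewrite mulr_ge0 // divr_ge0 // ?ltW // exprn_ge0.
move=> /passage_time_ltP[t [t0 tu rt]].
have h : Y s w - r * s `^ b @[s --> t^'+] --> Y t w - r * t `^ b.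
  apply: cvgB; first exact: cY.
  by apply: cvgMr; exact: powR_right_continuous.
have /cvgrPdist_lt/(_ (Y t w - r * t `^ b)) := h; rewrite subr_gt0 => /(_ rt) [q /= q0 hq].
have tu0 : 0 < Num.min q (u - t) by rewrite lt_min q0 subr_gt0.
have [m [k [_ tk kt]]] := dyadic_between t0 tu tu0.
have k1 : u / 2 ^+ m * k%:R < t + q by apply: lt_le_trans kt _; rewrite lerD2l ge_min lexx.
have k2 : u / 2 ^+ m * k%:R < u.
  by apply: lt_le_trans kt _; rewrite -lerBrDl ge_min lexx orbT.
exists m => //; exists k => //; rewrite /F k2 /=.
have := hq (u / 2 ^+ m * k%:R); rewrite /= distrC gtr0_norm ?subr_gt0 // ltrBlDl.
move=> /(_ k1 tk); rewrite ltr_norml => /andP[_]; lra.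
Qed.

End PassageTime.

(** * Uniform treatment of the one-sided and two-sided cases *)

Section Sided.
Context {R : realType}.

(* The identity for the one-sided passage time, the absolute value for the
   two-sided one. *)
Definition sided (phi : R -> R) := phi = (fun x => x) \/ phi = (fun x => `|x|).

Variables (phi : R -> R) (sphi : sided phi).

Lemma sided_le_norm x : phi x <= `|x|.
Proof. by case: sphi => ->; rewrite ?ler_norm. Qed.

Lemma sided_lip x y : `|phi x - phi y| <= `|x - y|.
Proof. by case: sphi => -> //; exact: ler_dist_dist. Qed.

Lemma sided_scale k x : 0 <= k -> phi (k * x) = k * phi x.
Proof. by move=> k0; case: sphi => -> //; rewrite normrM ger0_norm. Qed.

Lemma sided_cvg (T : Type) (F : set_system T) {FF : Filter F} (g : T -> R) (l : R) :
  g x @[x --> F] --> l -> phi (g x) @[x --> F] --> phi l.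
Proof. by case: sphi => -> // gl; exact: cvg_norm. Qed.

Lemma sided_measurable d (T : measurableType d) (g : T -> R) :
  measurable_fun setT g -> measurable_fun setT (fun x => phi (g x)).
Proof. by case: sphi => -> // mg; exact: measurableT_comp. Qed.

End Sided.

Section SidedConcentration.
Context {R : realType} {d : measure_display} {Omega : measurableType d}.
Variables (P : probability Omega R) (X : R -> Omega -> R).
Hypothesis hX : levy_process P X.
Variables (phi : R -> R) (sphi : sided phi).

Lemma sided_concentration (e : R) : 0 < e -> exists2 eta : R, 0 < eta &
  forall t a, 0 < t -> 0 < a -> whp P eta [set w | `|phi (X t w) - a| <= eta * a] ->
  exists c, [/\ phi c = a, `|c| = a & whp P e [set w | `|X t w - c| <= e * a]].
Proof.
move=> e0; case: sphi => ->.
  exists e => // t a t0 a0 h; exists a; split => //; exact: gtr0_norm.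
pose f := Num.min (e / 3) 4^-1.
have f0 : 0 < f by rewrite lt_min; apply/andP; split; lra.
have f4 : f <= 4^-1 by rewrite ge_min lexx orbT.
have f3 : 3 * f <= e by have : f <= e / 3 by [rewrite ge_min lexx]; lra.
pose eta := Num.min (e / 9) 6^-1.
have eta0 : 0 < eta by rewrite lt_min; apply/andP; split; lra.
have eta6 : 5 * eta < 1 by have : eta <= 6^-1 by [rewrite ge_min lexx orbT]; lra.
have eta9 : 9 * eta <= e by have : eta <= e / 9 by [rewrite ge_min lexx]; lra.
(* [levy_sign] consumes tolerance [eta] and error [f ^ 2], and returns [9 * eta] and [3 * f], both
   at most [e]. *)
exists (Num.min eta (f ^+ 2)).
  by rewrite lt_min eta0 exprn_gt0.
move=> t a t0 a0 h.
have [|c ca hc] := levy_sign hX t0 a0 eta0 eta6 f0 f4.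
  apply: whpS h _ _; last by rewrite ge_min lexx orbT.
  by move=> w /= /le_trans; apply; apply: ler_wpM2r; [exact: ltW|rewrite ge_min lexx].
exists c; split => //; apply: whpS hc _ f3 => w /= /le_trans; apply.
by rewrite ler_wpM2r //; exact: ltW.
Qed.

Lemma functional_concentration (e : R) : 0 < e -> exists2 eta : R, 0 < eta &
  forall t a c, 0 < t -> 0 < a -> whp P eta [set w | `|X t w - c| <= eta * a] ->
  whp P e [set w | forall s, 0 <= s -> s <= t -> `|X s w - s * (c / t)| <= e * a].
Proof.
move=> e0; pose eta := Num.min (e / 48) (7^-1).
have eta0 : 0 < eta by rewrite lt_min; apply/andP; split; lra.
have eta7 : 6 * eta < 1 by have : eta <= 7^-1 by [rewrite ge_min lexx orbT]; lra.
have eta48 : 48 * eta <= e by have : eta <= e / 48 by [rewrite ge_min lexx]; lra.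
exists eta => // t a c t0 a0 h.
have := levy_functional hX t0 eta0 eta7 (mulr_gt0 eta0 a0) h.
move=> /whpS; apply; last lra.
move=> w /= h' s s0 st; apply: le_trans (h' s s0 st) _; nra.
Qed.

Lemma sided_functional (e : R) : 0 < e -> exists2 eta : R, 0 < eta &
  forall t a, 0 < t -> 0 < a -> whp P eta [set w | `|phi (X t w) - a| <= eta * a] ->
  exists c, [/\ phi c = a, `|c| = a &
    whp P e [set w | forall s, 0 <= s -> s <= t -> `|X s w - s * (c / t)| <= e * a]].
Proof.
move=> /functional_concentration[e1 e10 h1].
have [eta eta0 h2] := sided_concentration e10.
exists eta => // t a t0 a0 /(h2 t a t0 a0)[c [ca cn hc]].
by exists c; split => //; exact: h1.
Qed.

End SidedConcentration.

Section PowerFacts.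
Context {R : realType}.
Implicit Types (l x b r s : R).

Lemma expr_lt_exists l x : 0 <= l -> l < 1 -> 0 < x -> exists n, l ^+ n < x.
Proof.
move=> l0 l1 x0.
pose n := Num.truncn (x^-1 / (1 - l)).
exists n.+1.
have hl : 0 < 1 - l by lra.
have hn : x^-1 < n.+1%:R * (1 - l) by rewrite -ltr_pdivrMr //; exact: truncnS_gt.
have hl1 : 1 - l <= 1 by lra.
have := @bernoulli_bound R (1 - l) n.+1 (ltW hl) hl1; rewrite subKr => hb.
have hx : x^-1 < 1 + n.+1%:R * (1 - l) by lra.
have x1 : 0 < 1 + n.+1%:R * (1 - l) by apply: lt_trans hx; rewrite invr_gt0.
apply: le_lt_trans (_ : (1 + n.+1%:R * (1 - l))^-1 < x).
  by rewrite -[leRHS]mul1r ler_pdivlMr.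
by rewrite -[ltRHS]invrK ltf_pV2 // posrE invr_gt0.
Qed.

Lemma geometric_bracket l x : 0 <= l -> l < 1 -> 0 < x -> x <= 1 ->
  exists n, l ^+ n.+1 < x /\ x <= l ^+ n.
Proof.
move=> l0 l1 x0 x1; have ex := expr_lt_exists l0 l1 x0.
case: (ex_minnP ex) => -[|n] hn hmin; first by move: hn; rewrite expr0 ltNge x1.
by exists n; split => //; rewrite leNgt; apply/negP => /hmin; rewrite ltnn.
Qed.

Lemma powR_exprn x b n : 0 <= x -> (x ^+ n) `^ b = (x `^ b) ^+ n.
Proof.
move=> x0; elim: n => [|n IH]; first by rewrite !expr0 powR1.
by rewrite !exprS powRM ?exprn_ge0 // IH.
Qed.

Lemma powR_lt1 x r : 0 <= x -> x < 1 -> 0 < r -> x `^ r < 1.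
Proof.
move=> x0 x1 r0; have := gt0_ltr_powR r0; move=> /(_ x 1).
by rewrite powR1 !nnegrE; apply.
Qed.

Lemma powR_gt1 x r : 1 < x -> 0 < r -> 1 < x `^ r.
Proof.
move=> x1 r0; have := gt0_ltr_powR r0; move=> /(_ 1 x).
by rewrite powR1 !nnegrE; apply => //; exact: le_trans (ltW x1).
Qed.

Lemma powR_splitM x r s : 0 < x -> x `^ (r + s) = x `^ r * x `^ s.
Proof. by move=> x0; rewrite powRD //; apply/implyP => _; rewrite gt_eqF. Qed.

(** The solution is [3 ^ (- 1 / (1 - b))]. Passing from [t] to [l * t] then multiplies the boundary
    by [3 * l], three times the factor of a line; this spare factor drives the chaining over scales,
    and [l <= 1 / 3] keeps [2 * l] below 1. *)
Lemma boundary_ratio_exists b : 0 <= b -> b < 1 ->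
  exists l, [/\ 0 < l, l <= 3^-1 & l `^ b = 3 * l].
Proof.
move=> b0 b1; have b1' : 0 < 1 - b by lra.
exists (3 `^ (- (1 - b)^-1)); set l := _ `^ _.
have l0 : 0 < l by apply: powR_gt0; lra.
have h : l `^ (b - 1) = 3.
  rewrite /l -powRrM (_ : _ * _ = 1) ?powRr1 //.
  by rewrite -(opprB 1 b) mulrNN mulVf // gt_eqF.
split => //.
  rewrite -(powR_inv1 (_ : 0 <= 3)) // /l; apply: ler_powR; first lra.
  by rewrite lerN2 invf_ge1 //; lra.
rewrite -{1}(subrK 1 b) powRD; last by apply/implyP => _; rewrite gt_eqF.
by rewrite h powRr1 // ltW.
Qed.

End PowerFacts.

(** * From the norming function to the passage time *)

Section Direct.
Context {R : realType} {d : measure_display} {Omega : measurableType d}.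
Variables (P : probability Omega R) (X : R -> Omega -> R).
Hypothesis hX : levy_process P X.
Variables (phi : R -> R) (sphi : sided phi) (B : R -> R).
Hypothesis B0 : positive_near0 B.
Hypothesis HB : forall e : R, 0 < e -> \forall t \near 0^'+,
  whp P e [set w | `|phi (X t w) - B t| <= e * B t].
Variables (b : R) (b0 : 0 <= b) (b1 : b < 1).

Lemma norming_functional (e : R) : 0 < e -> \forall t \near 0^'+, exists c,
  [/\ phi c = B t, `|c| = B t &
    whp P e [set w | forall s, 0 <= s -> s <= t -> `|X s w - s * (c / t)| <= e * B t]].
Proof.
move=> /(sided_functional hX sphi)[eta eta0 h]; have hb := HB eta0.
near=> t; apply: h; [by []|by near: t; exact: B0|by near: t].
Unshelve. all: by end_near. Qed.

(** On a common path, [X s] is close both to the end of the line attached to [s], of modulus [B s],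
    and to the point at time [s] of the line attached to [t], of modulus [s / t * B t]. *)
Lemma norming_linear (e : R) : 0 < e -> \forall t \near 0^'+,
  forall s, 0 < s -> s <= t -> `|B s - s / t * B t| <= e * B t.
Proof.
move=> e0; pose e' := Num.min (e / 3) 3^-1.
have e'0 : 0 < e' by rewrite lt_min; apply/andP; split; lra.
have e'3 : e' <= e / 3 by rewrite ge_min lexx.
have e'1 : e' <= 3^-1 by rewrite ge_min lexx orbT.
have h1 := near0_le (norming_functional e'0); have h2 := near0_le B0.
near=> t; have t0 : 0 < t by [].
have h1t : forall s, 0 < s -> s <= t -> exists c,
  [/\ phi c = B s, `|c| = B s &
    whp P e' [set w | forall s', 0 <= s' -> s' <= s -> `|X s' w - s' * (c / s)| <= e' * B s]].
  by near: t.
have h2t : forall s, 0 < s -> s <= t -> 0 < B s by near: t.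
move=> s s0 st.
have Bs := h2t s s0 st; have Bt := h2t t t0 (lexx t).
have [c [_ cs hs]] := h1t s s0 st; have [c' [_ ct ht]] := h1t t t0 (lexx t).
have [|w [/= a1 a2]] := whp_nonempty _ (whpI hs ht); first lra.
have {}a1 := a1 s (ltW s0) (lexx s); have {}a2 := a2 s (ltW s0) st.
have sn0 : s != 0 by rewrite gt_eqF.
rewrite mulrC divfK // in a1.
have a3 : `|c - s * (c' / t)| <= e' * (B s + B t).
  have -> : c - s * (c' / t) = (X s w - s * (c' / t)) - (X s w - c) by ring.
  by apply: le_trans (ler_normB _ _) _; rewrite mulrDr addrC; exact: lerD.
have a4 := le_trans (ler_dist_dist c (s * (c' / t))) a3.
have a5 : `|s * (c' / t)| = s / t * B t.
  by rewrite normrM normf_div ct (gtr0_norm s0) (gtr0_norm t0); ring.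
rewrite cs a5 in a4.
have st1 : s / t <= 1 by rewrite ler_pdivrMr // mul1r.
have st0 : 0 < s / t by exact: divr_gt0.
(* The comparison has error [e' * (B s + B t)]; this crude bound, from [e' <= 1 / 3], turns it into
   a multiple of [B t]. *)
have a6 : B s <= 2 * B t.
  move: a4; rewrite ler_norml => /andP[_ a4].
  have : s / t * B t <= B t by rewrite ler_piMl // ltW.
  have : e' * B s <= 3^-1 * B s by apply: ler_wpM2r => //; exact: ltW.
  have : e' * B t <= 3^-1 * B t by apply: ler_wpM2r => //; exact: ltW.
  move: a4; rewrite mulrDr; set x := s / t * B t; set y := e' * B s; set z := e' * B t.
  lra.
apply: le_trans a4 _.
apply: le_trans (_ : e' * (3 * B t) <= _); first by apply: (ler_wpM2l (ltW e'0)); lra.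
by rewrite mulrA; apply: ler_wpM2r; [exact: ltW|lra].
Unshelve. all: by end_near. Qed.

Lemma norming_sup (e : R) : 0 < e -> \forall t \near 0^'+,
  whp P e [set w | forall s, 0 <= s -> s <= t -> `|X s w| <= 2 * B t].
Proof.
move=> e0; pose e' := Num.min e 1.
have e'0 : 0 < e' by rewrite lt_min e0 ltr01.
have h := norming_functional e'0.
near=> t; have t0 : 0 < t by [].
have Bt : 0 < B t by near: t; exact: B0.
have [c [_ ct ht]] : exists c, [/\ phi c = B t, `|c| = B t &
    whp P e' [set w | forall s, 0 <= s -> s <= t -> `|X s w - s * (c / t)| <= e' * B t]].
  by near: t.
apply: whpS ht _ _; last by rewrite ge_min lexx.
move=> w /= hw s s0 st.
have a1 := hw s s0 st; have a2 := abs_fraction_le c s0 st t0.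
have a3 : e' * B t <= 1 * B t by apply: ler_wpM2r; [exact: ltW|rewrite ge_min lexx orbT].
have := ler_normD (X s w - s * (c / t)) (s * (c / t)); rewrite subrK.
rewrite ct in a2; lra.
Unshelve. all: by end_near. Qed.

(** Iterating [norming_linear] with ratio [2 * l] and tolerance [l / 2] costs a factor
    [2 * l + l / 2] per step, which stays below the factor [3 * l] of the boundary. *)
Lemma norming_geometric (l : R) : 0 < l -> l <= 3^-1 ->
  \forall t \near 0^'+, forall k, B ((2 * l) ^+ k * t) <= (5 / 2 * l) ^+ k * B t.
Proof.
move=> l0 l3; have l2 : 0 < l / 2 by lra.
have h1 := near0_le (norming_linear l2); have h2 := near0_le B0.
near=> t; have t0 : 0 < t by [].
have h1t : forall u, 0 < u -> u <= t -> forall s, 0 < s -> s <= u -> `|B s - s / u * B u| <= l / 2 * B u.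
  by near: t.
have h2t : forall s, 0 < s -> s <= t -> 0 < B s by near: t.
elim=> [|k IH]; first by rewrite !expr0 !mul1r.
have uk0 : 0 < (2 * l) ^+ k * t by rewrite mulr_gt0 // exprn_gt0 // mulr_gt0.
have uk1 : (2 * l) ^+ k * t <= t.
  by apply: ler_piMl; [exact: ltW|apply: exprn_ile1; lra].
have ukS : (2 * l) ^+ k.+1 * t = 2 * l * ((2 * l) ^+ k * t) by rewrite exprS; ring.
have := h1t _ uk0 uk1 ((2 * l) ^+ k.+1 * t); rewrite ukS.
have -> : 0 < 2 * l * ((2 * l) ^+ k * t) by rewrite mulr_gt0 // mulr_gt0.
have -> : 2 * l * ((2 * l) ^+ k * t) <= (2 * l) ^+ k * t.
  by apply: ler_piMl; [exact: ltW|lra].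
move=> /(_ isT isT); rewrite mulfK ?gt_eqF // ler_norml => /andP[_ h].
apply: le_trans (_ : 5 / 2 * l * B ((2 * l) ^+ k * t) <= _).
  by move: h; set x := B ((2 * l) ^+ k * t); set y := B _; nra.
by rewrite exprS -[X in _ <= X]mulrA; apply: ler_wpM2l => //; lra.
Unshelve. all: by end_near. Qed.

Lemma sum_half_powers (c : R) n : \sum_(j < n) c / 2 ^+ j = 2 * c - 2 * c / 2 ^+ n.
Proof.
elim: n => [|n IH]; first by rewrite big_ord0 expr0 divr1 subrr.
rewrite big_ord_recr /= IH exprS; have : (2 : R) ^+ n != 0 by rewrite expf_neq0.
by move=> h; field.
Qed.

(* With l `^ b = 3 l, at the scale l ^ k t the boundary is (3 l) ^ k B t, and
   u = (2 l) ^ k t satisfies B u <= (5 / 2 l) ^ k B t, which is eventually much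
   smaller; u contains 2 ^ k blocks of length l ^ k t, so the probability of a
   large value before time l ^ k t is O (2 ^ -k). *)
Lemma small_time : exists2 eta : R, 0 < eta < 1 & forall e, 0 < e ->
  \forall t \near 0^'+, whp P e [set w | forall s, 0 <= s -> s <= eta * t ->
     `|X s w| <= B t * (s / t) `^ b].
Proof.
have [l [l0 l3 lb]] := boundary_ratio_exists b0 b1.
(* From scale [K] on, [4 * (5 / 2 * l) ^ k = 4 * (5 / 6) ^ k * (3 * l) ^ k] is at most
   [(3 * l) ^ (k + 1)]. As [K] depends only on [l], the fraction of time obtained does not depend on
   [e]. *)
have [K hK] : exists K, (5 / 6) ^+ K < 3 * l / 4 :> R.
  by apply: expr_lt_exists; lra.
have ll0 : 0 <= l by exact: ltW.
have l1 : l < 1 by lra.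
exists (l ^+ K.+1).
  rewrite exprn_gt0 //= exprn_ilt1 //.
move=> e e0; pose e' := Num.min (e / 4) 2^-1.
have e'0 : 0 < e' by rewrite lt_min; apply/andP; split; lra.
have e'4 : e' <= e / 4 by rewrite ge_min lexx.
have e'2 : e' <= 2^-1 by rewrite ge_min lexx orbT.
have h1 := near0_le (norming_sup e'0); have h2 := near0_le B0.
have h3 := norming_geometric l0 l3.
near=> t; have t0 : 0 < t by [].
have h1t : forall u, 0 < u -> u <= t ->
   whp P e' [set w | forall s, 0 <= s -> s <= u -> `|X s w| <= 2 * B u] by near: t.
have Bt : 0 < B t by near: t; exact: B0.
have h3t : forall k, B ((2 * l) ^+ k * t) <= (5 / 2 * l) ^+ k * B t by near: t.
have step k : (K <= k)%N -> whp P (2 * e' / 2 ^+ k) [set w | forall s, 0 <= s -> s <= l ^+ k * t ->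
    `|X s w| <= (3 * l) ^+ k.+1 * B t].
  move=> Kk.
  have u0 : 0 < (2 * l) ^+ k * t by rewrite mulr_gt0 // exprn_gt0 // mulr_gt0.
  have u1 : (2 * l) ^+ k * t <= t.
    by apply: ler_piMl; [exact: ltW|apply: exprn_ile1; lra].
  have v0 : 0 < l ^+ k * t by rewrite mulr_gt0 // exprn_gt0.
  have N2 : (2 ^ k).-1.+1 = (2 ^ k)%N by rewrite prednK // expn_gt0.
  have := @levy_block _ _ _ P X (l ^+ k * t) (2 * B ((2 * l) ^+ k * t)) e' (2 ^ k).-1 hX v0 (ltW e'0) e'2.
  rewrite N2 natrX => /(_ _) hb; apply: whpS (hb _) _ (lexx _).
    apply: whpS (h1t _ u0 u1) _ (lexx _) => w /= hw s s0 st; apply: hw => //.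
    by rewrite exprMn -mulrA.
  move=> w /= hw s s0 st; apply: le_trans (hw s s0 st) _.
  apply: le_trans (_ : 4 * ((5 / 2 * l) ^+ k * B t) <= _); first by have := h3t k; lra.
  rewrite mulrA; apply: ler_wpM2r; first exact: ltW.
  have -> : 5 / 2 * l = 5 / 6 * (3 * l) by field.
  rewrite exprMn exprS mulrA; apply: ler_wpM2r; first by rewrite exprn_ge0 // mulr_ge0.
  have : (5 / 6 : R) ^+ k <= (5 / 6) ^+ K by apply: ler_wiXn2l => //; lra.
  by lra.
have X0 : whp P 0 [set w | X 0 w = 0] by exact: whp_ae (levy_start hX).
(* The errors [2 * e' / 2 ^ j] sum to at most [4 * e'], so a single event handles every scale. *)
have hbig : whp P (4 * e') (\bigcap_j [set w | forall s, 0 <= s -> s <= l ^+ (K + j) * t ->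
    `|X s w| <= (3 * l) ^+ (K + j).+1 * B t]).
  apply: (@whp_bigcap _ _ _ _ (fun j => 2 * e' / 2 ^+ j)).
    move=> j; apply: whpS (step _ (leq_addr j K)) _ _ => //.
    apply: ler_wpM2l; first by rewrite mulr_ge0 // ltW.
    rewrite lef_pV2 ?posrE ?exprn_gt0 //.
    by apply: ler_weXn2l; [rewrite ler1n|exact: leq_addl].
  move=> n; rewrite sum_half_powers.
  have : 0 <= 2 * (2 * e') / 2 ^+ n by rewrite divr_ge0 ?exprn_ge0 // !mulr_ge0 // ltW.
  lra.
apply: whpS (whpI hbig X0) _ _; last lra.
move=> w [/= hw hw0] s; rewrite le_eqVlt => /orP[/eqP <- _|s0 sl].
  by rewrite hw0 normr0 mulr_ge0 ?powR_ge0 // ltW.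
have x0 : 0 < s / t by exact: divr_gt0.
have xl : s / t <= l ^+ K.+1 by rewrite ler_pdivrMr.
have x1 : s / t <= 1.
  apply: le_trans xl _; exact: exprn_ile1 (ltW l1).
(* With [s / t] between [l ^ (n + 1)] and [l ^ n], the bound for scale [n] applies, and its factor
   [(3 * l) ^ (n + 1)] is [(l ^ (n + 1)) ^ b], at most the boundary at [s]. This accounts for the
   exponent [k.+1] above. *)
have [n [n1 n2]] := geometric_bracket ll0 l1 x0 x1.
have Kn : (K <= n)%N.
  rewrite leqNgt; apply/negP => nK.
  have : l ^+ K.+1 < l ^+ K.+1; last by rewrite ltxx.
  apply: lt_le_trans (_ : l ^+ n.+1 <= _).
    apply: lt_le_trans (_ : l ^+ K <= _); last by apply: ler_wiXn2l => //; exact: ltW.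
    by rewrite exprS gtr_pMl // exprn_gt0.
  by apply: le_trans (ltW n1) xl.
have := hw (n - K)%N I s (ltW s0); rewrite /= subnKC // => /(_ _) h.
apply: le_trans (h _) _; first by rewrite -ler_pdivrMr.
rewrite mulrC; apply: ler_wpM2l; first exact: ltW.
rewrite -lb -powR_exprn //; apply: ge0_ler_powR => //; rewrite ?nnegrE.
- by rewrite exprn_ge0.
- exact: ltW.
- exact: ltW.
Unshelve. all: by end_near. Qed.

(** With [x = s / t] in [eta, 1 - e], the boundary is [x * x ^ (b - 1) >= x * q] times [B t], where
    [q > 1], while the line is [x] times [B t]. The gap is at least [eta * (q - 1) * B t], and [del]
    is chosen below it; times before [eta * t] are the business of [small_time]. *)
Lemma below_boundary (e : R) : 0 < e -> e < 1 -> \forall t \near 0^'+,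
  whp P e [set w | forall s, 0 <= s -> s <= (1 - e) * t -> `|X s w| <= B t * (s / t) `^ b].
Proof.
move=> e0 e1; have [eta /andP[eta0 eta1] small] := small_time.
have e1' : 0 < 1 - e by lra.
pose q := (1 - e) `^ (b - 1).
have q1 : 1 < q.
  rewrite /q -(opprB 1 b) powRN -[ltLHS]invr1 ltf_pV2 ?posrE ?powR_gt0 //.
  by apply: powR_lt1; [exact: ltW|lra|rewrite subr_gt0].
pose del := Num.min (e / 2) (eta * (q - 1)).
have del0 : 0 < del.
  by rewrite lt_min; apply/andP; split; [lra|rewrite mulr_gt0 // subr_gt0].
have h1 := norming_functional del0.
have e20 : 0 < e / 2 by lra.
have h2 := small _ e20.
near=> t; have t0 : 0 < t by [].
have Bt : 0 < B t by near: t; exact: B0.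
have [c [_ ct ht]] : exists c, [/\ phi c = B t, `|c| = B t &
    whp P del [set w | forall s, 0 <= s -> s <= t -> `|X s w - s * (c / t)| <= del * B t]].
  by near: t.
have ht2 : whp P (e / 2) [set w | forall s, 0 <= s -> s <= eta * t ->
     `|X s w| <= B t * (s / t) `^ b] by near: t.
apply: whpS (whpI ht ht2) _ _; last first.
  have : del <= e / 2 by rewrite ge_min lexx.
  lra.
move=> w [/= a1 a2] s s0 st; have [se|se] := leP s (eta * t); first exact: a2.
have st' : s <= t by nra.
have := ler_normD (X s w - s * (c / t)) (s * (c / t)); rewrite subrK => /le_trans; apply.
have -> : `|s * (c / t)| = B t * (s / t).
  by rewrite normrM normf_div ct (ger0_norm s0) (gtr0_norm t0); ring.
apply: le_trans (lerD (a1 s s0 st') (lexx _)) _.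
rewrite [del * _]mulrC -mulrDr; apply: ler_wpM2l; first exact: ltW.
set x := s / t.
have xe : eta < x by rewrite ltr_pdivlMr.
have x0 : 0 < x by exact: lt_trans xe.
have x1 : x <= 1 - e by rewrite ler_pdivrMr.
have -> : x `^ b = x * x `^ (b - 1).
  by rewrite -[X in X * _]powRr1 ?(ltW x0) // -powR_splitM // addrCA subrr addr0.
have xq : q <= x `^ (b - 1).
  rewrite /q -(opprB 1 b) !powRN lef_pV2 ?posrE ?powR_gt0 //.
  have b1' : 0 <= 1 - b by rewrite subr_ge0 ltW.
  by apply: ge0_ler_powR; rewrite ?nnegrE //; lra.
have del1 : del <= eta * (q - 1) by rewrite ge_min lexx orbT.
apply: le_trans (_ : x * q <= _); last by rewrite ler_wpM2l // ltW.
have : eta * (q - 1) <= x * (q - 1) by rewrite ler_wpM2r //; lra.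
by rewrite mulrBr mulr1; lra.
Unshelve. all: by end_near. Qed.

(** At time [(1 + e) * t] the norming function has grown by a factor close to [1 + e], the boundary
    only by [(1 + e) ^ b]. *)
Lemma above_boundary (e : R) : 0 < e -> \forall t \near 0^'+,
  whp P e [set w | B t * (1 + e) `^ b < phi (X ((1 + e) * t) w)].
Proof.
move=> e0; have e1 : 0 < 1 + e by lra.
pose q := (1 + e) `^ b.
have q0 : 0 < q by exact: powR_gt0.
have qe : q < 1 + e.
  rewrite -[ltRHS]powRr1 ?ltW //.
  rewrite -[X in _ `^ X](subrK b 1) powR_splitM // ltr_pMl //.
  by apply: powR_gt1; [lra|rewrite subr_gt0].
(* The final comparison amounts to [(1 + e) * del * (1 + q) < 1 + e - q]; since
   [1 + q <= 2 * (1 + e)], this choice makes the left side at most half of the right one. *)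
pose del := Num.min e ((1 + e - q) / (4 * (1 + e) ^+ 2)).
have del0 : 0 < del by rewrite lt_min e0 /= divr_gt0 ?subr_gt0 // mulr_gt0 // exprn_gt0.
have h1 := near0_scale e1 (HB del0); have h2 := near0_scale e1 (norming_linear del0).
have h3 := near0_scale e1 B0.
near=> t; have t0 : 0 < t by [].
have Bt : 0 < B ((1 + e) * t) by near: t; exact: h3.
have ht : whp P del [set w | `|phi (X ((1 + e) * t) w) - B ((1 + e) * t)| <= del * B ((1 + e) * t)].
  by near: t.
have h2t : forall s, 0 < s -> s <= (1 + e) * t ->
   `|B s - s / ((1 + e) * t) * B ((1 + e) * t)| <= del * B ((1 + e) * t) by near: t.
apply: whpS ht _ _; last by rewrite ge_min lexx.
have tt : t <= (1 + e) * t by nra.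
have := h2t t t0 tt.
have -> : t / ((1 + e) * t) = (1 + e)^-1 by field; rewrite !gt_eqF.
move=> a1 w /= a2; move: a1 a2; rewrite !ler_norml => /andP[_ a1] /andP[a2 _].
set y := B ((1 + e) * t) in Bt a1 a2 *; set z := phi _ in a2 *.
have a3 : (1 - del) * y <= z by lra.
apply: lt_le_trans a3; rewrite -/q.
have a4 : B t <= ((1 + e)^-1 + del) * y by lra.
apply: le_lt_trans (_ : ((1 + e)^-1 + del) * y * q < _); first by rewrite ler_wpM2r // ltW.
rewrite mulrAC ltr_pM2r //.
have del1 : (1 + e) * del * (4 * (1 + e)) <= 1 + e - q.
  have : del * (4 * (1 + e) ^+ 2) <= 1 + e - q.
    by rewrite -ler_pdivlMr ?mulr_gt0 ?exprn_gt0 // ge_min lexx orbT.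
  by congr (_ <= _); ring.
have k0 : 0 < (1 + e) * del by exact: mulr_gt0.
have k1 : (1 + e) * del * (1 + q) <= (1 + e) * del * (2 * (1 + e)).
  by apply: (ler_wpM2l (ltW k0)); lra.
rewrite mulrDl -(ltr_pM2l e1) !mulrDr mulrA divff ?gt_eqF // mul1r.
lra.
Unshelve. all: by end_near. Qed.

(** Indexing by [t] avoids any inverse function: the level [B t / t ^ b] is the one whose boundary
    equals [B t] at time [t], so no regularity of the quotient is involved. *)
Lemma passage_time_squeezed (e : R) : 0 < e -> \forall t \near 0^'+,
  whp P e [set w |
    ((((1 - e) * t)%:E <= upper_passage_time (fun t w => phi (X t w)) b (B t / t `^ b) w) /\
     (upper_passage_time (fun t w => phi (X t w)) b (B t / t `^ b) w <= ((1 + e) * t)%:E))%E].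
Proof.
move=> e0; pose e' := Num.min (e / 2) 2^-1.
have e'0 : 0 < e' by rewrite lt_min; apply/andP; split; lra.
have e'2 : e' <= e / 2 by rewrite ge_min lexx.
have e'1 : e' < 1 by have : e' <= 2^-1 by [rewrite ge_min lexx orbT]; lra.
have h1 := below_boundary e'0 e'1; have h2 := above_boundary e'0.
near=> t; have t0 : 0 < t by [].
have h1t : whp P e' [set w | forall s, 0 <= s -> s <= (1 - e') * t -> `|X s w| <= B t * (s / t) `^ b].
  by near: t.
have h2t : whp P e' [set w | B t * (1 + e') `^ b < phi (X ((1 + e') * t) w)] by near: t.
apply: whpS (whpI h1t h2t) _ _; last lra.
have tb : t `^ b != 0 by rewrite gt_eqF // powR_gt0.
have bE s : 0 <= s -> B t / t `^ b * s `^ b = B t * (s / t) `^ b.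
  move=> s0; rewrite {1}(_ : s = s / t * t); last by rewrite divfK // gt_eqF.
  by rewrite powRM ?(divr_ge0 s0 (ltW t0)) ?(ltW t0) //; field.
move=> w [/= a1 a2]; split.
  apply: le_trans (_ : (((1 - e') * t)%:E <= _)%E).
    by rewrite lee_fin; apply: ler_wpM2r; [exact: ltW|lra].
  apply: passage_time_ge => s s0 st; rewrite bE //.
  by apply: le_trans (sided_le_norm sphi _) _; apply: a1 => //; exact: ltW.
apply: le_trans (_ : (_ <= ((1 + e') * t)%:E)%E) _; last first.
  by rewrite lee_fin; apply: ler_wpM2r; [exact: ltW|lra].
have u0 : 0 <= (1 + e') * t by rewrite mulr_ge0 ?ltW //; lra.
by apply: passage_time_le => //; rewrite bE // mulfK ?gt_eqF.
Unshelve. all: by end_near. Qed.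

End Direct.

(** * Regular variation and inverses *)

Section Scaling.
Context {R : realType}.
Implicit Types (f g : R -> R) (rho x e t r : R).

Lemma itv_pos (a t : R) : (t \in `]0, a[) = (0 < t < a).
Proof. by rewrite in_itv. Qed.

Lemma cont_incr_eq f g : (forall t, 0 < t -> f t = g t) ->
  cont_incr_near0 f -> cont_incr_near0 g.
Proof.
move=> fg [del del0 [cf incf]]; exists del => //; split.
  move=> t; rewrite itv_pos => /andP[t0 td].
  have fgt : {near t, f =1 g}.
    near=> u; apply: fg; near: u; exact: lt_nbhsr.
  apply/(cvg_trans (near_eq_cvg fgt)); rewrite -fg //.
  by apply: cf; rewrite itv_pos t0.
move=> s t; rewrite !itv_pos => /andP[s0 sd] /andP[t0 td] st.
by rewrite -!fg //; apply: incf => //; rewrite itv_pos ?s0 ?t0.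
Unshelve. all: by end_near. Qed.

Lemma power_scaling_le rho f x e : power_scaling_at0 rho f -> positive_near0 f ->
  0 < x -> 0 < e -> \forall t \near 0^'+, `|f (x * t) - x `^ rho * f t| <= e * f t.
Proof.
move=> sf f0 x0 e0; have /cvgrPdist_le/(_ e e0) h := sf x x0.
near=> t; have ft : 0 < f t by near: t; exact: f0.
have -> : f (x * t) - x `^ rho * f t = - ((x `^ rho - f (x * t) / f t) * f t).
  by field; rewrite gt_eqF.
rewrite normrN normrM (gtr0_norm ft); apply: ler_wpM2r; first exact: ltW.
by near: t.
Unshelve. all: by end_near. Qed.

(** Halving the argument multiplies [f] by about [2 ^ (- rho) < 1], so [f] decays geometrically
    along halvings of a fixed point; monotonicity fills in the other arguments. *)
Lemma scaling_to0 rho f : 0 < rho -> power_scaling_at0 rho f -> positive_near0 f ->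
  cont_incr_near0 f -> forall e, 0 < e -> \forall t \near 0^'+, f t < e.
Proof.
move=> rho0 sf f0 [del del0 [_ incf]] e e0.
have h20 : 0 < 2^-1 :> R by lra.
have h21 : 2^-1 < 1 :> R by lra.
have q1 : 2^-1 `^ rho < 1 :> R by apply: powR_lt1; lra.
have q0 : 0 < 2^-1 `^ rho :> R by apply: powR_gt0; lra.
pose e' : R := (1 - 2^-1 `^ rho) / 2.
have e'0 : 0 < e' by rewrite /e'; lra.
have /near0P[d1 d10 hd1] := power_scaling_le sf f0 h20 e'0.
have /near0P[d2 d20 hd2] := f0.
pose t1 := Num.min del (Num.min d1 d2) / 2.
have t10 : 0 < t1 by rewrite divr_gt0 // !lt_min del0 d10 d20.
have [t1d t1d1 t1d2] : [/\ t1 < del, t1 < d1 & t1 < d2].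
  have : Num.min del (Num.min d1 d2) <= del by rewrite ge_min lexx.
  have : Num.min del (Num.min d1 d2) <= d1 by rewrite !ge_min lexx orbT.
  have : Num.min del (Num.min d1 d2) <= d2 by rewrite !ge_min lexx !orbT.
  by rewrite /t1 in t10 *; split; lra.
pose q := 2^-1 `^ rho + e'.
have q'0 : 0 <= q by rewrite /q; lra.
have q'1 : q < 1 by rewrite /q /e'; lra.
have tk k : 0 < 2^-1 ^+ k * t1 by rewrite mulr_gt0 // exprn_gt0.
have tk1 k : 2^-1 ^+ k * t1 <= t1.
  by apply: ler_piMl; [exact: ltW|apply: exprn_ile1; lra].
have step k : f (2^-1 ^+ k * t1) <= q ^+ k * f t1.
  elim: k => [|k IH]; first by rewrite !expr0 !mul1r.
  have -> : 2^-1 ^+ k.+1 * t1 = 2^-1 * (2^-1 ^+ k * t1) by rewrite exprS mulrA.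
  have := hd1 _ (tk k) (le_lt_trans (tk1 k) t1d1).
  rewrite ler_norml => /andP[_ h].
  rewrite exprS -[X in _ <= X]mulrA.
  apply: le_trans (_ : q * f (2^-1 ^+ k * t1) <= _); first by rewrite /q mulrDl; lra.
  exact: ler_wpM2l.
have ft1 : 0 < f t1 by exact: hd2.
have [k hk] := expr_lt_exists q'0 q'1 (divr_gt0 e0 ft1).
apply/near0P; exists (2^-1 ^+ k * t1) => // t t0 tt.
have kd := le_lt_trans (tk1 k) t1d.
apply: lt_trans (_ : f (2^-1 ^+ k * t1) < e).
  by apply: incf => //; rewrite itv_pos ?t0 ?(lt_trans tt) ?tk.
by apply: le_lt_trans (step k) _; rewrite -ltr_pdivlMr.
Qed.

End Scaling.

Section Inverse.
Context {R : realType}.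
Variable f : R -> R.
Hypothesis f0 : positive_near0 f.
Hypothesis cif : cont_incr_near0 f.
Hypothesis f_to0 : forall e, 0 < e -> \forall t \near 0^'+, f t < e.
Implicit Types (C : R -> R) (r s t e : R).

Lemma incr_ivt : exists2 del : R, 0 < del & [/\
  {in `]0, del[ &, {homo f : s t / s < t}},
  forall t, 0 < t -> t < del -> 0 < f t &
  forall t r, 0 < t -> t < del -> 0 < r -> r < f t ->
    exists s, [/\ 0 < s, s < t & f s = r]].
Proof.
have [d1 d10 [cf incf]] := cif; have /near0P[d2 d20 hd2] := f0.
exists (Num.min d1 d2); first by rewrite lt_min d10.
have incf' : {in `]0, Num.min d1 d2[ &, {homo f : s t / s < t}}.
  move=> s t; rewrite !itv_pos !lt_min => /and3P[s0 sd _] /and3P[t0 td _].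
  by apply: incf; rewrite itv_pos ?s0 ?t0.
split => //; first by move=> t t0; rewrite lt_min => /andP[_]; exact: hd2.
move=> t r t0; rewrite lt_min => /andP[td1 td2] r0 rt.
have /near0P[d3 d30 hd3] := f_to0 r0.
pose s := Num.min t d3 / 2.
have s0 : 0 < s by rewrite divr_gt0 // lt_min t0.
have st : s < t.
  have : Num.min t d3 <= t by rewrite ge_min lexx.
  by rewrite /s in s0 *; lra.
have sd3 : s < d3.
  have : Num.min t d3 <= d3 by rewrite ge_min lexx orbT.
  by rewrite /s in s0 *; lra.
have fs : f s < r by exact: hd3.
have cst : {within `[s, t], continuous f}.
  apply: continuous_in_subspaceT => x; rewrite inE /= in_itv /= => /andP[sx xt].
  by apply: cf; rewrite itv_pos (lt_le_trans s0 sx) (le_lt_trans xt td1).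
have [|c] := IVT (ltW st) cst (v := r).
  by rewrite ge_min le_max (ltW fs) (ltW rt) orbT.
rewrite in_itv /= => /andP[sc ct] fc; exists c; split => //.
  exact: lt_le_trans sc.
rewrite lt_neqAle ct andbT; apply/eqP => ct'.
by move: rt; rewrite -fc ct' ltxx.
Qed.

Lemma exists_inverse : exists C, inverse_near0 f C.
Proof.
have [del del0 [incf posf ivt]] := incr_ivt.
pose d := del / 2.
have d0 : 0 < d by rewrite divr_gt0.
have dd : d < del by rewrite /d; lra.
have [C hC] : exists C : R -> R, forall r, 0 < r -> r < f d -> [/\ 0 < C r, C r < d & f (C r) = r].
  suff : forall r, exists s, 0 < r -> r < f d -> [/\ 0 < s, s < d & f s = r].
    by move=> /choice[C hC]; exists C.
  move=> r; have [/andP[r0 rd]|/negP h] := boolP ((0 < r) && (r < f d)).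
    by have [s hs] := ivt d r d0 dd r0 rd; exists s.
  by exists 0 => r0 rd; exfalso; apply: h; rewrite r0.
exists C, d, (f d); split => //; first exact: posf.
  move=> s; rewrite !itv_pos => /andP[s0 sd].
  have fs : f s < f d by apply: incf; rewrite ?itv_pos ?s0 ?d0 //= (lt_trans sd).
  have fs0 : 0 < f s by apply: posf => //; exact: lt_trans dd.
  have [c0 cd fc] := hC _ fs0 fs; split; last by rewrite fs0.
  have [cs|cs|//] := ltgtP (C (f s)) s.
    have : f (C (f s)) < f s by apply: incf; rewrite ?itv_pos ?s0 ?c0 //= ?(lt_trans _ dd).
    by rewrite fc ltxx.
  have : f s < f (C (f s)) by apply: incf; rewrite ?itv_pos ?s0 ?c0 //= ?(lt_trans _ dd).
  by rewrite fc ltxx.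
move=> r; rewrite !itv_pos => /andP[r0 rd]; have [c0 cd fc] := hC _ r0 rd.
by rewrite c0.
Qed.

Variable C : R -> R.
Hypothesis fC : inverse_near0 f C.

Lemma inverse_to0 e : 0 < e -> \forall r \near 0^'+, [/\ 0 < C r, C r < e & f (C r) = r].
Proof.
move=> e0; have [del del0 [incf posf ivt]] := incr_ivt.
have [d [eta [d0 eta0 h1 h2]]] := fC.
pose t := Num.min e (Num.min d del) / 2.
have t0 : 0 < t by rewrite divr_gt0 // !lt_min e0 d0 del0.
have [te td tdel] : [/\ t < e, t < d & t < del].
  have : Num.min e (Num.min d del) <= e by rewrite ge_min lexx.
  have : Num.min e (Num.min d del) <= d by rewrite !ge_min lexx orbT.
  have : Num.min e (Num.min d del) <= del by rewrite !ge_min lexx !orbT.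
  by rewrite /t in t0 *; split; lra.
have ft0 := posf t t0 tdel.
apply/near0P; exists (Num.min eta (f t)); first by rewrite lt_min eta0.
move=> r r0; rewrite lt_min => /andP[reta rft].
have [s [s0 st fs]] := ivt t r t0 tdel r0 rft.
have [] := h1 s; first by rewrite itv_pos s0 (lt_trans st td).
rewrite fs => Cs _; rewrite Cs; split => //; exact: lt_trans te.
Qed.

(** Order comparisons with [C r] become comparisons with values of [f]. Continuity, monotonicity and
    scaling of [C] all rest on this equivalence. *)
Lemma inverse_lt : exists2 d : R, 0 < d & exists2 eta : R, 0 < eta &
  forall r t, 0 < r -> r < eta -> 0 < t -> t < d ->
    [/\ 0 < C r, C r < d, (C r < t) = (r < f t) & (t < C r) = (f t < r)].
Proof.
have [del del0 [incf posf ivt]] := incr_ivt.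
exists del => //; have /near0P[eta eta0 heta] := inverse_to0 del0.
exists eta => // r t r0 re t0 td; have [c0 cd fc] := heta r r0 re.
have inC : C r \in `]0, del[ by rewrite itv_pos c0.
have int : t \in `]0, del[ by rewrite itv_pos t0.
split => //.
  have [ct|ct|ct] := ltgtP (C r) t.
  - by have := incf _ _ inC int ct; rewrite fc => ->.
  - by have := incf _ _ int inC ct; rewrite fc => /ltW; rewrite leNgt => /negbTE.
  - by rewrite -ct fc ltxx.
have [ct|ct|ct] := ltgtP (C r) t.
- by have := incf _ _ inC int ct; rewrite fc => /ltW; rewrite leNgt => /negbTE.
- by have := incf _ _ int inC ct; rewrite fc => ->.
- by rewrite -ct fc ltxx.
Qed.

Lemma inverse_positive : positive_near0 C.
Proof. by have := inverse_to0 ltr01; apply: filterS => r []. Qed.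

Lemma inverse_cont_incr : cont_incr_near0 C.
Proof.
have [d d0 [eta eta0 h]] := inverse_lt.
have /near0P[eta' eta'0 hinv] := inverse_to0 d0.
exists (Num.min eta eta'); first by rewrite lt_min eta0.
split.
  move=> r; rewrite itv_pos lt_min => /and3P[r0 re re'].
  have d20 : 0 < d / 2 by rewrite divr_gt0.
  have [c0 cd fc] := hinv r r0 re'.
  apply/cvgrPdist_le => e e0.
  pose e' := Num.min e (Num.min (C r) (d - C r)) / 2.
  have e'0 : 0 < e' by rewrite divr_gt0 // !lt_min e0 c0 subr_gt0.
  have [e1 e2 e3] : [/\ e' < e, e' < C r & e' < d - C r].
    have : Num.min e (Num.min (C r) (d - C r)) <= e by rewrite ge_min lexx.
    have : Num.min e (Num.min (C r) (d - C r)) <= C r by rewrite !ge_min lexx orbT.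
    have : Num.min e (Num.min (C r) (d - C r)) <= d - C r by rewrite !ge_min lexx !orbT.
    by rewrite /e' in e'0 *; split; lra.
  have t1 : 0 < C r - e' by lra.
  have t1d : C r - e' < d by lra.
  have t2 : 0 < C r + e' by lra.
  have t2d : C r + e' < d by lra.
  have [_ _ _ h1] := h r _ r0 re t1 t1d.
  have [_ _ h2 _] := h r _ r0 re t2 t2d.
  have f1 : f (C r - e') < r by rewrite -h1; lra.
  have f2 : r < f (C r + e') by rewrite -h2; lra.
  near=> r'.
  have r'0 : 0 < r' by near: r'; exact: lt_nbhsr.
  have r'e : r' < eta by near: r'; exact: lt_nbhsl.
  have r'1 : f (C r - e') < r' by near: r'; exact: lt_nbhsr.
  have r'2 : r' < f (C r + e') by near: r'; exact: lt_nbhsl.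
  have [_ _ _] := h r' _ r'0 r'e t1 t1d; rewrite r'1 => h3.
  have [_ _ + _] := h r' _ r'0 r'e t2 t2d; rewrite r'2 => h4.
  by clear - h3 h4 e1; rewrite ler_norml; apply/andP; split; lra.
move=> r r'; rewrite !itv_pos !lt_min => /and3P[r0 re re'] /and3P[r'0 r'e r'e'] rr'.
have [c0 cd fc] := hinv r' r'0 r'e'.
by have [_ _ -> _] := h r (C r') r0 re c0 cd; rewrite fc.
Unshelve. all: by end_near. Qed.

(** With [y = x ^ (1 / rho)], the values of [f] at [(y - e') * C r] and [(y + e') * C r] lie on
    either side of [x * r] for small [r], so [C (x * r) / C r] is caught between [y - e'] and
    [y + e']. *)
Lemma inverse_scaling rho : 0 < rho -> power_scaling_at0 rho f ->
  power_scaling_at0 rho^-1 C.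
Proof.
move=> rho0 sf x x0.
have [d d0 [eta eta0 h]] := inverse_lt.
pose y := x `^ rho^-1; have y0 : 0 < y by exact: powR_gt0.
have yx : y `^ rho = x by rewrite /y -powRrM mulVf ?gt_eqF // powRr1 // ltW.
apply/cvgrPdist_le => e e0.
pose e' := Num.min e y / 2.
have e'0 : 0 < e' by rewrite divr_gt0 // lt_min e0.
have [e1 e2] : e' < e /\ e' < y.
  have : Num.min e y <= e by rewrite ge_min lexx.
  have : Num.min e y <= y by rewrite ge_min lexx orbT.
  by rewrite /e' in e'0 *; split; lra.
have z1 : 0 < y - e' by lra.
have z2 : 0 < y + e' by lra.
have hz1 : (y - e') `^ rho < x.
  by rewrite -yx; apply: gt0_ltr_powR; rewrite ?nnegrE //; lra.
have hz2 : x < (y + e') `^ rho.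
  by rewrite -yx; apply: gt0_ltr_powR; rewrite ?nnegrE //; lra.
have g1 : 0 < (x - (y - e') `^ rho) / 2 by lra.
have g2 : 0 < ((y + e') `^ rho - x) / 2 by lra.
have /near0P[d1 d10 hd1] := power_scaling_le sf f0 z1 g1.
have /near0P[d2 d20 hd2] := power_scaling_le sf f0 z2 g2.
pose m := Num.min (Num.min d1 d2) (d / (y + e')).
have m0 : 0 < m by rewrite !lt_min d10 d20 divr_gt0.
have hC := inverse_to0 m0.
near=> r.
have r0 : 0 < r by [].
have [c0 cm fc] : [/\ 0 < C r, C r < m & f (C r) = r] by near: r.
have xr0 : 0 < x * r by exact: mulr_gt0.
have xre : x * r < eta.
  rewrite mulrC -ltr_pdivlMr //; near: r; apply/near0P; exists (eta / x) => //.
  exact: divr_gt0.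
move: cm; rewrite !lt_min => /andP[/andP[cm1 cm2]]; rewrite ltr_pdivlMr // mulrC => cm3.
have u2 : 0 < (y + e') * C r by exact: mulr_gt0.
have u1 : 0 < (y - e') * C r by exact: mulr_gt0.
have u1d : (y - e') * C r < d by apply: le_lt_trans cm3; apply: ler_wpM2r; [exact: ltW|lra].
have [_ _ _ h1] := h _ _ xr0 xre u1 u1d.
have [_ _ h2 _] := h _ _ xr0 xre u2 cm3.
have a1 : f ((y - e') * C r) < x * r.
  by have := hd1 _ c0 cm1; rewrite fc ler_norml => /andP[_]; clear - hz1 r0; nra.
have a2 : x * r < f ((y + e') * C r).
  by have := hd2 _ c0 cm2; rewrite fc ler_norml => /andP[+ _]; clear - hz2 r0; nra.
rewrite a1 in h1; rewrite a2 in h2.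
have q1 : y - e' < C (x * r) / C r by rewrite ltr_pdivlMr.
have q2 : C (x * r) / C r < y + e' by rewrite ltr_pdivrMr.
by clear - q1 q2 e1; rewrite -/y ler_norml; apply/andP; split; lra.
Unshelve. all: by end_near. Qed.

End Inverse.

(** * Smoothing the norming function *)

Section NormingFunction.
Context {R : realType}.
Variables (B : R -> R) (b : R).
Hypothesis b0 : 0 <= b.
Hypothesis b1 : b < 1.
Hypothesis B0 : positive_near0 B.
Hypothesis linB : forall e, 0 < e -> \forall t \near 0^'+,
  forall s, 0 < s -> s <= t -> `|B s - s / t * B t| <= e * B t.
Implicit Types (x e t s : R).

Let f t := B t / t `^ b.

Lemma norming_ratio_lt1 x : 0 < x -> x <= 1 -> B (x * t) / B t @[t --> 0^'+] --> x.
Proof.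
move=> x0 x1; apply/cvgrPdist_le => e e0; have h := linB e0.
near=> t; have t0 : 0 < t by [].
have Bt : 0 < B t by near: t; exact: B0.
have ht : forall s, 0 < s -> s <= t -> `|B s - s / t * B t| <= e * B t by near: t.
have xt0 : 0 < x * t by exact: mulr_gt0.
have xt1 : x * t <= t by rewrite ler_piMl // ltW.
have := ht _ xt0 xt1; rewrite mulfK ?gt_eqF // => h1.
have -> : x - B (x * t) / B t = - ((B (x * t) - x * B t) / B t) by field; rewrite gt_eqF.
by rewrite normrN normf_div (gtr0_norm Bt) ler_pdivrMr.
Unshelve. all: by end_near. Qed.

Lemma cvg_near0_scale (g : R -> R) (l x : R) : 0 < x ->
  g t @[t --> 0^'+] --> l -> g (x * t) @[t --> 0^'+] --> l.
Proof.
move=> x0 /cvgrPdist_le h; apply/cvgrPdist_le => e e0.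
exact: (near0_scale x0 (h e e0)).
Qed.

Lemma norming_ratio x : 0 < x -> B (x * t) / B t @[t --> 0^'+] --> x.
Proof.
move=> x0; have [x1|x1] := leP x 1; first exact: norming_ratio_lt1.
have xi0 : 0 < x^-1 by rewrite invr_gt0.
have xi1 : x^-1 <= 1 by rewrite invf_le1 // ltW.
have h := cvg_near0_scale x0 (norming_ratio_lt1 xi0 xi1).
have : (B (x^-1 * (x * t)) / B (x * t))^-1 @[t --> 0^'+] --> (x^-1)^-1.
  by apply: cvgV h; rewrite gt_eqF.
rewrite invrK; apply: cvg_trans; apply: near_eq_cvg.
near=> t; rewrite mulKf ?gt_eqF // invf_div //.
Unshelve. all: by end_near. Qed.

Lemma norming_scaling : power_scaling_at0 (1 - b) f.
Proof.
move=> x x0.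
have xE : x `^ (1 - b) = x * (x `^ b)^-1.
  by rewrite powR_splitM // powRr1 ?powRN // ltW.
rewrite xE.
have : B (x * t) / B t * (x `^ b)^-1 @[t --> 0^'+] --> x * (x `^ b)^-1.
  by apply: cvgMl; exact: norming_ratio.
apply: cvg_trans; apply: near_eq_cvg; near=> t.
have t0 : 0 < t by [].
have Bt : 0 < B t by near: t; exact: B0.
have tb : t `^ b != 0 by rewrite gt_eqF // powR_gt0.
have xb : x `^ b != 0 by rewrite gt_eqF // powR_gt0.
rewrite /f powRM ?ltW //; field.
by rewrite xb tb gt_eqF.
Unshelve. all: by end_near. Qed.

Lemma norming_powR_pos : positive_near0 f.
Proof.
near=> t; rewrite /f divr_gt0 ?powR_gt0 //; near: t; exact: B0.
Unshelve. all: by end_near. Qed.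

Lemma norming_powRE s t : 0 < s -> 0 < t -> f s = (s / t) `^ (- b) * (B s / t `^ b).
Proof.
move=> s0 t0; rewrite /f powRN powRM ?ltW ?invr_gt0 //.
have -> : t^-1 `^ b = (t `^ b)^-1 by rewrite -powR_inv1 ?ltW // -powRrM mulN1r powRN.
have sb : s `^ b != 0 by rewrite gt_eqF // powR_gt0.
have tb : t `^ b != 0 by rewrite gt_eqF // powR_gt0.
by field; rewrite sb tb.
Qed.

Lemma halving_exists s t : 0 < s -> 0 < t -> exists n, t <= 2 ^+ n * s.
Proof.
move=> s0 t0; have h0 : 0 <= 2^-1 :> R by lra.
have h1 : 2^-1 < 1 :> R by lra.
have [n] := expr_lt_exists h0 h1 (divr_gt0 s0 t0).
rewrite exprVn ltr_pdivlMr // mulrC ltr_pdivrMr ?exprn_gt0 // mulrC => /ltW.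
by exists n.
Qed.

(** Almost linearity is accurate only for [s] comparable with [t], so one descends by halving. Since
    [2 ^ (- (1 - b)) < 1], a halving gives [f (u / 2) <= f u] without loss, and the factor [1 + e]
    is paid once, at the last step where [s] lies between [u / 2] and [u]. *)
Lemma norming_upper e : 0 < e -> \forall t \near 0^'+,
  forall s, 0 < s -> s <= t -> f s <= (1 + e) * f t.
Proof.
move=> e0; have e2 : 0 < e / 2 by lra.
have q1 : 2^-1 `^ (1 - b) < 1 :> R by apply: powR_lt1; [lra|lra|rewrite subr_gt0].
have h20 : 0 < 2^-1 :> R by lra.
have q0 : 0 < 1 - 2^-1 `^ (1 - b) :> R by rewrite subr_gt0.
have h1 := near0_le (power_scaling_le norming_scaling norming_powR_pos h20 q0).
have h2 := near0_le (linB e2).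
have h3 := near0_le norming_powR_pos.
near=> t; have t0 : 0 < t by [].
have h1t : forall s, 0 < s -> s <= t ->
  `|f (2^-1 * s) - 2^-1 `^ (1 - b) * f s| <= (1 - 2^-1 `^ (1 - b)) * f s by near: t.
have h2t : forall u, 0 < u -> u <= t -> forall s, 0 < s -> s <= u ->
  `|B s - s / u * B u| <= e / 2 * B u by near: t.
have h3t : forall s, 0 < s -> s <= t -> 0 < f s by near: t.
suff H k u s : 0 < u -> u <= t -> 0 < s -> s <= u -> u <= 2 ^+ k * s -> f s <= (1 + e) * f u.
  by move=> s s0 st; have [n hn] := halving_exists s0 t0; exact: (H n).
elim: k u => [|k IH] u u0 ut s0 su.
  rewrite expr0 mul1r => us; have -> : s = u by apply/eqP; rewrite eq_le su.
  by rewrite ler_peMl ?(ltW (h3t _ u0 ut)) //; lra.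
move=> us; have [su2|su2] := leP s (u / 2).
  have u20 : 0 < u / 2 by lra.
  have u2t : u / 2 <= t by lra.
  apply: le_trans (IH (u / 2) u20 u2t s0 su2 _) _; first by move: us; rewrite exprS; lra.
  apply: ler_wpM2l; first lra.
  by have := h1t u u0 ut; rewrite mulrC ler_norml => /andP[_]; lra.
have fu := h3t _ u0 ut.
have ub : 0 < u `^ b by exact: powR_gt0.
have Bu : 0 < B u by move: fu; rewrite /f pmulr_lgt0 // invr_gt0.
have x0 : 0 < s / u by exact: divr_gt0.
have x2 : 2^-1 <= s / u by rewrite ler_pdivlMr //; lra.
have x1 : s / u <= 1 by rewrite ler_pdivrMr // mul1r.
rewrite (norming_powRE s0 u0); have := h2t u u0 ut s s0 su; rewrite ler_norml => /andP[_ hB].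
have xb : (s / u) `^ (- b) <= 2.
  rewrite powRN -[leRHS]invrK lef_pV2 ?posrE ?invr_gt0 ?powR_gt0 //.
  by apply: le_trans x2 _; apply: ger1_powR; [rewrite x0|exact: ltW].
have xbx : (s / u) `^ (- b) * (s / u) <= 1.
  rewrite -[X in _ * X](powRr1 (ltW x0)) -powR_splitM // addrC.
  rewrite -[leRHS](@powRr0 R (s / u)); apply: ger_powR; first by rewrite x0.
  by rewrite subr_ge0 ltW.
have hf : B s / u `^ b <= (s / u + e / 2) * f u.
  by rewrite /f mulrA; apply: ler_wpM2r; [rewrite invr_ge0 ltW|lra].
apply: le_trans (ler_wpM2l (powR_ge0 _ _) hf) _.
rewrite mulrA; apply: ler_wpM2r; first exact: ltW.
rewrite mulrDr; apply: lerD => //.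
have : (s / u) `^ (- b) * (e / 2) <= 2 * (e / 2) by apply: ler_wpM2r => //; exact: ltW.
lra.
Unshelve. all: by end_near. Qed.

(** A Potter-type bound by the same descent: [f (u / 2) >= f u / 4], so a halving is compensated
    exactly by the square, an exponent with room to spare over [1 - b]. The factor [1 + e] is again
    paid once. *)
Lemma norming_lower e : 0 < e -> \forall t \near 0^'+,
  forall s, 0 < s -> s <= t -> f t * (s / t) ^+ 2 <= (1 + e) * f s.
Proof.
move=> e0; pose del := Num.min 4^-1 (e / (2 * (1 + e))).
have del0 : 0 < del by rewrite lt_min divr_gt0 //; lra.
have del4 : del <= 4^-1 by rewrite ge_min lexx.
have dele : del * (2 * (1 + e)) <= e.
  by rewrite -ler_pdivlMr; [rewrite ge_min lexx orbT|lra].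
have h2 := near0_le (linB del0).
have h3 := near0_le norming_powR_pos.
near=> t; have t0 : 0 < t by [].
have h2t : forall u, 0 < u -> u <= t -> forall s, 0 < s -> s <= u ->
  `|B s - s / u * B u| <= del * B u by near: t.
have h3t : forall s, 0 < s -> s <= t -> 0 < f s by near: t.
have base u s : 0 < u -> u <= t -> 0 < s -> s <= u -> (s / u - del) * f u <= f s \/ s / u < del.
  move=> u0 ut s0 su; have [|x2] := ltP (s / u) del; [by right|left].
  have fu := h3t _ u0 ut.
  have ub : 0 < u `^ b by exact: powR_gt0.
  have Bu : 0 < B u by move: fu; rewrite /f pmulr_lgt0 // invr_gt0.
  have x0 : 0 < s / u by exact: divr_gt0.
  have x1 : s / u <= 1 by rewrite ler_pdivrMr // mul1r.
  rewrite (norming_powRE s0 u0); have := h2t u u0 ut s s0 su; rewrite ler_norml => /andP[hB _].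
  have xb : 1 <= (s / u) `^ (- b).
    rewrite powRN -invr1 lef_pV2 ?posrE ?powR_gt0 //.
    rewrite -[leRHS](@powRr0 R (s / u)); apply: ger_powR => //; by rewrite x0.
  have hf : (s / u - del) * f u <= B s / u `^ b.
    by rewrite /f mulrA; apply: ler_wpM2r; [rewrite invr_ge0 ltW|lra].
  apply: (le_trans hf); apply: ler_peMl => //.
  by apply: le_trans hf; apply: mulr_ge0; [lra|exact: ltW].
suff H k u s : 0 < u -> u <= t -> 0 < s -> s <= u -> u <= 2 ^+ k * s ->
    f u * (s / u) ^+ 2 <= (1 + e) * f s.
  by move=> s s0 st; have [n hn] := halving_exists s0 t0; exact: (H n).
elim: k u => [|k IH] u u0 ut s0 su.
  rewrite expr0 mul1r => us; have -> : s = u by apply/eqP; rewrite eq_le su.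
  rewrite divff ?gt_eqF // expr1n mulr1.
  by rewrite ler_peMl ?(ltW (h3t _ u0 ut)) //; lra.
have fu := h3t _ u0 ut.
move=> us; have [su2|su2] := leP s (u / 2).
  have u20 : 0 < u / 2 by lra.
  have u2t : u / 2 <= t by lra.
  have us2 : u / 2 <= 2 ^+ k * s by move: us; rewrite exprS; lra.
  apply: le_trans (IH (u / 2) u20 u2t s0 su2 us2).
  have hu : u / 2 / u = 2^-1 by field; rewrite gt_eqF.
  have uu : u / 2 <= u by lra.
  have [h|h] := base u (u / 2) u0 ut u20 uu.
    rewrite hu in h.
    have -> : s / (u / 2) = 2 * (s / u) by field; rewrite gt_eqF.
    rewrite [X in _ <= _ * X]exprMn [X in _ <= X]mulrA.
    apply: ler_wpM2r; first by rewrite sqr_ge0.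
    by rewrite expr2; nra.
  by move: h; rewrite hu; lra.
have x2 : 2^-1 < s / u by rewrite ltr_pdivlMr //; lra.
have x1 : s / u <= 1 by rewrite ler_pdivrMr // mul1r.
have [h|h] := base u s u0 ut s0 su; last lra.
have e1 : 0 <= 1 + e by lra.
apply: le_trans (ler_wpM2l e1 h).
rewrite [X in X <= _]mulrC [X in _ <= X]mulrA; apply: ler_wpM2r; first exact: ltW.
have xx : (s / u) ^+ 2 <= s / u.
  by rewrite expr2; apply: ler_piMl => //; exact/ltW/divr_gt0.
have ex : e * 2^-1 <= e * (s / u) by apply: ler_wpM2l; exact: ltW.
lra.
Unshelve. all: by end_near. Qed.

(* Sup-convolution of f with the kernel min 1 (u ^ 3), whose decay beats the
   growth of f; the factor 1 + t makes the result strictly increasing. *)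
Lemma smooth_norming : exists g : R -> R,
  [/\ positive_near0 g, cont_incr_near0 g &
    forall e, 0 < e -> \forall t \near 0^'+, `|g t - f t| <= e * f t].
Proof.
have [t0 t00 [up low pos]] : exists2 t0, 0 < t0 & [/\
  forall s t, 0 < s -> s <= t -> t < t0 -> f s <= 2 * f t,
  forall s t, 0 < s -> s <= t -> t < t0 -> f t * (s / t) ^+ 2 <= 2 * f s &
  forall t, 0 < t -> t < t0 -> 0 < f t].
  have /near0P[a a0 ha] := norming_upper ltr01.
  have /near0P[a' a'0 ha'] := norming_lower ltr01.
  have /near0P[a'' a''0 ha''] := norming_powR_pos.
  exists (Num.min a (Num.min a' a'')); first by rewrite !lt_min a0 a'0.
  split.
  - move=> s t s0 st; rewrite !lt_min => /and3P[ta _ _].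
    by apply: ha => //; exact: lt_le_trans st.
  - move=> s t s0 st; rewrite !lt_min => /and3P[_ ta _].
    by apply: ha' => //; exact: lt_le_trans st.
  - move=> t tpos; rewrite !lt_min => /and3P[_ _ ta]; exact: ha''.
pose ker s t := Num.min 1 ((t / s) ^+ 3).
pose S t := [set f s * ker s t | s in [set s | 0 < s /\ s < t0]].
pose g t := sup (S t).
have ker1 s t : 0 < s -> s <= t -> ker s t = 1.
  move=> s0 st; apply/min_idPl; rewrite exprn_ege1 // ler_pdivlMr // mul1r //.
have kerlt s t : 0 < s -> 0 < t -> t <= s -> ker s t = (t / s) ^+ 3.
  move=> s0 tp ts; apply/min_idPr; apply: exprn_ile1; first exact/ltW/divr_gt0.
  by rewrite ler_pdivrMr // mul1r.
have kbound s t : 0 < t -> t < t0 -> 0 < s -> s < t0 -> f s * ker s t <= 2 * f t.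
  move=> tp tt s0 st; have [ts|ts] := leP s t.
    by rewrite ker1 // mulr1; exact: up.
  rewrite kerlt //; last exact: ltW.
  apply: le_trans (low _ _ tp (ltW ts) st); apply: ler_wpM2l; first exact/ltW/pos.
  have x0 : 0 <= t / s by rewrite divr_ge0 // ltW.
  have x1 : t / s <= 1 by rewrite ler_pdivrMr // mul1r ltW.
  by rewrite exprS; apply: ler_piMl => //; rewrite sqr_ge0.
have Sne t : 0 < t -> t < t0 -> S t (f t).
  by move=> tp tt; exists t => //; rewrite ker1 // mulr1.
have Sub t : 0 < t -> t < t0 -> has_sup (S t).
  move=> tp tt; split; first by exists (f t); exact: Sne.
  by exists (2 * f t) => _ [s [s0 st] <-]; exact: kbound.
have gf t : 0 < t -> t < t0 -> f t <= g t.
  by move=> tp tt; apply: sup_upper_bound (Sub t tp tt) _ (Sne t tp tt).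
have gpos t : 0 < t -> t < t0 -> 0 < g t.
  by move=> tp tt; apply: lt_le_trans (gf t tp tt); exact: pos.
have gS t s : 0 < t -> t < t0 -> 0 < s -> s < t0 -> f s * ker s t <= g t.
  by move=> tp tt s0 st; apply: sup_upper_bound (Sub t tp tt) _ _; exists s.
have gle t M : 0 < t -> t < t0 -> (forall s, 0 < s -> s < t0 -> f s * ker s t <= M) -> g t <= M.
  move=> tp tt h; apply: ge_sup; first by exists (f t); exact: Sne.
  by move=> _ [s [s0 st] <-]; exact: h.
have gmono t t' : 0 < t -> t <= t' -> t' < t0 -> g t <= g t'.
  move=> tp tt' t't0; have t'p := lt_le_trans tp tt'.
  apply: gle => //; first exact: le_lt_trans tt' _.
  move=> s s0 st; apply: le_trans (gS t' s t'p t't0 s0 st).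
  apply: ler_wpM2l; first exact/ltW/pos.
  rewrite /ker le_min ge_min lexx /= ge_min; apply/orP; right.
  have ge0 v : 0 < v -> v / s \is Num.nneg by move=> vp; rewrite nnegrE divr_ge0 ?(ltW s0) ?(ltW vp).
  by apply: lerXn2r; [exact: ge0|exact: ge0|rewrite ler_pM2r // invr_gt0].
(* Together with monotonicity this gives continuity: [g] is trapped between 1 and [(t' / t) ^ 3]
   times itself. The kernel inherits the bound pointwise and the supremum preserves it. *)
have gcube t t' : 0 < t -> t <= t' -> t' < t0 -> g t' <= (t' / t) ^+ 3 * g t.
  move=> tp tt' t't0; have t'p := lt_le_trans tp tt'; have tt0 := le_lt_trans tt' t't0.
  apply: gle => // s s0 st.
  have x1 : 1 <= (t' / t) ^+ 3.
    by rewrite exprn_ege1 // ler_pdivlMr // mul1r.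
  have fs := ltW (pos s s0 st).
  apply: le_trans (_ : (t' / t) ^+ 3 * (f s * ker s t) <= _); last first.
    by apply: ler_wpM2l; [exact: le_trans x1|exact: gS].
  rewrite mulrCA; apply: ler_wpM2l => //.
  rewrite /ker minr_pMr; last exact: le_trans x1.
  rewrite mulr1 -exprMn (_ : t' / t * (t / s) = t' / s); last first.
    by field; rewrite !gt_eqF.
  by rewrite le_min !ge_min lexx orbT x1.
have gnear e : 0 < e -> \forall t \near 0^'+, g t <= (1 + e) * f t.
  move=> e0; have /near0P[a a0 ha] := norming_upper e0.
  have /near0P[a' a'0 ha'] := norming_lower e0.
  apply/near0P; exists (Num.min t0 (Num.min a (a' / 2))).
    by rewrite !lt_min t00 a0 divr_gt0.
  move=> t tp; rewrite !lt_min => /and3P[tt0 ta ta'].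
  have ft := pos t tp tt0.
  apply: gle => // s s0 st; have [ts|ts] := leP s t.
    by rewrite ker1 // mulr1; exact: ha.
  have x0 : 0 <= t / s by rewrite divr_ge0 // ltW.
  have x1 : t / s <= 1 by rewrite ler_pdivrMr // mul1r ltW.
  have fs := pos s s0 st.
  rewrite kerlt //; last exact: ltW.
  (* For [s >= 2 * t] the third power leaves a factor [t / s <= 1 / 2], which cancels the constant 2
     of [low], valid up to [t0]; for [s < 2 * t], [s] is small enough for the sharp constant
     [1 + e]. *)
  have [ts2|ts2] := leP (2 * t) s.
    have x2 : t / s <= 2^-1 by rewrite ler_pdivrMr //; lra.
    have h := low _ _ tp (ltW ts) st.
    rewrite exprS mulrCA.
    apply: le_trans (_ : 2^-1 * (f s * (t / s) ^+ 2) <= _).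
      by apply: ler_wpM2r => //; rewrite mulr_ge0 ?sqr_ge0 // ltW.
    have : 0 <= e * f t by rewrite mulr_ge0 // ltW.
    lra.
  have sa' : s < a' by lra.
  apply: le_trans (ha' s s0 sa' t tp (ltW ts)); apply: ler_wpM2l; first exact: ltW.
  by rewrite exprS; apply: ler_piMl => //; rewrite sqr_ge0.
have cg t : 0 < t -> t < t0 -> {for t, continuous g}.
  move=> tp tt0; apply/cvgrPdist_le => e e0.
  have gt0 := gpos t tp tt0.
  have cc : (u / t) ^+ 3 @[u --> t] --> (t / t) ^+ 3.
    have cu : u / t @[u --> t] --> t / t by apply: cvgMl; exact: cvg_id.
    exact: (cvgM cu (cvgM cu cu)).
  have eg : 0 < e / g t by exact: divr_gt0.
  have /cvgrPdist_le/(_ _ eg) hc := cc.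
  near=> u.
  have u0 : 0 < u by near: u; exact: lt_nbhsr.
  have ut0 : u < t0 by near: u; exact: lt_nbhsl.
  have : `|(t / t) ^+ 3 - (u / t) ^+ 3| <= e / g t by near: u.
  rewrite divff ?gt_eqF // expr1n ler_pdivlMr // => hu.
  have tn : t != 0 by rewrite gt_eqF.
  have un : u != 0 by rewrite gt_eqF.
  have [tu|tu] := leP t u.
    have h1 := gmono _ _ tp tu ut0; have h2 := gcube _ _ tp tu ut0.
    rewrite distrC ger0_norm ?subr_ge0 //.
    apply: le_trans hu; rewrite distrC.
    apply: le_trans (_ : ((u / t) ^+ 3 - 1) * g t <= _); first by lra.
    by apply: ler_wpM2r; [exact: ltW|exact: ler_norm].
  have h1 := gmono _ _ u0 (ltW tu) tt0; have h2 := gcube _ _ u0 (ltW tu) tt0.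
  rewrite ger0_norm ?subr_ge0 //; apply: le_trans hu.
  apply: le_trans (_ : (1 - (u / t) ^+ 3) * g t <= _); last first.
    by apply: ler_wpM2r; [exact: ltW|exact: ler_norm].
  have h3 : (u / t) ^+ 3 * g t <= g u.
    apply: le_trans (ler_wpM2l _ h2) _; first by rewrite exprn_ge0 // divr_ge0 // ltW.
    have utu : u / t * (t / u) = 1 by field; rewrite tn un.
    by rewrite mulrA -exprMn utu expr1n mul1r.
  lra.
exists (fun t => (1 + t) * g t); split.
- apply/near0P; exists t0 => // t tp tt; rewrite mulr_gt0 ?gpos //; lra.
- exists t0 => //; split.
    move=> t; rewrite itv_pos => /andP[tp tt]; apply: cvgM; last exact: cg.
    by apply: cvgD; [exact: cvg_cst|exact: cvg_id].
  move=> s t; rewrite !itv_pos => /andP[s0 st] /andP[tp tt] lst.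
  have h1 := gmono _ _ s0 (ltW lst) tt; have h2 := gpos s s0 st.
  nra.
- move=> e e0; pose e' := Num.min (e / 4) 1.
  have e'0 : 0 < e' by rewrite lt_min ltr01 andbT; lra.
  have e'4 : e' <= e / 4 by rewrite ge_min lexx.
  have e'1 : e' <= 1 by rewrite ge_min lexx orbT.
  have h := gnear e' e'0.
  near=> t; have tp : 0 < t by [].
  have tt : t < t0 by near: t; apply/near0P; exists t0.
  have te : t < e' by near: t; apply/near0P; exists e'.
  have h1 : g t <= (1 + e') * f t by near: t.
  have h2 := gf t tp tt; have h3 := pos t tp tt.
  rewrite ger0_norm; last by rewrite subr_ge0; nra.
  have h4 : (1 + t) * g t <= (1 + e') * ((1 + e') * f t).
    by apply: ler_pM => //; [lra|exact/ltW/gpos|lra].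
  have h5 : e' * e' <= e' by rewrite ler_piMr // ltW.
  have h6 : (1 + e') * (1 + e') <= 1 + e by nra.
  have h7 : (1 + e') * ((1 + e') * f t) <= (1 + e) * f t.
    by rewrite mulrA; apply: ler_wpM2r => //; exact: ltW.
  lra.
Unshelve. all: by end_near. Qed.

End NormingFunction.

(** * From the passage time to the norming function *)

Section ConverseTools.
Context {R : realType} {d : measure_display} {Omega : measurableType d}.
Variables (P : probability Omega R).

(* B t is the upper median of Y t. *)
Lemma norming_of_concentration (Y : R -> Omega -> R) :
  (forall e : R, 0 < e -> \forall t \near 0^'+, exists2 be, 0 < be &
     whp P e [set w | `|Y t w - be| <= e * be]) ->
  exists2 B : R -> R, positive_near0 B & forall e : R, 0 < e -> \forall t \near 0^'+,
    whp P e [set w | `|Y t w - B t| <= e * B t].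
Proof.
move=> hY; pose S t := [set x : R | whp P 2^-1 [set w | x <= Y t w]].
pose B t := sup (S t).
have key (e : R) t be : 0 < be -> 0 < e -> e <= 4^-1 -> whp P e [set w | `|Y t w - be| <= e * be] ->
    (1 - e) * be <= B t /\ B t <= (1 + e) * be.
  move=> be0 e0 e4 h.
  have inS : S t ((1 - e) * be).
    apply: whpS h _ _; last lra.
    by move=> w /=; rewrite ler_norml => /andP[h1 _]; lra.
  have ubS x : S t x -> x <= (1 + e) * be.
    move=> Sx; have [|w [/= h1]] := whp_nonempty _ (whpI Sx h); first lra.
    by rewrite ler_norml => /andP[_ h2]; lra.
  split; last by apply: ge_sup => //; exists ((1 - e) * be).
  apply: sup_upper_bound => //; split; first by exists ((1 - e) * be).
  by exists ((1 + e) * be).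
exists B.
  have h40 : 0 < 4^-1 :> R by lra.
  have h := hY _ h40; near=> t.
  have [be be0 hbe] : exists2 be, 0 < be & whp P 4^-1 [set w | `|Y t w - be| <= 4^-1 * be].
    by near: t.
  have [h1 _] := key _ _ _ be0 h40 (lexx _) hbe.
  by apply: lt_le_trans h1; rewrite mulr_gt0 //; lra.
move=> e e0; pose e' := Num.min (e / 4) 4^-1.
have e'0 : 0 < e' by rewrite lt_min; apply/andP; split; lra.
have e'4 : e' <= e / 4 by rewrite ge_min lexx.
have e'1 : e' <= 4^-1 by rewrite ge_min lexx orbT.
have h := hY _ e'0; near=> t.
have [be be0 hbe] : exists2 be, 0 < be & whp P e' [set w | `|Y t w - be| <= e' * be].
  by near: t.
have [h1 h2] := key _ _ _ be0 e'0 e'1 hbe.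
apply: whpS hbe _ _; last lra.
move=> w /=; rewrite !ler_norml => /andP[h3 h4].
have h5 : e' * be <= e / 4 * be by apply: ler_wpM2r => //; exact: ltW.
have h6 : be <= 2 * B t.
  have : e' * be <= 4^-1 * be by apply: ler_wpM2r => //; exact: ltW.
  lra.
have h7 : e / 4 * be <= e / 4 * (2 * B t) by apply: ler_wpM2l => //; lra.
by apply/andP; split; lra.
Unshelve. all: by end_near. Qed.

Variables (X : R -> Omega -> R).
Hypothesis hX : levy_process P X.

Lemma levy_multiple_concentration (u c a e : R) n : 0 <= u ->
  whp P e [set w | `|X u w - c| <= a] ->
  whp P (n%:R * e) [set w | `|X (n%:R * u) w - n%:R * c| <= n%:R * a].
Proof.
move=> u0 h; elim: n => [|n IH].
  rewrite mul0r; apply: whpS (whp_ae (levy_start hX)) _ (lexx _) => w /= X0.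
  by rewrite mul0r X0 !mul0r subr0 normr0.
have nu0 : 0 <= n%:R * u by rewrite mulr_ge0.
have hi := levy_whp_incr hX nu0 u0 (measurable_near c a) h.
apply: whpS (whpI IH hi) _ _; last by rewrite -natr1; lra.
move=> w [/= h1 h2]; rewrite -natr1.
have -> : (n%:R + 1) * u = n%:R * u + u by ring.
have -> : X (n%:R * u + u) w - (n%:R + 1) * c =
  (X (n%:R * u) w - n%:R * c) + (X (n%:R * u + u) w - X (n%:R * u) w - c) by ring.
by apply: le_trans (ler_normD _ _) _; rewrite mulrDl mul1r; exact: lerD.
Qed.

Variables (phi : R -> R) (sphi : sided phi).

Lemma sided_subadd x y : phi (x + y) <= phi x + phi y.
Proof. by case: sphi => -> //; exact: ler_normD. Qed.

(** For the absolute value, the one-sided inequality is applied to [X] and to its opposite, each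
    with [q / 2]; hence the choice [e = (q / 2) ^ (N + 1)]. *)
Lemma sided_multiple_passage (q : R) N : 0 < q -> exists2 e : R, 0 < e &
  forall v y, 0 < v ->
  whp P e [set w | forall s, 0 <= s -> s <= N.+1%:R * v -> phi (X s w) <= N.+1%:R * y] ->
  forall j, whp P q [set w | forall s, 0 <= s -> s <= v ->
    phi (X (j%:R * v + s) w - X (j%:R * v) w) <= y].
Proof.
move=> q0; have q20 : 0 < q / 2 by lra.
exists ((q / 2) ^+ N.+1); first exact: exprn_gt0.
move=> v y v0; case: sphi => -> h j.
  apply: whpS (levy_multiple_passage hX v0 (ltW q20) (lexx _) h j) _ _ => //; lra.
have h1 : whp P (q / 2) [set w | forall s, 0 <= s -> s <= v -> X (j%:R * v + s) w - X (j%:R * v) w <= y].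
  apply: (levy_multiple_passage hX v0 (ltW q20) (lexx _)).
  apply: whpS h _ (lexx _) => w /= hw s s0 sv; apply: le_trans (hw s s0 sv).
  exact: ler_norm.
have h2 : whp P (q / 2) [set w | forall s, 0 <= s -> s <= v ->
    - X (j%:R * v + s) w - - X (j%:R * v) w <= y].
  apply: (levy_multiple_passage (levy_opp hX) v0 (ltW q20) (lexx _)).
  apply: whpS h _ (lexx _) => w /= hw s s0 sv; apply: le_trans (hw s s0 sv).
  by rewrite -normrN; exact: ler_norm.
apply: whpS (whpI h1 h2) _ _; last lra.
move=> w [/= a1 a2] s s0 sv; rewrite ler_norml.
have := a1 s s0 sv; have := a2 s s0 sv => a3 a4; apply/andP; split; lra.
Qed.

End ConverseTools.

Section Converse.
Context {R : realType} {d : measure_display} {Omega : measurableType d}.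
Variables (P : probability Omega R) (X : R -> Omega -> R).
Hypothesis hX : levy_process P X.
Variables (phi : R -> R) (sphi : sided phi) (b : R).
Hypothesis b0 : 0 <= b.
Hypothesis b1 : b < 1.
Variable C : R -> R.
Hypothesis C0 : positive_near0 C.
Let T := upper_passage_time (fun t w => phi (X t w)) b.
Hypothesis HC : squeezed P T C.

Let powb0 (x : R) : 0 < x -> 0 < x `^ b. Proof. exact: powR_gt0. Qed.

Lemma passage_below (e : R) : 0 < e -> \forall r \near 0^'+,
  whp P e [set w | forall s, 0 <= s -> s < (1 - e) * C r -> phi (X s w) <= r * s `^ b].
Proof.
move=> e0; have h := HC e0; near=> r.
have /whpS : whp P e [set w | ((((1 - e) * C r)%:E <= T r w) /\ (T r w <= ((1 + e) * C r)%:E))%E].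
  by near: r.
apply => // w [/= h1 _] s s0 sC; rewrite leNgt; apply/negP => hs.
have : (T r w <= s%:E)%E by apply: passage_time_le.
by move=> /(le_trans h1); rewrite lee_fin leNgt sC.
Unshelve. all: by end_near. Qed.

(** The infimum need not be attained, so the upper end is relaxed from [1 + e] to [1 + 2 * e] in
    order to exhibit an actual crossing time. *)
Lemma passage_crossing (e : R) : 0 < e -> \forall r \near 0^'+,
  whp P e [set w | exists s, [/\ (1 - e) * C r <= s, 0 <= s, s < (1 + 2 * e) * C r &
     r * s `^ b < phi (X s w)]].
Proof.
move=> e0; have h := HC e0; near=> r.
have Cr : 0 < C r by near: r; exact: C0.
have /whpS : whp P e [set w | ((((1 - e) * C r)%:E <= T r w) /\ (T r w <= ((1 + e) * C r)%:E))%E].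
  by near: r.
apply => // w [/= h1 h2].
have : (T r w < ((1 + 2 * e) * C r)%:E)%E.
  by apply: le_lt_trans h2 _; rewrite lte_fin ltr_pM2r //; lra.
move=> /passage_time_ltP[s [s0 se hs]]; exists s; split => //.
have : (T r w <= s%:E)%E by apply: passage_time_le.
by move=> /(le_trans h1); rewrite lee_fin.
Unshelve. all: by end_near. Qed.

(** The length [v = 2 / (2 * J + 1) * C r] makes the window from [J * v] to [(J + 1) * v] symmetric
    about [C r]. For [J >= 2 * (N + 1)], [N + 1] such lengths fit before [C r / 2], where the path
    stays below [r * C r ^ b <= (N + 1) * del * (r * C r ^ b)]; multiple passage then bounds the
    rise over any one window. *)
Lemma passage_window (del : R) : 0 < del -> exists J0, forall J, (J0 <= J)%N ->
  forall q : R, 0 < q -> \forall r \near 0^'+,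
  whp P q [set w | forall s, 0 <= s -> s <= 2 / (2 * J%:R + 1) * C r ->
    phi (X (J%:R * (2 / (2 * J%:R + 1) * C r) + s) w - X (J%:R * (2 / (2 * J%:R + 1) * C r)) w)
     <= del * (r * C r `^ b)].
Proof.
move=> del0; pose N := Num.truncn del^-1.
have hN : 1 <= N.+1%:R * del.
  by rewrite -ler_pdivrMr // mul1r; apply/ltW/truncnS_gt.
exists (2 * N.+1)%N => J NJ q q0.
have [e e0 he] := sided_multiple_passage hX sphi N q0.
pose e' := Num.min e 4^-1.
have e'0 : 0 < e' by rewrite lt_min e0 /=; lra.
have e'4 : e' <= 4^-1 by rewrite ge_min lexx orbT.
have e'e : e' <= e by rewrite ge_min lexx.
have h := passage_below e'0.
have J1 : 0 < 2 * J%:R + 1 :> R by have := ler0n R J; lra.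
have NJ' : 2 * N.+1%:R <= J%:R :> R by rewrite -natrM ler_nat.
near=> r; have r0 : 0 < r by [].
have Cr : 0 < C r by near: r; exact: C0.
have v0 : 0 < 2 / (2 * J%:R + 1) * C r by rewrite mulr_gt0 // divr_gt0.
apply: (he _ _ v0).
have hr : whp P e' [set w | forall s, 0 <= s -> s < (1 - e') * C r -> phi (X s w) <= r * s `^ b].
  by near: r.
apply: whpS hr _ e'e => w /= hw s s0 sv.
have sC : s <= 2^-1 * C r.
  apply: le_trans sv _; rewrite mulrA; apply: ler_wpM2r; first exact: ltW.
  by rewrite mulrA ler_pdivrMr //; lra.
have sC' : s < (1 - e') * C r.
  by apply: le_lt_trans sC _; rewrite ltr_pM2r //; lra.
apply: le_trans (hw s s0 sC') _.
apply: le_trans (_ : r * C r `^ b <= _).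
  apply: ler_wpM2l; first exact: ltW.
  apply: ge0_ler_powR => //; rewrite ?nnegrE //; first exact: ltW.
  by apply: le_trans sC _; rewrite ler_piMl //; [exact: ltW|lra].
by rewrite [X in _ <= X]mulrA; apply: ler_peMl => //; rewrite mulr_ge0 ?powR_ge0 // ltW.
Unshelve. all: by end_near. Qed.

(* The boundary is crossed just after time u = (1 - 1 / Q) C r, and the
   increment after u is small, so X u was already close to the boundary. *)
Lemma passage_concentration (del : R) : 0 < del -> exists2 k : R, 2^-1 <= k < 1 &
  \forall r \near 0^'+,
    whp P del [set w | `|phi (X (k * C r) w) - r * C r `^ b| <= del * (r * C r `^ b)].
Proof.
move=> del0; have d20 : 0 < del / 2 by lra.
have [J0 hJ0] := passage_window d20.
pose J := maxn (maxn J0 1) (Num.truncn del^-1).+1.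
have J0J : (J0 <= J)%N by rewrite /J !leq_max leqnn.
have J1 : (1 <= J)%N by rewrite /J !leq_max leqnn orbT.
have Jdel : 1 <= J%:R * del.
  rewrite -ler_pdivrMr // mul1r; apply: le_trans (ltW (truncnS_gt _)) _.
  by rewrite ler_nat /J leq_max leqnn orbT.
have {}J1 : 1 <= J%:R :> R by rewrite ler1n.
have Q0 : 0 < 2 * J%:R + 1 :> R by lra.
pose k : R := 2 * J%:R / (2 * J%:R + 1).
have kE : k = 1 - (2 * J%:R + 1)^-1 by rewrite /k; field; rewrite gt_eqF.
have Qi0 : 0 < (2 * J%:R + 1)^-1 :> R by rewrite invr_gt0.
have Qidel : (2 * J%:R + 1)^-1 <= del / 2.
  rewrite -[leLHS]mul1r ler_pdivrMr //; lra.
exists k; first by rewrite kE /k; apply/andP; split; [rewrite -kE ler_pdivlMr //; lra|lra].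
have hw := hJ0 J J0J _ d20.
(* The second bound places the crossing time inside the window about [C r] and the window's start
   before [(1 - e) * C r]; the first makes the three errors add up to [del]. *)
pose e := Num.min (del / 4) ((2 * J%:R + 1)^-1 / 4).
have e0 : 0 < e by rewrite lt_min; apply/andP; split; lra.
have e1 : e <= del / 4 by rewrite ge_min lexx.
have e2 : e <= (2 * J%:R + 1)^-1 / 4 by rewrite ge_min lexx orbT.
have hb := passage_below e0; have hc := passage_crossing e0.
near=> r; have r0 : 0 < r by [].
have Cr : 0 < C r by near: r; exact: C0.
have uE : J%:R * (2 / (2 * J%:R + 1) * C r) = k * C r.
  by rewrite /k; field; rewrite gt_eqF.
have g1 : whp P (del / 2) [set w | forall s, 0 <= s -> s <= 2 / (2 * J%:R + 1) * C r ->
    phi (X (k * C r + s) w - X (k * C r) w) <= del / 2 * (r * C r `^ b)].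
  by rewrite -uE; near: r.
have g2 : whp P e [set w | forall s, 0 <= s -> s < (1 - e) * C r -> phi (X s w) <= r * s `^ b].
  by near: r.
have g3 : whp P e [set w | exists s, [/\ (1 - e) * C r <= s, 0 <= s, s < (1 + 2 * e) * C r &
     r * s `^ b < phi (X s w)]] by near: r.
apply: whpS (whpI (whpI g1 g2) g3) _ _; last lra.
set a := r * C r `^ b in g1 g2 g3 *.
have a0 : 0 < a by rewrite mulr_gt0 // powb0.
have k0 : 0 < k by rewrite /k divr_gt0 //; lra.
have k1 : k <= 1 by rewrite kE; lra.
have u0 : 0 < k * C r by exact: mulr_gt0.
move=> w [[/= a1 a2] [s [s1 s0 s2 s3]]].
have us : k * C r <= s.
  apply: le_trans s1; apply: ler_wpM2r; first exact: ltW.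
  by rewrite kE; lra.
have sv : s - k * C r <= 2 / (2 * J%:R + 1) * C r.
  rewrite lerBlDr -mulrDl; apply/(le_trans (ltW s2))/ler_wpM2r; first exact: ltW.
  by rewrite kE; lra.
have ub1 : phi (X (k * C r) w) <= a.
  apply: le_trans (a2 _ (ltW u0) _) _.
    by rewrite ltr_pM2r // kE; lra.
  rewrite /a; apply: ler_wpM2l; first exact: ltW.
  apply: ge0_ler_powR => //; rewrite ?nnegrE; [exact: ltW|exact: ltW|].
  by rewrite ler_piMl // ltW.
(* The crossing happens after [k * C r], and [k <= k ^ b] because [k <= 1] and [b <= 1]. *)
have lb1 : k * a <= r * s `^ b.
  apply: le_trans (_ : r * (k * C r) `^ b <= _); last first.
    apply: ler_wpM2l; first exact: ltW.
    by apply: ge0_ler_powR => //; rewrite ?nnegrE //; exact: ltW.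
  rewrite powRM ?(ltW k0) ?(ltW Cr) // [X in _ <= X]mulrCA; apply: ler_wpM2r.
    by rewrite mulr_ge0 ?powR_ge0 // ltW.
  by apply: ger1_powR; [rewrite k0|exact: ltW].
have a3 : phi (X s w - X (k * C r) w) <= del / 2 * a.
  have := a1 (s - k * C r); rewrite subr_ge0 => /(_ us sv).
  by have -> : k * C r + (s - k * C r) = s by ring.
have a4 : phi (X s w) <= phi (X s w - X (k * C r) w) + phi (X (k * C r) w).
  by apply: le_trans (sided_subadd sphi _ _); rewrite subrK.
have a5 : (2 * J%:R + 1)^-1 * a <= del / 2 * a by apply: ler_wpM2r => //; exact: ltW.
rewrite kE mulrBl mul1r in lb1.
have da : 0 <= del * a by rewrite mulr_ge0 ?ltW.
rewrite ler_norml; apply/andP; split; lra.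
Unshelve. all: by end_near. Qed.

Lemma passage_functional (del : R) : 0 < del -> exists2 k : R, 2^-1 <= k < 1 &
  \forall r \near 0^'+, exists c, [/\ phi c = r * C r `^ b, `|c| = r * C r `^ b &
    whp P del [set w | forall s, 0 <= s -> s <= k * C r ->
       `|X s w - s * (c / (k * C r))| <= del * (r * C r `^ b)]].
Proof.
move=> /(sided_functional hX sphi)[eta eta0 h].
have [k /andP[k0 k1] hk] := passage_concentration eta0.
exists k; first by rewrite k0.
near=> r; have r0 : 0 < r by [].
have Cr : 0 < C r by near: r; exact: C0.
apply: h.
- by rewrite mulr_gt0 //; lra.
- by rewrite mulr_gt0 // powb0.
- by near: r.
Unshelve. all: by end_near. Qed.

(** At time [k * C r] the process is near the boundary of level [r], hence beyond that of level
    [r / 2]; so [T (r / 2) <= k * C r] on some path. The choice [e = (1 - k) / 2] keeps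
    [k / (1 - e)] below 1. *)
Lemma passage_norm_half : exists2 rho : R, 0 < rho < 1 & \forall r \near 0^'+, C (r / 2) <= rho * C r.
Proof.
have h80 : 0 < 8^-1 :> R by lra.
have [k /andP[k0 k1] hk] := passage_concentration h80.
pose e := (1 - k) / 2.
have e0 : 0 < e by rewrite /e; lra.
have h2 := near0_scale (_ : 0 < 2^-1) (HC e0).
exists (k / (1 - e)).
  rewrite divr_gt0 //=; [|lra|rewrite /e; lra].
  by rewrite ltr_pdivrMr /e; lra.
near=> r; have r0 : 0 < r by [].
have Cr : 0 < C r by near: r; exact: C0.
have hT : whp P e [set w | ((((1 - e) * C (2^-1 * r))%:E <= T (2^-1 * r) w) /\
    (T (2^-1 * r) w <= ((1 + e) * C (2^-1 * r))%:E))%E].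
  by near: r; apply: h2; lra.
have hX' : whp P 8^-1 [set w | `|phi (X (k * C r) w) - r * C r `^ b| <= 8^-1 * (r * C r `^ b)].
  by near: r.
have [|w [[/= a1 _] /= a2]] := whp_nonempty _ (whpI hT hX'); first by rewrite /e; lra.
have a0 : 0 < r * C r `^ b by rewrite mulr_gt0 // powb0.
have u0 : 0 < k * C r by rewrite mulr_gt0 //; lra.
have : (T (2^-1 * r) w <= (k * C r)%:E)%E.
  apply: passage_time_le; first exact: ltW.
  apply: le_lt_trans (_ : 2^-1 * (r * C r `^ b) < _).
    rewrite -mulrA; apply: ler_wpM2l; first lra.
    apply: ler_wpM2l; first exact: ltW.
    apply: ge0_ler_powR => //; rewrite ?nnegrE; [exact: ltW|exact: ltW|].
    by rewrite ler_piMl // ltW.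
  by move: a2; rewrite ler_norml => /andP[a2 _]; lra.
move=> /(le_trans a1); rewrite lee_fin [r / 2]mulrC => a3.
by rewrite mulrAC ler_pdivlMr; [rewrite [X in X <= _]mulrC|rewrite /e; lra].
Unshelve. all: by end_near. Qed.

(** Adding [n] increments of length [k * C r] brings [X] near [n * c], of size [n * a], while the
    boundary of level [2 * r] is then at most [2 * n ^ b * a <= n * a / 2], as [n ^ (1 - b) >= 4].
    The signed centre [c] from [passage_functional] is essential: centres known only in modulus
    could cancel. *)
Lemma passage_norm_double : exists2 L : R, 1 <= L & \forall r \near 0^'+, C (2 * r) <= L * C r.
Proof.
have b1' : 0 < 1 - b by rewrite subr_gt0.
pose x : R := 4 `^ (1 - b)^-1.
have x1 : 1 <= x.
  rewrite /x -[leLHS](@powRr0 R 4); apply: ler_powR; first lra.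
  by rewrite invr_ge0 ltW.
pose n := (Num.truncn x).+1.
have xn : x <= n%:R by apply/ltW/truncnS_gt.
have n1 : 1 <= n%:R :> R by exact: le_trans xn.
have n0 : 0 < n%:R :> R by lra.
have n4 : 4 <= n%:R `^ (1 - b).
  apply: le_trans (_ : x `^ (1 - b) <= _).
    by rewrite /x -powRrM mulVf ?gt_eqF // powRr1.
  by apply: ge0_ler_powR; rewrite ?nnegrE; [exact: ltW|lra|lra|].
have h40 : 0 < (4 * n%:R)^-1 :> R by rewrite invr_gt0 mulr_gt0.
have [k /andP[k0 k1] hk] := passage_functional h40.
have h20 : 0 < 2^-1 :> R by lra.
have h2 := near0_scale (_ : 0 < 2) (HC h20).
exists (2 * n%:R); first lra.
near=> r; have r0 : 0 < r by [].
have Cr : 0 < C r by near: r; exact: C0.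
set a := r * C r `^ b.
have a0 : 0 < a by rewrite mulr_gt0 // powb0.
have u0 : 0 < k * C r by rewrite mulr_gt0 //; lra.
have hT : whp P 2^-1 [set w | ((((1 - 2^-1) * C (2 * r))%:E <= T (2 * r) w) /\
    (T (2 * r) w <= ((1 + 2^-1) * C (2 * r))%:E))%E].
  by near: r; apply: h2; lra.
have [c [cp cn hc]] : exists c, [/\ phi c = a, `|c| = a &
    whp P (4 * n%:R)^-1 [set w | forall s, 0 <= s -> s <= k * C r ->
       `|X s w - s * (c / (k * C r))| <= (4 * n%:R)^-1 * a]] by rewrite /a; near: r.
have hc1 : whp P (4 * n%:R)^-1 [set w | `|X (k * C r) w - c| <= (4 * n%:R)^-1 * a].
  apply: whpS hc _ (lexx _) => w /= hw; have := hw _ (ltW u0) (lexx _).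
  by rewrite [X in `|_ - X|]mulrCA divff ?gt_eqF // mulr1.
have hn := levy_multiple_concentration hX n (ltW u0) hc1.
have nn : n%:R * (4 * n%:R)^-1 = 4^-1 :> R by field; rewrite gt_eqF.
rewrite nn in hn.
have [|w [[/= a1 _] /= a2]] := whp_nonempty _ (whpI hT hn); first lra.
have nu0 : 0 < n%:R * (k * C r) by exact: mulr_gt0.
have lip := le_trans (sided_lip sphi _ _) a2.
rewrite (sided_scale sphi) // cp [X in _ <= X]mulrA nn in lip.
have nb0 : 0 < n%:R `^ b :> R by exact: powb0.
have nbn : 4 * n%:R `^ b <= n%:R :> R.
  rewrite -[leRHS](powRr1 (ltW n0)) -[X in _ <= _ `^ X](subrK b 1) powR_splitM //.
  by apply: ler_wpM2r => //; exact: ltW.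
have : (T (2 * r) w <= (n%:R * (k * C r))%:E)%E.
  apply: passage_time_le; first exact: ltW.
  apply: le_lt_trans (_ : 2 * n%:R `^ b * a < _).
    rewrite powRM ?(ltW n0) ?(ltW u0) // /a -!mulrA; apply: ler_wpM2l; first lra.
    rewrite mulrCA; apply: ler_wpM2l; first exact: ltW.
    apply: ler_wpM2l; first exact: ltW.
    apply: ge0_ler_powR => //; rewrite ?nnegrE; [exact: ltW|exact: ltW|].
    by rewrite ler_piMl // ltW.
  have : 4 * n%:R `^ b * a <= n%:R * a by apply: ler_wpM2r => //; exact: ltW.
  have : 1 * a <= n%:R * a by apply: ler_wpM2r => //; exact: ltW.
  by move: lip; rewrite ler_norml => /andP[lip _]; lra.
move=> /(le_trans a1); rewrite lee_fin => a3.
have : n%:R * (k * C r) <= n%:R * C r.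
  by apply: ler_wpM2l; [exact: ltW|rewrite ler_piMl // ltW].
lra.
Unshelve. all: by end_near. Qed.

(** Along [r1 / 2 ^ j] the times [u j = k * C (r1 / 2 ^ j)] tend to 0, by [passage_norm_half], and
    [u j <= L * u j.+1], by [passage_norm_double]. For [t] between consecutive ones, [X t] is near
    the line ending at [u j]. *)
Lemma passage_stable (e : R) : 0 < e -> \forall t \near 0^'+, exists2 be, 0 < be &
  whp P e [set w | `|phi (X t w) - be| <= e * be].
Proof.
move=> e0; have [rho /andP[rho0 rho1] hrho] := passage_norm_half.
have [L L1 hL] := passage_norm_double.
have L0 : 0 < L by lra.
(* The line has error [del * a] at time [u j]; relative to its size [t / u j * a] at time [t] this
   grows by at most [L]. *)
pose del := Num.min e (e / L).
have del0 : 0 < del by rewrite lt_min e0 divr_gt0.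
have dele : del <= e by rewrite ge_min lexx.
have delL : del * L <= e by rewrite -ler_pdivlMr // ge_min lexx orbT.
have [k /andP[k0 k1] hk] := passage_functional del0.
have hL' := near0_scale (_ : 0 < 2^-1) hL.
have [r1 r10 Hr] : exists2 r1 : R, 0 < r1 & forall r, 0 < r -> r <= r1 ->
  [/\ 0 < C r, C (r / 2) <= rho * C r, C r <= L * C (r / 2) &
   exists c, [/\ phi c = r * C r `^ b, `|c| = r * C r `^ b &
    whp P del [set w | forall s, 0 <= s -> s <= k * C r ->
       `|X s w - s * (c / (k * C r))| <= del * (r * C r `^ b)]]].
  have h : \forall r \near 0^'+, [/\ 0 < C r, C (r / 2) <= rho * C r, C r <= L * C (r / 2) &
   exists c, [/\ phi c = r * C r `^ b, `|c| = r * C r `^ b &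
    whp P del [set w | forall s, 0 <= s -> s <= k * C r ->
       `|X s w - s * (c / (k * C r))| <= del * (r * C r `^ b)]]].
    near=> r; split.
    - by near: r; exact: C0.
    - by near: r.
    - have : C (2 * (2^-1 * r)) <= L * C (2^-1 * r) by near: r; apply: hL'; lra.
      by rewrite mulrA divff ?mul1r // [r / 2]mulrC.
    - by near: r.
  have /near0P[r2 r20 h2] := h; exists (r2 / 2); first by rewrite divr_gt0.
  by move=> r r0 rr; apply: h2 => //; lra.
have rj0 j : 0 < r1 / 2 ^+ j by rewrite divr_gt0 // exprn_gt0.
have rj1 j : r1 / 2 ^+ j <= r1.
  rewrite ler_pdivrMr ?exprn_gt0 // ler_peMr //; first exact: ltW.
  by rewrite exprn_ege1 //; lra.
have rjS j : r1 / 2 ^+ j / 2 = r1 / 2 ^+ j.+1.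
  by rewrite exprS; have : (2 : R) ^+ j != 0 by [rewrite expf_neq0]; move=> ?; field.
pose u j := k * C (r1 / 2 ^+ j).
have kp : 0 < k by lra.
have Cr1 : 0 < C r1 by have [] := Hr r1 r10 (lexx _).
have uj j : u j <= rho ^+ j * (k * C r1).
  elim: j => [|j IH]; first by rewrite /u !expr0 divr1 mul1r.
  have [_ h _ _] := Hr _ (rj0 j) (rj1 j); rewrite rjS in h.
  rewrite exprS -[X in _ <= X]mulrA; apply: le_trans (ler_wpM2l (ltW rho0) IH).
  by rewrite /u mulrCA; apply: ler_wpM2l => //; exact: ltW.
apply/near0P; exists (u 0%N).
  by rewrite /u expr0 divr1 mulr_gt0.
move=> t t0 tu.
have ex : exists j, u j.+1 < t.
  have kc : 0 < k * C r1 by exact: mulr_gt0.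
  have [j hj] := expr_lt_exists (ltW rho0) rho1 (divr_gt0 t0 kc).
  exists j; apply: le_lt_trans (uj j.+1) _; rewrite -ltr_pdivlMr //.
  by apply: le_lt_trans hj; rewrite exprS ler_piMl ?exprn_ge0 // ltW.
case: (ex_minnP ex) => j hj hmin.
have tuj : t <= u j.
  case: j hj hmin => [_ _|j hj hmin]; first exact: ltW.
  by rewrite leNgt; apply/negP => /hmin; rewrite ltnn.
have [Cj _ hLj [c [cp cn hc]]] := Hr _ (rj0 j) (rj1 j).
rewrite rjS in hLj.
set r := r1 / 2 ^+ j in Cj hLj cp cn hc.
set a := r * C r `^ b in cp cn hc.
have a0 : 0 < a by rewrite mulr_gt0 ?powb0 //; exact: rj0.
have uj0 : 0 < u j by rewrite /u mulr_gt0.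
exists (t / u j * a); first by rewrite mulr_gt0 // divr_gt0.
apply: whpS hc _ dele => w /= hw.
have h1 := hw t (ltW t0) tuj.
have -> : t / u j * a = phi (t * (c / u j)).
  rewrite -cp -(sided_scale sphi); last by rewrite divr_ge0 // ltW.
  by congr phi; ring.
apply: le_trans (sided_lip sphi _ _) _; apply: le_trans h1 _.
rewrite (sided_scale sphi) ?(ltW t0) // mulrC [c / _]mulrC (sided_scale sphi); last by rewrite invr_ge0 ltW.
rewrite cp mulrC.
have uL : u j <= L * t.
  apply: le_trans (_ : L * u j.+1 <= _); last by apply: ler_wpM2l; exact: ltW.
  by rewrite /u mulrCA; apply: ler_wpM2l => //; exact: ltW.
have tL : 1 <= L * (t / u j) by rewrite mulrA ler_pdivlMr // mul1r.
apply: le_trans (_ : del * (L * (t / u j)) * a <= _).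
  by rewrite -mulrA; apply: ler_wpM2l; [exact: ltW|apply: ler_peMl => //; exact: ltW].
have -> : e * (t * ((u j)^-1 * a)) = e * (t / u j) * a by ring.
apply: ler_wpM2r; first exact: ltW.
by rewrite [X in X <= _]mulrA; apply: ler_wpM2r => //; rewrite divr_ge0 // ltW.
Unshelve. all: by end_near. Qed.

Lemma passage_norming : exists2 B : R -> R, positive_near0 B &
  forall e : R, 0 < e -> \forall t \near 0^'+, whp P e [set w | `|phi (X t w) - B t| <= e * B t].
Proof. exact: norming_of_concentration passage_stable. Qed.

End Converse.

(** * Asymptotically equivalent functions *)

Section AsymptoticEquivalence.
Context {R : realType}.
Implicit Types (f g D : R -> R) (rho e : R).

Lemma cont_incr_measurable f : cont_incr_near0 f ->
  exists2 delta : R, 0 < delta & measurable_fun `]0, delta[%classic f.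
Proof.
move=> [del del0 [cf _]]; exists del => //.
apply: subspace_continuous_measurable_fun; first exact: measurable_itv.
by apply: continuous_in_subspaceT => x; rewrite inE /= => xd; exact: cf.
Qed.

Lemma equiv_positive f g : positive_near0 f ->
  (forall e, 0 < e -> \forall t \near 0^'+, `|g t - f t| <= e * f t) -> positive_near0 g.
Proof.
move=> f0 gf; have h20 : 0 < 2^-1 :> R by lra.
have h := gf _ h20; near=> t.
have ft : 0 < f t by near: t; exact: f0.
have : `|g t - f t| <= 2^-1 * f t by near: t.
by rewrite ler_norml => /andP[h1 _]; lra.
Unshelve. all: by end_near. Qed.

Lemma equiv_cvg1 f g : positive_near0 f ->
  (forall e, 0 < e -> \forall t \near 0^'+, `|g t - f t| <= e * f t) ->
  g t / f t @[t --> 0^'+] --> (1 : R).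
Proof.
move=> f0 gf; apply/cvgrPdist_le => e e0; have h := gf _ e0; near=> t.
have ft : 0 < f t by near: t; exact: f0.
have -> : 1 - g t / f t = - ((g t - f t) / f t) by field; rewrite gt_eqF.
by rewrite normrN normf_div (gtr0_norm ft) ler_pdivrMr //; near: t.
Unshelve. all: by end_near. Qed.

Lemma equiv_scaling rho f g : positive_near0 f ->
  (forall e, 0 < e -> \forall t \near 0^'+, `|g t - f t| <= e * f t) ->
  power_scaling_at0 rho f -> power_scaling_at0 rho g.
Proof.
move=> f0 gf sf x x0; have g0 := equiv_positive f0 gf.
have h1 := equiv_cvg1 f0 gf.
have h2 := cvg_near0_scale x0 h1.
have h3 : (g t / f t)^-1 @[t --> 0^'+] --> (1 : R)^-1 by apply: cvgV h1; exact: oner_neq0.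
have -> : x `^ rho = 1 * x `^ rho * 1^-1 by rewrite invr1 mulr1 mul1r.
have h4 : (g (x * t) / f (x * t)) * (f (x * t) / f t) * (g t / f t)^-1
    @[t --> 0^'+] --> 1 * x `^ rho * 1^-1.
  by apply: cvgM => //; apply: cvgM => //; exact: sf.
apply: cvg_trans h4; apply: near_eq_cvg.
have f0' := near0_scale x0 f0.
near=> t.
have ft : f t != 0 by rewrite gt_eqF //; near: t; exact: f0.
have gt : g t != 0 by rewrite gt_eqF //; near: t; exact: g0.
have fxt : f (x * t) != 0 by rewrite gt_eqF //; near: t; exact: f0'.
by rewrite /=; field; rewrite ft gt fxt.
Unshelve. all: by end_near. Qed.

Lemma equiv_to0 f g : positive_near0 f ->
  (forall e, 0 < e -> \forall t \near 0^'+, `|g t - f t| <= e * f t) ->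
  (forall e, 0 < e -> \forall t \near 0^'+, f t < e) ->
  forall e, 0 < e -> \forall t \near 0^'+, g t < e.
Proof.
move=> f0 gf fz e e0; have e20 : 0 < e / 2 by lra.
have h1 := fz _ e20; have h2 := gf _ ltr01; near=> t.
have : f t < e / 2 by near: t.
have : `|g t - f t| <= 1 * f t by near: t.
by rewrite ler_norml => /andP[_ h3]; lra.
Unshelve. all: by end_near. Qed.

Lemma between_close e p q u v x y : `|u - p * x| <= e / 2 * x ->
  `|v - q * x| <= e / 2 * x -> p * x <= (1 + e / 2) * x ->
  (1 - e / 2) * x <= q * x -> v <= y -> y <= u -> `|y - x| <= e * x.
Proof.
rewrite !ler_norml => /andP[_ h1] /andP[h2 _] h3 h4 h5 h6.
by apply/andP; split; lra.
Qed.

(** Since [g (D t) = t] and [g] is close to [C], the value [C (D t)] lies between [t / (1 + eta)]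
    and [t / (1 - eta)]. Applying the increasing [f], which inverts [C] and scales like a power,
    places [D t] near [f t]. *)
Lemma inverse_equiv rho f C g D : 0 < rho -> rho <= 1 ->
  positive_near0 f -> cont_incr_near0 f ->
  (forall e, 0 < e -> \forall t \near 0^'+, f t < e) ->
  power_scaling_at0 rho f -> inverse_near0 f C ->
  (forall e, 0 < e -> \forall r \near 0^'+, `|g r - C r| <= e * C r) ->
  positive_near0 g -> cont_incr_near0 g ->
  (forall e, 0 < e -> \forall t \near 0^'+, g t < e) ->
  inverse_near0 g D ->
  forall e, 0 < e -> \forall t \near 0^'+, `|D t - f t| <= e * f t.
Proof.
move=> rho0 rho1 f0 cif fz sf fC gC g0 cig gz gD e e0.
pose eta := Num.min (e / 4) 2^-1.
have eta0 : 0 < eta by rewrite lt_min; apply/andP; split; lra.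
have eta4 : eta <= e / 4 by rewrite ge_min lexx.
have eta2 : eta <= 2^-1 by rewrite ge_min lexx orbT.
have x10 : 0 < (1 - eta)^-1 by rewrite invr_gt0; lra.
have x20 : 0 < (1 + eta)^-1 by rewrite invr_gt0; lra.
have e20 : 0 < e / 2 by lra.
have x12 : (1 - eta)^-1 <= 2 by rewrite -[leRHS]invrK lef_pV2 ?posrE ?invr_gt0 //; lra.
(* As [rho <= 1] and the base is at least 1, the power is bounded by the base; [p2] is the symmetric
   use. *)
have p1 : (1 - eta)^-1 `^ rho <= 1 + e / 2.
  apply: le_trans (_ : (1 - eta)^-1 <= _).
    by apply: ler1_powR => //; rewrite invf_ge1; lra.
  rewrite -[leLHS]mul1r ler_pdivrMr; last lra.
  have : eta * (1 + e / 2) <= e / 2.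
    have : eta * (e / 2) <= 2^-1 * (e / 2) by apply: ler_wpM2r => //; exact: ltW.
    lra.
  lra.
have p2 : 1 - e / 2 <= (1 + eta)^-1 `^ rho.
  apply: le_trans (_ : (1 + eta)^-1 <= _); last first.
    by apply: ger1_powR => //; rewrite x20 invf_le1; lra.
  apply: le_trans (_ : 1 - eta <= _); first lra.
  rewrite -[leRHS]mul1r ler_pdivlMr; last lra.
  have : 0 <= eta * eta by rewrite mulr_ge0 // ltW.
  lra.
have s1 := power_scaling_le sf f0 x10 e20.
have s2 := power_scaling_le sf f0 x20 e20.
have [del del0 [_ incf]] := cif.
have /near0P[r0 r00 hgC] := gC _ eta0.
have del40 : 0 < del / 4 by lra.
have /near0P[r1 r10 hC] := inverse_to0 f0 cif fz fC del40.
have m0 : 0 < Num.min r0 r1 by rewrite lt_min r00.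
have hD := inverse_to0 g0 cig gz gD m0.
near=> t; have t0 : 0 < t by [].
have ft : 0 < f t by near: t; exact: f0.
have [D0 Dm gDt] : [/\ 0 < D t, D t < Num.min r0 r1 & g (D t) = t] by near: t.
move: Dm; rewrite lt_min => /andP[Dr0 Dr1].
have [c0 cdel fc] := hC _ D0 Dr1.
have := hgC _ D0 Dr0; rewrite gDt ler_norml => /andP[a1 a2].
have a3 : C (D t) <= (1 - eta)^-1 * t.
  by rewrite mulrC ler_pdivlMr; clear - a1 eta2; lra.
have a4 : (1 + eta)^-1 * t <= C (D t).
  by rewrite mulrC ler_pdivrMr; clear - a2 eta0; lra.
have tdel : t < del / 2.
  have : eta * C (D t) <= 2^-1 * C (D t) by apply: ler_wpM2r => //; exact: ltW.
  by clear - a2 cdel c0; lra.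
have u1 : 0 < (1 - eta)^-1 * t by exact: mulr_gt0.
have u2 : 0 < (1 + eta)^-1 * t by exact: mulr_gt0.
have u1d : (1 - eta)^-1 * t < del.
  apply: le_lt_trans (_ : 2 * t < _); last by clear - tdel; lra.
  by apply: ler_wpM2r => //; exact: ltW.
have cdel' : C (D t) < del by clear - cdel c0; lra.
have monof p q : 0 < p -> q < del -> p <= q -> f p <= f q.
  move=> p0 qd; rewrite le_eqVlt => /orP[/eqP ->//|pq]; apply/ltW/incf => //.
    by rewrite itv_pos p0 (lt_trans pq).
  by rewrite itv_pos (lt_trans p0).
have b1 := monof _ _ c0 u1d a3; have b2 := monof _ _ u2 cdel' a4.
rewrite fc in b1 b2.
have s1t : `|f ((1 - eta)^-1 * t) - (1 - eta)^-1 `^ rho * f t| <= e / 2 * f t by near: t.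
have s2t : `|f ((1 + eta)^-1 * t) - (1 + eta)^-1 `^ rho * f t| <= e / 2 * f t by near: t.
have q1 : (1 - eta)^-1 `^ rho * f t <= (1 + e / 2) * f t by apply: ler_wpM2r => //; exact: ltW.
have q2 : (1 - e / 2) * f t <= (1 + eta)^-1 `^ rho * f t by apply: ler_wpM2r => //; exact: ltW.
exact: between_close s1t s2t q1 q2 b2 b1.
Unshelve. all: by end_near. Qed.

End AsymptoticEquivalence.

(** * Both parts for either passage time *)

Section Assembly.
Context {R : realType} {d : measure_display} {Omega : measurableType d}.
Variables (P : probability Omega R) (X : R -> Omega -> R).
Hypothesis hX : levy_process P X.
Variables (phi : R -> R) (sphi : sided phi) (b : R).
Hypothesis b0 : 0 <= b.
Hypothesis b1 : b < 1.

Let Y (t : R) (w : Omega) : \bar R := (phi (X t w))%:E.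
Let T := upper_passage_time (fun t w => phi (X t w)) b.

Lemma sided_levy_measurable t : 0 <= t -> measurable_fun setT (fun w => phi (X t w)).
Proof. by move=> t0; exact: (sided_measurable sphi (levy_measurable hX t0)). Qed.

Lemma ratio_processP (B : R -> R) : positive_near0 B ->
  ratio_cvg1_in_prob P Y B <-> squeezed P Y B.
Proof.
move=> B0; apply: ratio_cvg1P => //; near=> t.
apply: measurableT_comp => //; apply: sided_levy_measurable; exact: ltW.
Unshelve. all: by end_near. Qed.

Lemma ratio_passageP (C : R -> R) : positive_near0 C ->
  ratio_cvg1_in_prob P T C <-> squeezed P T C.
Proof.
move=> C0; apply: ratio_cvg1P => //; near=> t.
apply: measurable_passage_time => //; first exact: sided_levy_measurable.
by move=> w s s0; apply: (sided_cvg sphi); exact: (levy_right_continuous hX).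
Unshelve. all: by end_near. Qed.

Lemma squeezed_processP (B : R -> R) : squeezed P Y B <->
  forall e : R, 0 < e -> \forall t \near 0^'+,
    whp P e [set w | `|phi (X t w) - B t| <= e * B t].
Proof.
have E e t : [set w | ((((1 - e) * B t)%:E <= Y t w) /\ (Y t w <= ((1 + e) * B t)%:E))%E] =
    [set w | `|phi (X t w) - B t| <= e * B t].
  apply/seteqP; split => w /=; rewrite /Y !lee_fin ler_norml.
    by move=> [h1 h2]; apply/andP; split; lra.
  by move=> /andP[h1 h2]; split; lra.
split=> h e e0; have := h e e0; apply: filterS => t; by rewrite E.
Qed.

Lemma norming_direct (B : R -> R) : positive_near0 B -> squeezed P Y B ->
  cont_incr_near0 (fun t => B t / t `^ b) ->
  [/\ positive_near0 (fun t => B t / t `^ b),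
      power_scaling_at0 (1 - b) (fun t => B t / t `^ b),
      (forall e, 0 < e -> \forall t \near 0^'+, B t / t `^ b < e),
      exists C : R -> R, inverse_near0 (fun t => B t / t `^ b) C &
      forall C : R -> R, inverse_near0 (fun t => B t / t `^ b) C ->
        [/\ squeezed P T C, regularly_varying_at0 (1 - b)^-1 C & cont_incr_near0 C]].
Proof.
move=> B0 /squeezed_processP HB ci.
have linB := @norming_linear _ _ _ _ _ hX _ sphi _ B0 HB.
have f0 : positive_near0 (fun t => B t / t `^ b) by exact: norming_powR_pos.
have sf : power_scaling_at0 (1 - b) (fun t => B t / t `^ b) by exact: norming_scaling.
have rho0 : 0 < 1 - b by rewrite subr_gt0.
have fz := scaling_to0 rho0 sf f0 ci.
split => //; first exact: exists_inverse.
move=> C fC; have ciC := inverse_cont_incr f0 ci fz fC.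
split => //; last first.
  split; first exact: inverse_positive fC.
    exact: cont_incr_measurable.
  exact: (inverse_scaling f0 ci fz fC rho0 sf).
move=> e e0.
have /near0P[t0 t00 ht] := passage_time_squeezed hX sphi B0 HB b0 b1 e0.
have hC := inverse_to0 f0 ci fz fC t00.
near=> r.
have [c0 ct fc] : [/\ 0 < C r, C r < t0 & B (C r) / C r `^ b = r] by near: r.
by have := ht _ c0 ct; rewrite fc.
Unshelve. all: by end_near. Qed.

Lemma norming_smooth (B : R -> R) : positive_near0 B -> squeezed P Y B ->
  exists B' : R -> R, [/\ positive_near0 B', squeezed P Y B' &
    cont_incr_near0 (fun t => B' t / t `^ b)].
Proof.
move=> B0 sB; have /squeezed_processP HB := sB.
have linB := @norming_linear _ _ _ _ _ hX _ sphi _ B0 HB.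
have [g [g0 cg gf]] := smooth_norming b0 b1 B0 linB.
exists (fun t => g t * t `^ b); split.
- near=> t; rewrite mulr_gt0 ?powR_gt0 //; near: t; exact: g0.
- apply: squeezed_equiv B0 sB _ => e e0; have h := gf e e0; near=> t.
  have tb : 0 < t `^ b by exact: powR_gt0.
  have -> : B t = B t / t `^ b * t `^ b by rewrite divfK // gt_eqF.
  rewrite -mulrBl normrM (gtr0_norm tb) mulrA; apply: ler_wpM2r; first exact: ltW.
  by near: t.
- apply: cont_incr_eq cg => t t0; rewrite mulfK // gt_eqF //; exact: powR_gt0.
Unshelve. all: by end_near. Qed.

Lemma direct_part (B : R -> R) :
  positive_near0 B -> ratio_cvg1_in_prob P Y B ->
  (exists B' : R -> R, [/\ positive_near0 B', ratio_cvg1_in_prob P Y B' &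
     cont_incr_near0 (fun t => B' t / t `^ b)]) /\
  (forall B' : R -> R, positive_near0 B' -> ratio_cvg1_in_prob P Y B' ->
     cont_incr_near0 (fun t => B' t / t `^ b) ->
     (exists C : R -> R, inverse_near0 (fun t => B' t / t `^ b) C) /\
     (forall C : R -> R, inverse_near0 (fun t => B' t / t `^ b) C ->
        ratio_cvg1_in_prob P T C /\ regularly_varying_at0 (1 - b)^-1 C)).
Proof.
move=> B0 /(ratio_processP B0) sB; split.
  have [B' [B'0 sB' ci]] := norming_smooth B0 sB.
  by exists B'; split => //; exact/ratio_processP.
move=> B' B'0 /(ratio_processP B'0) sB' ci.
have [_ _ _ exC hC] := norming_direct B'0 sB' ci; split => // C /hC[sC rv _].
by split => //; apply/ratio_passageP => //; case: rv.
Qed.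

(** The direct part turns a smoothed norming function [B] of the process into an inverse [E] that
    norms the passage time, so by uniqueness [C] and every [C'] are equivalent to [E] and inherit
    its scaling. An arbitrary [C] need not be measurable, hence only [power_scaling_at0] for it; a
    continuous [C'] is regularly varying, and its inverse recovers [B] by [inverse_equiv]. *)
Lemma converse_part (C : R -> R) :
  positive_near0 C -> ratio_cvg1_in_prob P T C ->
  [/\ power_scaling_at0 (1 - b)^-1 C,
      exists C' : R -> R, [/\ positive_near0 C', ratio_cvg1_in_prob P T C' & cont_incr_near0 C'] &
      forall C' : R -> R, positive_near0 C' -> ratio_cvg1_in_prob P T C' -> cont_incr_near0 C' ->
        [/\ regularly_varying_at0 (1 - b)^-1 C', exists D : R -> R, inverse_near0 C' D &
            forall D : R -> R, inverse_near0 C' D ->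
              ratio_cvg1_in_prob P Y (fun t => t `^ b * D t)]].
Proof.
move=> C0 /(ratio_passageP C0) sC.
have [B1 B10 /squeezed_processP sB1] := passage_norming hX sphi b0 b1 C0 sC.
have [B [B0 sB ci]] := norming_smooth B10 sB1.
have [f0 sf fz [E fE] hE] := norming_direct B0 sB ci.
have [sE [E0 mE scE] ciE] := hE E fE.
have Ez e : 0 < e -> \forall r \near 0^'+, E r < e.
  by move=> e0; apply: filterS (inverse_to0 f0 ci fz fE e0) => r [].
have rho0 : 0 < 1 - b by rewrite subr_gt0.
have rho1 : 1 - b <= 1 by rewrite lerBlDr lerDl.
have uniq (C' : R -> R) (C'0 : positive_near0 C') (sC' : squeezed P T C') :=
  squeezed_unique E0 C'0 sE sC'.
split.
- exact: equiv_scaling E0 (uniq C C0 sC) scE.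
- by exists E; split => //; exact/ratio_passageP.
- move=> C' C'0 /(ratio_passageP C'0) sC' ciC'.
  have C'E := uniq C' C'0 sC'.
  have C'z := equiv_to0 E0 C'E Ez.
  split.
  + by split => //; [exact: cont_incr_measurable|exact: equiv_scaling E0 C'E scE].
  + exact: exists_inverse.
  + move=> D C'D.
    have Df := inverse_equiv rho0 rho1 f0 ci fz sf fE C'E C'0 ciC' C'z C'D.
    have DB e : 0 < e -> \forall t \near 0^'+, `|t `^ b * D t - B t| <= e * B t.
      move=> e0; have h := Df e e0; near=> t.
      have tb : 0 < t `^ b by exact: powR_gt0.
      have -> : B t = t `^ b * (B t / t `^ b) by rewrite mulrC divfK // gt_eqF.
      rewrite -mulrBr normrM (gtr0_norm tb) mulrCA; apply: ler_wpM2l; first exact: ltW.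
      by near: t.
    apply/ratio_processP; first exact: equiv_positive B0 DB.
    exact: squeezed_equiv B0 sB DB.
Unshelve. all: by end_near. Qed.

End Assembly.

Theorem theorem3p1 (R : realType) (d : measure_display)
    (Omega : measurableType d) (P : probability Omega R)
    (X : R -> Omega -> R) (hX : levy_process P X)
    (b : R) (hb0 : 0 <= b) (hb1 : b < 1) :
  (* (a), direct part *)
  (forall B : R -> R,
     positive_near0 B ->
     ratio_cvg1_in_prob P (fun t w => (X t w)%:E) B ->
     (exists B' : R -> R,
        [/\ positive_near0 B',
            ratio_cvg1_in_prob P (fun t w => (X t w)%:E) B' &
            cont_incr_near0 (fun t => B' t / t `^ b)]) /\
     (forall B' : R -> R,
        positive_near0 B' ->
        ratio_cvg1_in_prob P (fun t w => (X t w)%:E) B' ->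
        cont_incr_near0 (fun t => B' t / t `^ b) ->
        (exists C : R -> R, inverse_near0 (fun t => B' t / t `^ b) C) /\
        (forall C : R -> R, inverse_near0 (fun t => B' t / t `^ b) C ->
           ratio_cvg1_in_prob P (upper_passage_time X b) C /\
           regularly_varying_at0 (1 - b)^-1 C)))
  /\
  (* (a), converse part *)
  (forall C : R -> R,
     positive_near0 C ->
     ratio_cvg1_in_prob P (upper_passage_time X b) C ->
     [/\ power_scaling_at0 (1 - b)^-1 C,
         exists C' : R -> R,
           [/\ positive_near0 C',
               ratio_cvg1_in_prob P (upper_passage_time X b) C' &
               cont_incr_near0 C'] &
         forall C' : R -> R,
           positive_near0 C' ->
           ratio_cvg1_in_prob P (upper_passage_time X b) C' ->
           cont_incr_near0 C' ->
           [/\ regularly_varying_at0 (1 - b)^-1 C',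
               exists D : R -> R, inverse_near0 C' D &
               forall D : R -> R, inverse_near0 C' D ->
                 ratio_cvg1_in_prob P (fun t w => (X t w)%:E)
                   (fun t => t `^ b * D t)]])
  /\
  (* (b), direct part *)
  (forall B : R -> R,
     positive_near0 B ->
     ratio_cvg1_in_prob P (fun t w => `|X t w|%:E) B ->
     (exists B' : R -> R,
        [/\ positive_near0 B',
            ratio_cvg1_in_prob P (fun t w => `|X t w|%:E) B' &
            cont_incr_near0 (fun t => B' t / t `^ b)]) /\
     (forall B' : R -> R,
        positive_near0 B' ->
        ratio_cvg1_in_prob P (fun t w => `|X t w|%:E) B' ->
        cont_incr_near0 (fun t => B' t / t `^ b) ->
        (exists C : R -> R, inverse_near0 (fun t => B' t / t `^ b) C) /\
        (forall C : R -> R, inverse_near0 (fun t => B' t / t `^ b) C ->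
           ratio_cvg1_in_prob P (two_sided_passage_time X b) C /\
           regularly_varying_at0 (1 - b)^-1 C)))
  /\
  (* (b), converse part *)
  (forall C : R -> R,
     positive_near0 C ->
     ratio_cvg1_in_prob P (two_sided_passage_time X b) C ->
     [/\ power_scaling_at0 (1 - b)^-1 C,
         exists C' : R -> R,
           [/\ positive_near0 C',
               ratio_cvg1_in_prob P (two_sided_passage_time X b) C' &
               cont_incr_near0 C'] &
         forall C' : R -> R,
           positive_near0 C' ->
           ratio_cvg1_in_prob P (two_sided_passage_time X b) C' ->
           cont_incr_near0 C' ->
           [/\ regularly_varying_at0 (1 - b)^-1 C',
               exists D : R -> R, inverse_near0 C' D &
               forall D : R -> R, inverse_near0 C' D ->
                 ratio_cvg1_in_prob P (fun t w => `|X t w|%:E)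
                   (fun t => t `^ b * D t)]]).
Proof.
have s1 : sided (fun x : R => x) by left.
have s2 : sided (fun x : R => `|x|) by right.
split; first exact: (direct_part hX s1 hb0 hb1).
split; first exact: (converse_part hX s1 hb0 hb1).
(* By conversion, [two_sided_passage_time X b] is the upper passage time of the process of absolute
   values. *)
split; first exact: (direct_part hX s2 hb0 hb1).
exact: (converse_part hX s2 hb0 hb1).
Qed.
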